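(* Let $G$ be a finite solvable group whose character graph $\Delta(G)$ is connected. If the order of $\Delta(G)$ is even, then $\Delta(G)$ has a perfect matching. If $\Delta(G)$ has no cut vertex and its order is odd, then $\Delta(G)$ is hypomatchable. The property is not necessarily true for nonsolvable groups: there exists a finite nonsolvable group $G$ whose character graph $\Delta(G)$ is connected and of even order but has no perfect matching.
   Context: For a finite group $G$, $\mathrm{Irr}(G)$ is the set of irreducible complex characters and $\mathrm{cd}(G)=\{\chi(1):\chi\in\mathrm{Irr}(G)\}$. $\rho(G)$ is the set of primes dividing some element of $\mathrm{cd}(G)$. The character graph $\Delta(G)$ is the simple undirected graph with vertex set $\rho(G)$ in which two distinct primes $p,q$ are adjacent if and only if $pq$ divides some $\chi(1)\in\mathrm{cd}(G)$. The order of a graph is its number of vertices. A cut vertex is a vertex whose deletion increases the number of connected components. A matching is a set $M$ of edges such that every vertex is incident with at most one edge of $M$; it is a perfect matching if every vertex is incident with exactly one edge of $M$. A graph is hypomatchable if for every vertex $v$ the graph obtained by deleting $v$ has a perfect matching. *)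

(* Defs.v *)
From HB Require Import structures.
From mathcomp Require Import all_boot all_order all_algebra.
From mathcomp Require Import all_fingroup all_solvable all_field all_character.

Set Implicit Arguments.
Unset Strict Implicit.
Unset Printing Implicit Defensive.

Import Order.TTheory GRing.Theory Num.Theory.
Local Open Scope nat_scope.

Record sgraph := SGraph {
  vertex :> finType;
  edge : rel vertex;
  edge_sym : symmetric edge;
  edge_irr : irreflexive edge
}.

Definition graph_order (D : sgraph) : nat := #|vertex D|.

(* The null graph (the character graph of an abelian group) counts as
   connected. *)
Definition connected_graph (D : sgraph) : Prop :=
  forall x y : D, connect (@edge D) x y.

Definition num_components (D : sgraph) : nat := n_comp (@edge D) (vertex D).

Section DeleteVertex.
Variables (D : sgraph) (v : D).

Definition del_rel : rel {x : vertex D | x != v} :=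
  fun x y => edge (val x) (val y).

Lemma del_rel_sym : symmetric del_rel.
Proof. by move=> x y; apply: edge_sym. Qed.

Lemma del_rel_irr : irreflexive del_rel.
Proof. by move=> x; apply: edge_irr. Qed.

Definition del_vertex : sgraph := SGraph del_rel_sym del_rel_irr.

End DeleteVertex.

Definition cut_vertex (D : sgraph) (v : D) : Prop :=
  num_components D < num_components (del_vertex v).

(* Edges are encoded as two-element vertex sets. *)
Definition edge_set (D : sgraph) : {set {set D}} :=
  [set [set x.1; x.2] | x : D * D & edge x.1 x.2].

Definition matching (D : sgraph) (M : {set {set D}}) : Prop :=
  M \subset edge_set D /\
  forall v : D, #|[set a in M | v \in (a : {set D})]| <= 1.

Definition perfect_matching (D : sgraph) (M : {set {set D}}) : Prop :=
  matching M /\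
  forall v : D, #|[set a in M | v \in (a : {set D})]| = 1.

Definition has_perfect_matching (D : sgraph) : Prop :=
  exists M : {set {set D}}, perfect_matching M.

Definition hypomatchable (D : sgraph) : Prop :=
  forall v : D, has_perfect_matching (del_vertex v).

Section CharacterGraph.
Variables (gT : finGroupType) (G : {group gT}).

(* 'chi_i ranges over the irreducible complex characters, with values in algC;
   its degree 'chi_i 1 is a natural number, recovered here by truncation
   (see chi_degreeE). *)
Definition chi_degree (i : Iirr G) : nat := Num.truncn ('chi_i 1%g).

Lemma chi_degreeE (i : Iirr G) : ((chi_degree i)%:R = 'chi_i 1%g :> algC)%R.
Proof. by apply/truncnK/Cnat_irr1. Qed.

Lemma chi_degree_gt0 (i : Iirr G) : 0 < chi_degree i.
Proof. by rewrite -(ltr_nat algC) chi_degreeE irr1_gt0. Qed.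

Definition cd : seq nat := undup [seq chi_degree i | i : Iirr G].

Definition rho : seq nat := undup (flatten [seq primes d | d <- cd]).

Lemma mem_rho p : (p \in rho) = prime p && has (dvdn p) cd.
Proof.
rewrite mem_undup; apply/flatten_mapP/andP => [[d dcd]|[pp /hasP[d dcd pd]]].
  by rewrite mem_primes => /and3P[pp _ pd]; split=> //; apply/hasP; exists d.
exists d => //; rewrite mem_primes pp pd andbT /=.
by move: dcd; rewrite mem_undup => /imageP[i _ ->]; apply: chi_degree_gt0.
Qed.

Definition char_adj : rel (seq_sub rho) :=
  fun p q => (p != q) && has (dvdn (val p * val q)) cd.

Lemma char_adj_sym : symmetric char_adj.
Proof. by move=> p q; rewrite /char_adj eq_sym mulnC. Qed.

Lemma char_adj_irr : irreflexive char_adj.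
Proof. by move=> p; rewrite /char_adj eqxx. Qed.

Definition char_graph : sgraph := SGraph char_adj_sym char_adj_irr.

Lemma char_graph_order : graph_order char_graph = size rho.
Proof. by rewrite /graph_order card_seq_sub ?undup_uniq. Qed.

End CharacterGraph.

(* Main.v *)
Require Import Defs.
From HB Require Import structures.
From mathcomp Require Import all_boot all_order all_algebra.
From mathcomp Require Import all_fingroup all_solvable all_field all_character.
From mathcomp Require Import zify.

(** The two positive statements are one theorem about graphs combined with one
theorem about solvable groups.

The group theory is a theorem of Palfy: among any three primes that divide
character degrees of a finite solvable group, some two have a product that
divides a character degree ([palfy_three_primes]).  Thus the character graph
has no three pairwise nonadjacent vertices.  The graph theory is that a
connected graph of even order without three pairwise nonadjacent vertices has
a perfect matching ([perfect_matching_of_no_independent_triple]).  In a maximum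
matching that misses u and v, every other vertex is adjacent to exactly one of
u and v, on the same side as its partner; connectedness gives an edge a b
between the two sides, and exchanging the partners of a and b with u and v
leaves a and b unmatched but adjacent, which contradicts maximality.
Hypomatchability follows, since the deletion of a vertex that is not a cut
vertex keeps the graph connected and creates no independent triple.

For Palfy's theorem take a minimal counterexample G with pairwise nonadjacent
primes p, q, r, and a minimal normal subgroup N, an elementary abelian s-group.
By minimality one of the three primes, say r, divides no degree of G / N; by
the converse of Ito's theorem ([Ito_converse_solvable]) G / N has a normal
abelian Sylow r-subgroup.  In either case below one obtains a group H acting on
N such that every nonprincipal character of N is fixed by Sylow p- and
q-subgroups of H that are normal and abelian in its stabilizer (property
[Sylow_fixing]).  If s differs from r, then H is the normalizer of a Sylow
r-subgroup, and the property holds because r divides every degree over a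
nonprincipal character of N, so that p and q do not.  If s = r, the Sylow
r-subgroup R is normal with central derived subgroup N, and H is a complement
of R; the property is obtained from a character of R over the given character
of N that has the same stabilizer in H ([invariant_irr_over]).

The core of the argument ([Sylow_centralises_core]) is that p and q cannot both
divide the order of the group that H induces on N.  Factor out C_H(N), let L be
the largest normal {p, q}'-subgroup of H, and consider normal subgroups L P0
and L Q0 with nontrivial P0 and Q0 of p-power and q-power order.  Partitioning
the nonprincipal characters of N by the Sylow subgroup that fixes them shows
that the number of Sylow p-subgroups of L P0 is (s^m - 1) / (s^a - 1) for some
a, where s^m = |N|.  This number divides |L|, and so does a primitive prime
divisor of s^m - 1, provided by Zsigmondy's theorem
([primitive_prime_divisor]).  As p q divides no degree of H, every element of L
is conjugate to an element that centralises P0 or Q0 ([class_covering]); such an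
element of primitive order must centralise N, which is absurd.  The cases
without primitive divisors, m at most 2 and s^m = 2^6, are treated apart.

Hence one of the primes, say p, has a Sylow subgroup P that centralises N.
When s differs from r this makes N P a normal abelian subgroup of index prime
to p, and p divides no degree at all.  When s = r, the characters of R / N
provide a second quotient of the same kind with the same value as the number
of Sylow q-subgroups; since such a quotient determines its numerator
([repunit_quotient_inj]), some index in R is equal to |N|, which
commutator calculations in R refute ([card_center_lt_index]).

For the negative statement take the direct product of the alternating group of
degree five, with degrees 1, 3, 3, 4, 5, and an extraspecial group of order
7^3, with degrees 1 and 7.  The graph of the product is a star: 7 is adjacent
to the pairwise nonadjacent 2, 3 and 5.  It is connected of order four, and a
perfect matching would match both 2 and 3 with 7. *)

Set Implicit Arguments.
Unset Strict Implicit.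
Unset Printing Implicit Defensive.
Import Order.TTheory GroupScope GRing.Theory Num.Theory.
Local Open Scope ring_scope.

(** * Matchings in graphs without independent triples *)

Section Matchings.
Local Open Scope nat_scope.
Local Open Scope group_scope.

Definition no_independent_triple (D : sgraph) :=
  forall x y z : D, x != y -> x != z -> y != z ->
  [|| edge x y, edge x z | edge y z].

Section PairingPerm.
Variable D : sgraph.
Implicit Types (s : {perm D}) (u v x y : D).

(** A set of disjoint edges is encoded as an involutive permutation, whose fixed
points are the unmatched vertices: exchanging the roles of two vertices is then
a conjugation by a transposition. *)
Definition pairing s :=
  [forall x, (s (s x) == x) && ((s x != x) ==> edge x (s x))].

Lemma pairingP s :
  reflect ((forall x, s (s x) = x) /\ forall x, s x != x -> edge x (s x)) (pairing s).
Proof.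
apply: (iffP forallP) => [Ps | [sK sE] x]; last by rewrite sK eqxx; apply/implyP/sE.
by split=> x; have /andP[/eqP ? /implyP] := Ps x.
Qed.

Definition moved s := [set x | s x != x].

Lemma moved_conj s t : #|moved (s ^ t)| = #|moved s|.
Proof.
have -> : moved (s ^ t) = t @: moved s.
  apply/setP=> x; apply/idP/imsetP=> [|[y + ->]].
    rewrite inE => nx; exists (t^-1 x); last by rewrite permKV.
    rewrite inE; apply: contra nx => /eqP fx.
    by rewrite -{1}(permKV t x) permJ fx permKV.
  by rewrite !inE permJ; apply: contra => /eqP/perm_inj->.
by rewrite card_imset //; apply: perm_inj.
Qed.

(** The exchange along an alternating path of length two: v takes over the
partner of x. Conjugation preserves the number of matched vertices. *)
Lemma pairing_rotate s v x : pairing s -> s v = v -> edge v (s x) ->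
  pairing (s ^ tperm x v).
Proof.
move=> /pairingP[sK sE] sv vsx; set t := tperm x v.
have tE z : (s ^ t) z = t (s (t z)) by rewrite -{1}(tpermK x v z) permJ.
have xv : x != v by apply: contraTneq vsx => ->; rewrite sv edge_irr.
apply/pairingP; split=> z; rewrite !tE; first by rewrite tpermK sK tpermK.
rewrite -{2 3}(tpermK x v z) -/t; set w := t z.
rewrite (inj_eq perm_inj) => /sE.
have [-> | nwv] := eqVneq w v; first by rewrite sv edge_irr.
have [-> | nwx] := eqVneq w x.
  rewrite tpermL; case: tpermP => [-> | sxv | //]; first by rewrite edge_irr.
  by move: xv; rewrite -(sK x) sxv sv eqxx.
have -> : t w = w by rewrite /t tpermD // eq_sym.
case: tpermP => [swx _ | swv | //].
  by rewrite edge_sym; rewrite -swx sK in vsx.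
by rewrite -(sK w) swv sv eqxx in nwv.
Qed.

Lemma rotate_fixed s v x y : s v = v -> s x != x -> s y = y -> y != v ->
  (s ^ tperm x v) x = x /\ (s ^ tperm x v) y = y.
Proof.
move=> sv sx sy yv; have xy : x != y by apply: contraNneq sx => ->; rewrite sy.
split; first by rewrite -{2}(tpermR x v) permJ sv tpermR.
have ty : tperm x v y = y by rewrite tpermD // eq_sym.
by rewrite -{1}ty permJ sy ty.
Qed.

Lemma pairing_add s u v : pairing s -> s u = u -> s v = v -> edge u v ->
  pairing (s * tperm u v) /\ #|moved s| < #|moved (s * tperm u v)|.
Proof.
move=> /pairingP[sK sE] su sv uv.
have nuv : u != v by apply: contraTneq uv => ->; rewrite edge_irr.
have tE z : (s * tperm u v) z = if z == u then v else if z == v then u else s z.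
  rewrite permM; have [-> | zu] := eqVneq z u; first by rewrite su tpermL.
  have [-> | zv] := eqVneq z v; first by rewrite sv tpermR.
  rewrite tpermD // eq_sym.
    by apply: contraNneq zu => szu; rewrite -(sK z) szu su.
  by apply: contraNneq zv => szv; rewrite -(sK z) szv sv.
split.
  apply/pairingP; split=> z; rewrite !tE.
    have [-> | zu] := eqVneq z u; first by rewrite eq_sym (negPf nuv) eqxx.
    have [-> | zv] := eqVneq z v; first by rewrite eqxx.
    rewrite ifN; last by apply: contraNneq zu => szu; rewrite -(sK z) szu su.
    by rewrite ifN //; apply: contraNneq zv => szv; rewrite -(sK z) szv sv.
  have [-> | zu] := eqVneq z u; first by [].
  by have [-> | zv] := eqVneq z v; [rewrite edge_sym | apply: sE].
apply/proper_card/properP; split.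
  apply/subsetP=> z; rewrite !inE tE => sz.
  rewrite !ifN //; first by apply: contraNneq sz => ->; rewrite sv.
  by apply: contraNneq sz => ->; rewrite su.
exists u; last by rewrite inE su eqxx.
by rewrite inE tE eqxx eq_sym.
Qed.

Definition maximal_pairing s :=
  pairing s /\ forall t, pairing t -> #|moved t| <= #|moved s|.

Lemma maximal_pairing_exists : exists s, maximal_pairing s.
Proof.
have P1 : pairing (1 : {perm D}).
  by apply/pairingP; split=> x; rewrite !perm1 ?eqxx.
by case: (arg_maxnP (fun s => #|moved s|) P1) => s Ps maxs; exists s.
Qed.

Lemma maximal_fixed_nonadjacent s u v : maximal_pairing s -> s u = u -> s v = v ->
  ~~ edge u v.
Proof.
case=> Ps maxs su sv; apply/negP => uv.
have [Pt] := pairing_add Ps su sv uv.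
by rewrite ltnNge maxs.
Qed.

Lemma maximal_rotate s v x : maximal_pairing s -> s v = v -> edge v (s x) ->
  maximal_pairing (s ^ tperm x v).
Proof.
case=> Ps maxs sv vsx; split; first exact: pairing_rotate.
by move=> t; rewrite moved_conj; apply: maxs.
Qed.

(** Two unmatched vertices u and v are nonadjacent, even after an exchange: so if
v is adjacent to y, then u is not adjacent to the partner of y. Without
independent triples, every other vertex is adjacent to u or v; hence it is
adjacent to exactly one of them, the same one as its partner. Since the graph
is connected, there is an edge a b with a adjacent to u and b adjacent to v, and
two exchanges leave its end points unmatched. *)
Lemma maximal_pairing_one_fixed s u v : no_independent_triple D ->
  connected_graph D -> maximal_pairing s -> s u = u -> s v = v -> u = v.
Proof.
move=> n3 conn maxs su sv; apply/eqP; apply: contraT => nuv.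
have sK x : s (s x) = x by have [/pairingP[]] := maxs.
have nfix := maximal_fixed_nonadjacent maxs.
(* Exchange with z the partner of s y. *)
have opp w z y : s w = w -> s z = z -> w != z -> edge z y -> ~~ edge w (s y).
  move=> sw sz wz zy; have nsy : s (s y) != s y.
    by rewrite sK; apply/eqP => /esym sy; case/negP: (nfix _ _ sz sy).
  have zssy : edge z (s (s y)) by rewrite sK.
  have [fx fw] := rotate_fixed sz nsy sw wz.
  by rewrite (maximal_fixed_nonadjacent (maximal_rotate maxs sz zssy)).
have cover y : y != u -> y != v -> edge u y || edge v y.
  move=> yu yv; have := n3 u v y nuv; rewrite eq_sym yu eq_sym yv.
  by rewrite (negPf (nfix _ _ su sv)); apply.
have moving w y : s w = w -> edge w y -> s y != y.
  by move=> sw wy; apply/eqP => sy; case/negP: (nfix _ _ sw sy).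
have nsfix w y : s w = w -> s y != y -> s y != w.
  move=> sw; apply: contraNneq => sy.
  by rewrite -[X in _ == X](sK y) sy sw.
have nvu : v != u by rewrite eq_sym.
have partner w z y : s w = w -> s z = z -> w != z ->
    (forall y, y != w -> y != z -> edge w y || edge z y) ->
    edge w y -> edge w (s y) && ~~ edge z y.
  move=> sw sz wz cov wy; have nsy := moving _ _ sw wy.
  have nzsy : ~~ edge z (s y) by apply: (opp _ w) => //; rewrite eq_sym.
  have wsy : edge w (s y).
    by have := cov _ (nsfix _ _ sw nsy) (nsfix _ _ sz nsy); rewrite (negPf nzsy) orbF.
  by rewrite wsy -(sK y) (opp _ w) // eq_sym.
have partu y : edge u y -> edge u (s y) && ~~ edge v y by apply: partner.
have partv y : edge v y -> edge v (s y) && ~~ edge u y.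
  by apply: partner => // z zv zu; rewrite orbC cover.
pose B := [pred y | (y == u) || edge u y].
have [/exists_inP[a Ba /existsP[b /andP[ab nBb]]] | closedB] :=
    boolP [exists (a | B a), [exists b, edge a b && ~~ B b]]; last first.
  have clB : closed (@edge D) B.
    apply: intro_closed; first by apply: (sym_connect_sym (@edge_sym D)).
    move=> x y xy Bx; apply: contraR closedB => nBy.
    by apply/exists_inP; exists x => //; apply/existsP; exists y; rewrite xy.
  have := closed_connect clB (conn u v); rewrite !inE eqxx /= => /esym.
  by rewrite (negPf nvu) (negPf (nfix _ _ su sv)).
move: nBb; rewrite inE negb_or => /andP[bu nub].
have ua : edge u a.
  by case/orP: Ba => // /eqP au; rewrite -au ab in nub.
have /andP[usa nva] := partu a ua.
have nbv : b != v by apply: contraNneq nva => <-; rewrite edge_sym.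
have vb : edge v b by have := cover b bu nbv; rewrite (negPf nub).
have /andP[vsb _] := partv b vb.
have sa := moving _ _ su ua; have sb := moving _ _ sv vb.
have max1 := maximal_rotate maxs su usa.
have [fa fv] := rotate_fixed su sa sv nvu.
set t := s ^ _ in max1 fa fv.
(* The first exchange does not affect the pair of b, so a second one is possible. *)
have tb : t b = s b.
  have nba : b != a by apply: contraTneq ab => ->; rewrite edge_irr.
  have td : tperm a u b = b by rewrite tpermD // eq_sym.
  rewrite -{1}td permJ tpermD //.
    by apply: contraNneq nva => ->.
  by rewrite eq_sym nsfix.
have av : a != v by apply: contraTneq ua => ->; apply: nfix.
have vtb : edge v (t b) by rewrite tb.
have ntb : t b != b by rewrite tb.
have [fb fa'] := rotate_fixed fv ntb fa av.
by case/negP: (maximal_fixed_nonadjacent (maximal_rotate max1 fv vtb) fa' fb).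
Qed.

(** The cyclic group generated by the pairing is a 2-group, so fixed points and
points are equally many modulo 2. *)
Lemma odd_card_fixed s : pairing s -> odd #|[set x | s x == x]| = odd #|D|.
Proof.
move=> /pairingP[sK _].
have pS : 2.-group <[s]>.
  have s2 : s ^+ 2 = 1 by apply/permP=> x; rewrite expgS expg1 permM sK perm1.
  have: #[s] %| 2 by rewrite order_dvdn s2.
  by rewrite /pgroup -orderE => /pnat_dvd; apply.
have aS : [acts <[s]>, on [set: D] | 'P] by apply/actsP=> ? _ ? ; rewrite !inE.
have := pgroup_fix_mod pS aS; rewrite cardsT => e.
have -> : [set x | s x == x] = 'Fix_(setT | 'P)(<[s]>).
  apply/setP=> x; rewrite setTI afix_cycle inE.
  by apply/eqP/afix1P.
by have := congr1 odd e; rewrite !modn2 !oddb.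
Qed.

End PairingPerm.

Theorem perfect_matching_of_no_independent_triple (D : sgraph) :
  no_independent_triple D -> connected_graph D -> ~~ odd (graph_order D) ->
  has_perfect_matching D.
Proof.
move=> n3 conn evD; have [s maxs] := maximal_pairing_exists D.
have [Ps _] := maxs; have [sK sE] := pairingP _ Ps.
have nofix x : s x != x.
  apply/eqP => sx; have := odd_card_fixed Ps.
  suff -> : [set y | s y == y] = [set x].
    by rewrite cards1 -[#|D|]/(graph_order D) (negPf evD).
  apply/setP=> y; rewrite !inE; apply/eqP/eqP=> [sy | ->//].
  exact: maximal_pairing_one_fixed n3 conn maxs sy sx.
pose M : {set {set D}} := [set [set x; s x] | x : D].
have M1 v : [set a in M | v \in a] = [set [set v; s v]].
  apply/setP=> a; rewrite !inE; apply/andP/eqP=> [[/imsetP[x _ ->]]|->].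
    by rewrite !inE => /orP[/eqP-> // | /eqP->]; rewrite sK setUC.
  by rewrite !inE eqxx; split=> //; apply/imsetP; exists v.
exists M; split; last by move=> v; rewrite M1 cards1.
split=> [|v]; last by rewrite M1 cards1.
apply/subsetP=> a /imsetP[x _ ->]; apply/imsetP; exists (x, s x) => //.
by rewrite inE /= sE.
Qed.

Lemma del_no_independent_triple (D : sgraph) (v : D) :
  no_independent_triple D -> no_independent_triple (del_vertex v).
Proof. by move=> n3 x y z xy xz yz; apply: n3. Qed.

Lemma del_vertex_order (D : sgraph) (v : D) :
  (graph_order (del_vertex v)).+1 = graph_order D.
Proof.
rewrite /graph_order /= card_sig (cardD1 v) add1n; congr _.+1.
by apply: eq_card => x; rewrite !inE andbT.
Qed.

Lemma connected_graph_components (D : sgraph) :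
  num_components D <= 1 <-> connected_graph D.
Proof.
have symD := sym_connect_sym (@edge_sym D).
split=> [le1 x y | conn]; last first.
  rewrite /num_components leqNgt; apply/negP => /card_gt1P[x [y [+ + nxy]]].
  rewrite !inE /= !andbT => /eqP rx /eqP ry; case/negP: nxy.
  by rewrite -rx -ry root_connect //; apply: conn.
rewrite -root_connect //; apply/eqP.
apply/(card_le1_eqP le1); rewrite inE /= ?inE roots_root //.
Qed.

Theorem hypomatchable_of_no_independent_triple (D : sgraph) :
  no_independent_triple D -> connected_graph D ->
  (forall v : D, ~ cut_vertex v) -> odd (graph_order D) -> hypomatchable D.
Proof.
move=> n3 conn ncut odD v; apply: perfect_matching_of_no_independent_triple.
- exact: del_no_independent_triple.
- apply/connected_graph_components.
  apply: leq_trans (_ : num_components D <= 1); last exact/connected_graph_components.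
  by rewrite leqNgt; apply/negP; apply: ncut.
- by rewrite -[odd _]negbK -/(odd _.+1) del_vertex_order odD.
Qed.

End Matchings.

(** * Primitive prime divisors and repunits *)

Section Arithmetic.
Local Open Scope nat_scope.

(** Values of cyclotomic polynomials are taken in nat, where both their divisors
and their sizes are needed. *)
Definition cyc_val n x : nat := `| ('Phi_n).[x%:Z]%R |%N.

Lemma prod_cyc_val n x : 0 < n -> 0 < x ->
  \prod_(d <- divisors n) cyc_val d x = (x ^ n).-1.
Proof.
move=> n_gt0 x_gt0; rewrite -(big_morph absz abszM (erefl : absz 1%R = 1)).
have := congr1 (fun p => p.[x%:Z]%R) (prod_Cyclotomic n_gt0).
rewrite horner_prod hornerD hornerXn hornerN hornerC => ->.
by rewrite -rmorphXn /= -[1%R]/(Posz 1) subzn ?expn_gt0 ?x_gt0 // absz_nat subn1.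
Qed.

Lemma cyc_val_gt0 n x : 0 < n -> 1 < x -> 0 < cyc_val n x.
Proof.
move=> n_gt0 x_gt1; have := prod_cyc_val n_gt0 (ltnW x_gt1).
rewrite (big_rem n) /=; last by rewrite -dvdn_divisors.
case: (cyc_val n x) => //; rewrite mul0n => /esym/eqP.
rewrite -[_ == 0]negbK -lt0n -ltnS prednK ?expn_gt0 ?(ltnW x_gt1) //.
by rewrite -(expn0 x) ltn_exp2l // n_gt0.
Qed.

(** The n-th cyclotomic polynomial, n = d k, is one of the factors of X^n - 1
that do not occur in X^d - 1. *)
Lemma cyc_val_dvd_geometric d k x : 0 < d -> 1 < k -> 1 < x ->
  cyc_val (d * k) x %| \sum_(i < k) (x ^ d) ^ i.
Proof.
move=> d_gt0 k_gt1 x_gt1; set n := d * k; have k_gt0 := ltnW k_gt1.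
have n_gt0 : 0 < n by rewrite muln_gt0 d_gt0.
have xd1 : 0 < (x ^ d).-1.
  by rewrite -ltnS prednK ?expn_gt0 ?(ltnW x_gt1) // -(expn0 x) ltn_exp2l.
rewrite -(dvdn_pmul2l xd1) -predn_exp -expnM -/n.
rewrite -(prod_cyc_val n_gt0) ?(ltnW x_gt1) // -(prod_cyc_val d_gt0) ?(ltnW x_gt1) //.
rewrite [X in _ %| X](bigID (mem (divisors d))) /=; apply: dvdn_mul.
  have E : perm_eq [seq e <- divisors n | e \in divisors d] (divisors d).
    apply: uniq_perm; rewrite ?filter_uniq ?divisors_uniq // => e.
    rewrite mem_filter andb_idr // -!dvdn_divisors // => /dvdn_trans-> //.
    exact: dvdn_mulr.
  by rewrite -[X in _ %| X]big_filter (perm_big _ E).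
rewrite (big_rem n) /=; last by rewrite -dvdn_divisors.
rewrite -dvdn_divisors // ifT ?dvdn_mulr //.
by apply/negP=> /(dvdn_leq d_gt0); rewrite leqNgt ltn_Pmulr.
Qed.

(** Induction on d: the divisors of d t^(j+1) are those of d t^j and the products
of t^(j+1) with the divisors of d, and the identity is known for the proper
divisors of d. *)
Lemma cyc_val_prime_power d t j x :
    0 < d -> prime t -> ~~ (t %| d) -> 1 < x ->
  cyc_val (d * t ^ j.+1) x * cyc_val d (x ^ (t ^ j)) = cyc_val d (x ^ (t ^ j.+1)).
Proof.
move=> d_gt0 pr_t + x_gt1; have t_gt0 := prime_gt0 pr_t.
elim/ltn_ind: d d_gt0 => d IHd d_gt0 t'd.
have x_gt0 := ltnW x_gt1.
have [tj tj1] : 0 < t ^ j /\ 0 < t ^ j.+1 by rewrite !expn_gt0 t_gt0.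
have y_gt1 k : 0 < k -> 1 < x ^ k by move=> k0; rewrite -(expn0 x) ltn_exp2l.
have permD : perm_eq (divisors (d * t ^ j.+1))
    (divisors (d * t ^ j) ++ [seq e * t ^ j.+1 | e <- divisors d]).
  have inj_m : injective (muln^~ (t ^ j.+1)).
    by move=> a b /eqP; rewrite eqn_pmul2r // => /eqP.
  apply: uniq_perm; rewrite ?divisors_uniq ?cat_uniq ?(map_inj_uniq inj_m) ?divisors_uniq ?andbT //=.
    apply/hasPn=> _ /mapP[e De ->]; rewrite -dvdn_divisors ?muln_gt0 ?d_gt0 //.
    apply: contra t'd; rewrite expnSr [_ * (_ * t)]mulnA mulnAC.
    by rewrite dvdn_pmul2r //; apply: dvdn_trans; apply: dvdn_mull.
  move=> e; rewrite mem_cat -!dvdn_divisors ?muln_gt0 ?d_gt0 //.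
  apply/idP/orP=> [De | [|/mapP[f Df ->]]]; last 2 first.
  - by move/dvdn_trans; apply; rewrite expnSr mulnA dvdn_mulr.
  - by rewrite dvdn_pmul2r // dvdn_divisors.
  have e_gt0 : 0 < e by apply: dvdn_gt0 De; rewrite muln_gt0 d_gt0.
  have [tje | ntje] := boolP (t ^ j.+1 %| e).
    right; apply/mapP; exists (e %/ t ^ j.+1); last by rewrite divnK.
    by rewrite -dvdn_divisors // -(dvdn_pmul2r tj1) divnK.
  left; have [b co_tb De'] := pfactor_coprime pr_t e_gt0.
  rewrite De' dvdn_mul //; last first.
    by rewrite dvdn_exp2l // leqNgt -pfactor_dvdn.
  rewrite -(@Gauss_dvdl _ _ (t ^ j.+1)) ?coprimeXr 1?coprime_sym //.
  by apply: dvdn_trans De; rewrite De' dvdn_mulr.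
have := prod_cyc_val (_ : 0 < d * t ^ j.+1) x_gt0.
rewrite muln_gt0 d_gt0 tj1 => /(_ isT).
rewrite (perm_big _ permD) big_cat /= prod_cyc_val ?muln_gt0 ?d_gt0 // big_map.
rewrite ![d * _]mulnC ![x ^ (_ * d)]expnM.
rewrite -(prod_cyc_val d_gt0) ?expn_gt0 ?x_gt0 // -(prod_cyc_val d_gt0) ?expn_gt0 ?x_gt0 //.
have Dd : d \in divisors d by rewrite -dvdn_divisors.
rewrite -big_split /= !(big_rem _ Dd) /=.
set R := \prod_(_ <- _) _; set R' := \prod_(_ <- _) _.
have -> : R = R'.
  apply: eq_big_seq => e; rewrite (mem_rem_uniq _ (divisors_uniq d)) !inE.
  rewrite -dvdn_divisors // => /andP[ned De]; have e_gt0 := dvdn_gt0 d_gt0 De.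
  rewrite mulnC; apply: IHd => //; first by rewrite ltn_neqAle ned dvdn_leq.
  by apply: contra t'd => /dvdn_trans->.
have R_gt0 : 0 < R'.
  rewrite /R' big_seq; apply: prodn_cond_gt0 => e /mem_rem; rewrite -dvdn_divisors // => De.
  by rewrite cyc_val_gt0 ?y_gt1 // (dvdn_gt0 d_gt0 De).
by move/eqP; rewrite eqn_pmul2r // => /eqP <-; rewrite mulnC [t ^ _ * d]mulnC.
Qed.

(* Triangle inequality bounds over the primitive roots of unity. *)
(** Each factor x - z, with z a complex root of unity, has absolute value between
x - 1 and x + 1. *)
Lemma cyc_val_bounds n x : 0 < n -> 0 < x ->
  x.-1 ^ totient n <= cyc_val n x <= x.+1 ^ totient n.
Proof.
move=> n_gt0 x_gt0; have [z prim_z] := C_prim_root_exists n_gt0.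
have Dv : ((cyc_val n x)%:R = \prod_(k < n | coprime k n) `|x%:R - z ^+ k| :> algC)%R.
  rewrite natr_absz intr_norm; have := congr1 (fun p => p.[x%:R]%R) (Cintr_Cyclotomic prim_z).
  rewrite -[(x%:R)%R]/((Posz x)%:~R)%R horner_map /= => ->.
  rewrite /cyclotomic horner_prod normr_prod; apply: eq_bigr => k _.
  by rewrite hornerXsubC.
have z1 k : (`|z ^+ k| = 1)%R.
  rewrite normrX; suff -> : (`|z| = 1)%R by rewrite expr1n.
  apply/eqP; rewrite -(@pexpr_eq1 _ _ n) ?normr_ge0 // -normrX.
  by rewrite prim_expr_order // normr1.
have cardT : #|[pred k : 'I_n | coprime k n]| = totient n.
  rewrite totient_count_coprime -sum1_card big_mkord.
  by rewrite big_mkcond; apply: eq_bigr => k _; rewrite inE coprime_sym; case: coprime.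
have le1 : ((x.-1)%:R ^+ totient n <= (cyc_val n x)%:R :> algC)%R.
  rewrite Dv -cardT -prodr_const; apply: ler_prod => k _; rewrite ler0n /=.
  rewrite -subn1 natrB //.
  by have := lerB_dist (x%:R : algC)%R (z ^+ k)%R; rewrite z1 normr_nat.
have le2 : ((cyc_val n x)%:R <= (x.+1)%:R ^+ totient n :> algC)%R.
  rewrite Dv -cardT -prodr_const; apply: ler_prod => k _; rewrite normr_ge0 /=.
  by rewrite (le_trans (ler_normB _ _)) // z1 normr_nat -natr1.
by rewrite -!(ler_nat algC) !natrX le1.
Qed.

Lemma dvdn_predn_exp t s e : 0 < s -> (t %| (s ^ e).-1) = (s ^ e == 1 %[mod t]).
Proof. by move=> s_gt0; rewrite eqn_mod_dvd ?expn_gt0 ?s_gt0 // subn1. Qed.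

Lemma geometric_mod t y k : y = 1 %[mod t] -> \sum_(i < k) y ^ i = k %[mod t].
Proof.
move=> y1; rewrite -modn_summ.
rewrite (eq_bigr (fun=> 1 %% t)) => [|i _]; last by rewrite -modnXm y1 modnXm exp1n.
by rewrite modn_summ sum1_card card_ord.
Qed.

(** Let d be the order of s modulo t, so that d < t by Fermat's little theorem. If
d divides e and e is a proper divisor of m, then the cyclotomic value divides
(s^m - 1) / (s^e - 1), which is m / e modulo t; so t divides m / e. Applied to
all such e, this leaves only powers of t for m / d. *)
Lemma imprimitive_prime_factor t m s i :
    prime t -> 0 < s -> 0 < i < m -> t %| (s ^ i).-1 -> t %| (s ^ m).-1 -> 1 < s ->
    t %| cyc_val m s ->
  exists d j, [/\ m = d * t ^ j.+1, 0 < d, d < t & t %| (s ^ d).-1].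
Proof.
move=> pr_t s_gt0 /andP[i_gt0 ltim] ti tm s_gt1 tN.
have m_gt0 : 0 < m := ltn_trans i_gt0 ltim.
have exd : exists d, (0 < d) && (t %| (s ^ d).-1) by exists i; rewrite i_gt0.
have [d /andP[d_gt0 td] min_d] := ex_minnP exd.
have sd1 : s ^ d = 1 %[mod t] by apply/eqP; rewrite -dvdn_predn_exp.
have dvd_d e : t %| (s ^ e).-1 -> d %| e.
  rewrite dvdn_predn_exp // {1}(divn_eq e d) expnD mulnC [_ * d]mulnC expnM.
  rewrite -modnMmr -modnXm sd1 modnXm exp1n modnMmr muln1 -dvdn_predn_exp // => te.
  rewrite /dvdn -leqn0 leqNgt; apply/negP=> r_gt0.
  by have := min_d (e %% d); rewrite r_gt0 te leqNgt ltn_pmod // => /(_ isT).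
have d_dvd_m : d %| m := dvd_d m tm.
have t's : coprime t s.
  rewrite prime_coprime //; apply/negP=> ts.
  have : t %| (s ^ i).-1 + 1 by rewrite addn1 prednK ?dvdn_exp ?expn_gt0 ?s_gt0.
  by rewrite dvdn_addr // dvdn1 gtn_eqF ?prime_gt1.
have d_lt_t : d < t.
  have t1_gt0 : 0 < t.-1 by rewrite -ltnS prednK ?prime_gt1 ?prime_gt0.
  rewrite -(prednK (prime_gt0 pr_t)) ltnS dvdn_leq // dvd_d //.
  rewrite -(Gauss_dvdr _ t's) -subn1 mulnBr muln1 -expnS prednK ?prime_gt0 //.
  rewrite -eqn_mod_dvd; first by rewrite fermat_little.
  by rewrite -{1}(expn1 s) leq_exp2l // prime_gt0.
have lt_dm : d < m.
  by apply: leq_ltn_trans ltim; apply: min_d; rewrite i_gt0.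
have key e : d %| e -> e %| m -> e < m -> t %| m %/ e.
  move=> de em ltem; have e_gt0 := dvdn_gt0 m_gt0 em.
  have k_gt1 : 1 < m %/ e by rewrite ltn_divRL // mul1n.
  have := dvdn_trans tN _; rewrite -(divnK em) mulnC => /(_ _ (cyc_val_dvd_geometric e_gt0 k_gt1 s_gt1)).
  rewrite /dvdn geometric_mod //; first by rewrite mulKn.
  apply/eqP; rewrite -dvdn_predn_exp //; rewrite dvdn_predn_exp //.
  case/dvdnP: de => q ->; rewrite mulnC expnM -modnXm sd1 modnXm exp1n.
  by [].
pose k := m %/ d; have Dm : m = d * k by rewrite mulnC divnK.
have k_gt0 : 0 < k by move: m_gt0; rewrite Dm muln_gt0 => /andP[].
have [b co_tb Dk] := pfactor_coprime pr_t k_gt0.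
have b1 : b = 1.
  apply/eqP; rewrite -[_ == 1]negbK; apply/negP=> nb1.
  have b_gt0 : 0 < b by move: k_gt0; rewrite Dk muln_gt0 => /andP[].
  have b_gt1 : 1 < b by rewrite ltn_neqAle eq_sym nb1.
  pose u := pdiv b; have pr_u : prime u := pdiv_prime b_gt1.
  have u_k : u %| k by rewrite Dk dvdn_mulr // pdiv_dvd.
  pose e := d * (k %/ u); have Dme : m = e * u by rewrite -mulnA divnK.
  have e_gt0 : 0 < e by move: m_gt0; rewrite Dme muln_gt0 => /andP[].
  have := key e (dvdn_mulr _ (dvdnn d)) (_ : e %| m) _.
  rewrite {1}Dme dvdn_mulr // => /(_ isT).
  rewrite {1}Dme -[X in X < _]muln1 ltn_pmul2l // prime_gt1 // => /(_ isT).
  rewrite Dme mulKn // dvdn_prime2 // => /eqP Dt.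
  by move: co_tb; rewrite Dt prime_coprime // pdiv_dvd.
have := Dk; rewrite b1 mul1n; case: (logn t k) => [Dk1|j Dkj].
  by move: lt_dm; rewrite Dm Dk1 muln1 ltnn.
by exists d, j; rewrite -Dkj.
Qed.

(** With y = s^(m/t), which is 1 modulo t, the cyclotomic value divides
1 + y + ... + y^(t-1), and expanding modulo t^2 leaves t. For t = 2 this also
uses that y is an odd square, since m > 2. *)
Lemma imprimitive_prime_simple t m s d j :
    prime t -> 1 < s -> 2 < m -> m = d * t ^ j.+1 -> 0 < d -> d < t ->
    t %| (s ^ d).-1 ->
  ~~ (t ^ 2 %| cyc_val m s).
Proof.
move=> pr_t s_gt1 m_gt2 Dm d_gt0 ltdt td; have s_gt0 := ltnW s_gt1.
have t_gt0 := prime_gt0 pr_t; have t_gt1 := prime_gt1 pr_t.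
pose y := s ^ (d * t ^ j).
have ND : cyc_val m s %| \sum_(i < t) y ^ i.
  have -> : m = d * t ^ j * t by rewrite Dm expnSr mulnA.
  by apply: cyc_val_dvd_geometric; rewrite // muln_gt0 d_gt0 expn_gt0 t_gt0.
apply/negP=> /dvdn_trans/(_ ND).
have y1 : t %| y.-1.
  rewrite dvdn_predn_exp // expnM -modnXm.
  by move: td; rewrite dvdn_predn_exp // => /eqP->; rewrite modnXm exp1n.
have y_gt0 : 0 < y by rewrite expn_gt0 s_gt0.
have [t2 | t_odd] := even_prime pr_t.
  have d1 : d = 1 by move: ltdt; rewrite t2; case: (d) d_gt0 => [|[]].
  case: j => [|j] in Dm y ND y1 y_gt0 *; first by rewrite Dm d1 t2 in m_gt2.
  have Dy : y = (s ^ 2 ^ j) ^ 2 by rewrite /y d1 mul1n t2 expnSr expnM.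
  have s_odd : odd (s ^ 2 ^ j).
    by move: y1; rewrite t2 dvdn2 -subn1 oddB // Dy -mulnn oddM /=; case: odd.
  rewrite t2 !big_ord_recl big_ord0 /= expn0 expn1 Dy.
  rewrite -[s ^ 2 ^ j]odd_double_half s_odd; set w := _./2.
  have -> : 1 + ((1 + w.*2) ^ 2 + 0) = (w ^ 2 + w) * 2 ^ 2 + 2.
    by rewrite -mul2n; nia.
  by rewrite dvdn_addr; [move/(@dvdn_leq 4 2 isT) | exact: dvdn_mull].
have [z Dz] := dvdnP y1.
have Dy : y = (t * z).+1 by rewrite mulnC -Dz prednK.
have powy i : y ^ i = (i * (t * z)).+1 %[mod t ^ 2].
  elim: i => [|i IHi]; first by rewrite mul0n.
  rewrite expnS -modnMmr IHi modnMmr Dy.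
  have -> : (t * z).+1 * (i * (t * z)).+1 = i * z ^ 2 * t ^ 2 + (i.+1 * (t * z)).+1 by nia.
  by rewrite modnMDl.
rewrite /dvdn -modn_summ.
rewrite (eq_bigr (fun i : 'I_t => (i * (t * z)).+1 %% t ^ 2)) => [|i _]; last exact: powy.
rewrite modn_summ.
have -> : \sum_(i < t) (i * (t * z)).+1 = t + 'C(t, 2) * (t * z).
  rewrite (eq_bigr (fun i : 'I_t => 1 + i * (t * z))) // big_split /= sum1_card card_ord.
  by rewrite -big_distrl /= -bin2_sum big_mkord.
have /dvdnP[c ->] : t %| 'C(t, 2).
  apply: prime_dvd_bin => //=; rewrite ltn_neqAle t_gt1 andbT.
  by apply: contraTneq t_odd => <-.
rewrite (_ : t + _ = c * z * t ^ 2 + t); last by nia.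
rewrite modnMDl modn_small ?(gtn_eqF t_gt0) //.
by rewrite -{1}(expn1 t) ltn_exp2l.
Qed.

(** By [cyc_val_prime_power] and [cyc_val_bounds], with Y = s^(t^j), the value is
at least ((Y^t - 1) / (Y + 1))^totient(d). *)
Lemma cyc_val_gt d t j s c :
    0 < d -> prime t -> ~~ (t %| d) -> 1 < s -> 0 < c ->
    c * (s ^ (t ^ j)).+1 < ((s ^ (t ^ j)) ^ t).-1 ->
  c < cyc_val (d * t ^ j.+1) s.
Proof.
move=> d_gt0 pr_t t'd s_gt1 c_gt0 ltc; set Y := s ^ (t ^ j) in ltc.
have s_gt0 := ltnW s_gt1.
have Y_gt0 : 0 < Y by rewrite expn_gt0 s_gt0.
have := cyc_val_prime_power j d_gt0 pr_t t'd s_gt1.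
rewrite expnSr [s ^ (_ * t)]expnM -/Y => DN.
have /andP[_ ub] := cyc_val_bounds d_gt0 Y_gt0.
have Yt_gt0 : 0 < Y ^ t by rewrite expn_gt0 Y_gt0.
have /andP[lb _] := cyc_val_bounds d_gt0 Yt_gt0.
rewrite ltnNge; apply/negP=> leN.
have phi_gt0 : 0 < totient d by rewrite totient_gt0.
have: (c * Y.+1) ^ totient d < (Y ^ t).-1 ^ totient d by rewrite ltn_exp2r.
apply/negP; rewrite -leqNgt; apply: leq_trans lb _.
rewrite -DN expnMn leq_mul //; apply: leq_trans leN _.
by rewrite -{1}(expn1 c) leq_pexp2l.
Qed.

(** Zsigmondy's theorem, for exponents above two. Suppose that every prime factor
of the m-th cyclotomic value N of s divides some earlier s^i - 1. By
[imprimitive_prime_factor] two different such primes would each be smaller than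
the other, and by [imprimitive_prime_simple] the only one, t, divides N once;
so N = t. The lower bound for N contradicts this, except for 2^6 - 1. *)
Lemma primitive_prime_divisor s m :
    1 < s -> 2 < m -> ~~ ((s == 2) && (m == 6)) ->
  exists t, [/\ prime t, t %| (s ^ m).-1
    & forall i, 0 < i < m -> ~~ (t %| (s ^ i).-1)].
Proof.
move=> s_gt1 m_gt2 exc; have s_gt0 := ltnW s_gt1; have m_gt0 := ltnW (ltnW m_gt2).
set N := cyc_val m s.
have N_dvd : N %| (s ^ m).-1.
  rewrite -prod_cyc_val // (big_rem m) /= ?dvdn_mulr //.
  by rewrite -dvdn_divisors.
have split_m t : prime t -> t %| m ->
    exists d j, [/\ m = d * t ^ j.+1, 0 < d & ~~ (t %| d)].
  move=> pr_t tm; have [d co_td Dm] := pfactor_coprime pr_t m_gt0.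
  have l_gt0 : 0 < logn t m by rewrite logn_gt0 mem_primes pr_t m_gt0.
  exists d, (logn t m).-1; rewrite prednK //; split=> //.
    by move: m_gt0; rewrite Dm muln_gt0 => /andP[].
  by rewrite -prime_coprime.
have Y_gt1 t j : prime t -> 1 < s ^ (t ^ j).
  by move=> /prime_gt0 t0; rewrite -(expn0 s) ltn_exp2l // expn_gt0 t0.
have Y4 j : 2 ^ 1 < 2 ^ j.+1 -> 4 <= s ^ (2 ^ j).
  rewrite ltn_exp2l // ltnS => j_gt0; apply: (@leq_trans (2 ^ (2 ^ j))).
    change (2 ^ (2 ^ 1) <= 2 ^ (2 ^ j)).
    by rewrite (leq_exp2l (2 ^ 1) (2 ^ j)) // (leq_exp2l 1 j).
  by rewrite leq_exp2r // expn_gt0.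
have N_gt1 : 1 < N.
  have [[t [pr_t tm t_odd]] | noodd] :
      (exists t, [/\ prime t, t %| m & 2 < t]) \/ (forall t, prime t -> t %| m -> t = 2).
    case: (boolP (all (fun t => t == 2) (primes m))) => [/allP all2 | /allPn[t]].
      right=> t pr_t tm; apply/eqP/all2.
      by rewrite mem_primes pr_t m_gt0.
    rewrite mem_primes => /and3P[pr_t _ tm] nt2; left; exists t; split=> //.
    by rewrite ltn_neqAle eq_sym nt2 prime_gt1.
  - have [d [j [Dm d_gt0 t'd]]] := split_m t pr_t tm.
    rewrite /N Dm; apply: cyc_val_gt => //; set Y := s ^ _.
    have := Y_gt1 t j pr_t; rewrite -/Y => Y1.
    have : Y ^ 3 <= Y ^ t by rewrite leq_exp2l.
    by rewrite !expnS expn0; nia.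
  - have t2 : 2 %| m.
      by rewrite -(noodd (pdiv m)) ?pdiv_dvd ?pdiv_prime // (ltnW m_gt2).
    have [d [j [Dm d_gt0 t'd]]] := split_m 2 isT t2.
    have d1 : d = 1.
      apply/eqP; apply: contraR t'd => nd1; rewrite -(noodd (pdiv d)) ?pdiv_dvd //.
        by rewrite pdiv_prime // ltn_neqAle eq_sym nd1.
      by rewrite Dm dvdn_mulr ?pdiv_dvd.
    rewrite /N Dm; apply: cyc_val_gt => //.
    have m2 : 2 < 2 ^ j.+1 by move: m_gt2; rewrite Dm d1 mul1n.
    by have := Y4 j m2; set Y := s ^ _ => Y_ge4; rewrite -mulnn; nia.
case: (boolP [forall t : 'I_N.+1, (prime t && (t %| N)) ==>
     [exists i : 'I_m, (0 < i) && (t %| (s ^ i).-1)]]); last first.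
  case/forallPn=> t; rewrite negb_imply => /andP[/andP[pr_t tN] /existsPn noi].
  exists t; split=> //; first exact: dvdn_trans N_dvd.
  by move=> i /andP[i_gt0 ltim]; have := noi (Ordinal ltim); rewrite i_gt0.
move/forallP=> imprim.
have {}imprim t : prime t -> t %| N ->
    exists d j, [/\ m = d * t ^ j.+1, 0 < d, d < t & t %| (s ^ d).-1].
  move=> pr_t tN; have ltt : t < N.+1 by rewrite ltnS dvdn_leq // ltnW.
  have := imprim (Ordinal ltt); rewrite pr_t tN => /existsP[i /andP[i0 ti]].
  apply: (@imprimitive_prime_factor t m s i); rewrite ?i0 ?ltn_ord //.
  exact: dvdn_trans N_dvd.
pose t := pdiv N; have pr_t : prime t := pdiv_prime N_gt1.
have tN : t %| N := pdiv_dvd N.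
have [d [j [Dm d_gt0 ltdt td]]] := imprim t pr_t tN.
have t_gt0 := prime_gt0 pr_t; have t'd : ~~ (t %| d) by rewrite gtnNdvd.
have onlyt u : prime u -> u %| N -> u = t.
  move=> pr_u uN; have [e [k [De e_gt0 lteu _]]] := imprim u pr_u uN.
  apply/eqP; apply/idPn=> nut.
  have ue : t <= e.
    apply: dvdn_leq => //; rewrite -(@Gauss_dvdl _ _ (u ^ k.+1)) -?De.
      by rewrite Dm expnS dvdn_mull ?dvdn_mulr.
    by rewrite coprimeXr // prime_coprime // dvdn_prime2 // eq_sym.
  have td' : u <= d.
    apply: dvdn_leq => //; rewrite -(@Gauss_dvdl _ _ (t ^ j.+1)) -?Dm.
      by rewrite De expnS dvdn_mull ?dvdn_mulr.
    by rewrite coprimeXr // prime_coprime // dvdn_prime2.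
  by have := leq_ltn_trans ue lteu; rewrite ltnNge (leq_trans td' (ltnW ltdt)).
have Nt : N = t.
  have N_gt0 := ltnW N_gt1; have tpN : t.-nat N.
    by apply/pnatP=> // u pr_u uN; rewrite inE /= (onlyt u).
  have [[|[|l]] DN] := p_natP tpN; last 1 first.
  - have := imprimitive_prime_simple pr_t s_gt1 m_gt2 Dm d_gt0 ltdt td.
    by rewrite -/N DN dvdn_exp2l.
  - by move: N_gt1; rewrite DN.
  - by rewrite DN expn1.
have := @cyc_val_gt d t j s t d_gt0 pr_t t'd s_gt1 t_gt0.
rewrite -Dm -/N Nt ltnn; set Y := s ^ _ => Ygt; exfalso.
suff: is_true false by [].
have := Y_gt1 t j pr_t; rewrite -/Y => Y1.
(* t (Y + 1) < Y^t - 1 for t at least 5, as 3 t <= 2^(t-1). *)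
have [t_lt5 | t_ge5] := ltnP t 5; last first.
  have pow2 n : 4 <= n -> 3 * n.+1 <= 2 ^ n.
    elim: n => // n IHn; rewrite leq_eqVlt => /orP[/eqP[<-] // | /IHn].
    by rewrite expnS; lia.
  have := pow2 t.-1; rewrite prednK // => /(_ _) le3.
  have {}le3 : 3 * t <= 2 ^ t.-1 by apply: le3; rewrite -ltnS prednK.
  have : 2 ^ t.-1 <= Y ^ t.-1 by rewrite leq_exp2r // -ltnS prednK // prime_gt1.
  move=> le2Y; apply: Ygt; rewrite -{2}(prednK t_gt0) expnS mulnS.
  have := leq_mul (leqnn Y) (leq_trans le3 le2Y); move: (_ * Y ^ _) => Z.
  rewrite mulnCA (mulnC Y); have := leq_mul (leqnn t) Y1; move: (t * Y) => u.
  by clear -t_ge5; lia.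
have [t2 | t_odd] := even_prime pr_t.
  have d1 : d = 1 by move: ltdt; rewrite t2; case: (d) d_gt0 => [|[]].
  have : 4 <= Y.
    by rewrite /Y t2; apply: Y4; move: m_gt2; rewrite Dm d1 t2 mul1n.
  move=> Y_ge4; apply: Ygt; rewrite t2 -mulnn.
  by have := leq_mul Y_ge4 (leqnn Y); clear -Y_ge4; move: (Y * Y) => Z; lia.
have t3 : t = 3.
  by move: t_odd pr_t t_lt5; case: (t) => [|[|[|[|[|]]]]].
(* For t = 3 the estimate fails only if Y = 2, that is, s = 2 and m = 6. *)
have [Y3 | Y2] := ltnP 2 Y; first last.
  have [s2 j0] : s = 2 /\ j = 0.
    case: j @Y Y1 Y2 {Dm Ygt} => [|j] Y Y1 Y2; first by rewrite /Y expn0 expn1 in Y1 Y2; split=> //; apply/eqP; rewrite eqn_leq Y2.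
    have : 2 ^ 2 <= Y.
      apply: (@leq_trans (2 ^ (t ^ j.+1))); last by rewrite leq_exp2r // expn_gt0 t_gt0.
      rewrite leq_exp2l // t3 expnS; by apply: (@leq_mul 2 1 3 (3 ^ j)); rewrite // expn_gt0.
    by move=> /leq_trans/(_ Y2).
  case/negP: exc; rewrite s2 eqxx Dm j0 t3 expn1 /=.
  move: td ltdt; rewrite s2 t3.
  by case: (d) d_gt0 => [|[|[|]]].
apply: Ygt; rewrite t3 !expnS expn0 muln1.
have := leq_mul (leq_mul Y3 Y3) (leqnn Y); rewrite -(mulnA Y).
by clear -Y3; move: (Y * (Y * Y)) => Z; lia.
Qed.

(** Compare sizes in n r^g = r^f + n - 1, where n lies between two consecutive
powers of r. *)
Lemma repunit_exponent r n g f : 1 < r -> 1 < n -> 0 < f ->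
    n * (r ^ g).-1 = (r ^ f).-1 ->
  n * r ^ g = r ^ trunc_log r n * r ^ g + n.-1 /\ f = trunc_log r n + g.
Proof.
move=> r_gt1 n_gt1 f_gt0 Dn; have r_gt0 := ltnW r_gt1; have n_gt0 := ltnW n_gt1.
set e := trunc_log r n.
have rX k : 0 < r ^ k by rewrite expn_gt0 r_gt0.
have Df : r ^ f + n = n * r ^ g + 1.
  have := rX g; have := rX f; move: Dn; move: (r ^ f) (r ^ g) => F [|G] //=.
  by rewrite mulnS; lia.
have rf_gt1 : 1 < r ^ f by rewrite -(expn0 r) ltn_exp2l.
case: g => [|g] in Dn Df *; first by rewrite expn0 in Df; lia.
have le_n : r ^ e <= n := trunc_logP r_gt1 n_gt0.
have lt_n : n < r ^ e.+1 := trunc_log_ltn n r_gt1.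
have ub : f < e.+1 + g.+1.
  rewrite -(ltn_exp2l _ _ r_gt1) expnD.
  have := leq_mul lt_n (leqnn (r ^ g.+1)); rewrite mulSn.
  have := rX g.+1; move: Df n_gt1; move: (n * r ^ g.+1) (r ^ e.+1 * r ^ g.+1) => u v; lia.
have lb : e + g < f.
  rewrite -(ltn_exp2l _ _ r_gt1) expnD.
  have le1 := leq_mul le_n (leqnn (r ^ g)).
  have le2 : 2 * (n * r ^ g) <= n * r ^ g.+1 by rewrite expnS mulnCA leq_mul2l leq_mul2r r_gt1 !orbT.
  have le3 : n * 1 <= n * r ^ g by rewrite leq_mul.
  move: Df n_gt1 le1 le2 le3; rewrite muln1; move: (n * r ^ g) (r ^ e * r ^ g) (n * r ^ g.+1) => u v w; lia.
have ef : f = e + g.+1 by move: ub lb; lia.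
by split=> //; move: Df n_gt0; rewrite ef expnD; move: (n * r ^ g.+1) (r ^ e * r ^ g.+1) => u v; lia.
Qed.

(** By [repunit_exponent], (n - r^e) r^g = n - 1 where e is the integral part of
the logarithm of n in base r; so n determines g, and f = e + g. *)
Lemma repunit_quotient_inj r n g b f m : 1 < r -> 1 < n -> 0 < f -> 0 < m ->
    n * (r ^ g).-1 = (r ^ f).-1 -> n * (r ^ b).-1 = (r ^ m).-1 -> f = m.
Proof.
move=> r_gt1 n_gt1 f_gt0 m_gt0 Df Dm.
have [E1 ->] := repunit_exponent r_gt1 n_gt1 f_gt0 Df.
have [E2 ->] := repunit_exponent r_gt1 n_gt1 m_gt0 Dm.
set e := trunc_log r n in E1 E2 *; congr (_ + _); apply/eqP.
rewrite -(eqn_exp2l _ _ r_gt1).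
have F x : n * x = r ^ e * x + n.-1 -> (n - r ^ e) * x = n.-1.
  by rewrite mulnBl => ->; rewrite addKn.
have pos : 0 < n - r ^ e.
  by move: (F _ E1); case: (n - _) => //; rewrite mul0n; move: n_gt1; lia.
by rewrite -(eqn_pmul2l pos) (F _ E1) (F _ E2).
Qed.

End Arithmetic.

(** * Coprime action, Fitting subgroups and Sylow counting *)

Section FiniteGroups.
Local Open Scope nat_scope.
Local Open Scope group_scope.

Section GroupFacts.
Variable gT : finGroupType.
Implicit Types (A G H K L M N P Q R S X : {group gT}) (n p q : nat).

(** The Frattini argument gives G = N N_G(P). The subgroup C_N(P) is normal in G,
so by minimality it is trivial, unless P centralises N and is then normal in
G. *)
Lemma Frattini_complement p G N P :
    minnormal N G -> N \subset G -> abelian N -> p^'.-group N -> p.-Sylow(G) P ->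
    N * P <| G -> ~~ (P <| G) ->
  N ><| 'N_G(P) = G /\ 'C_N(P) = 1.
Proof.
move=> minN sNG abN p'N sylP nsNPG nnPG; have [/andP[ntN nNG] minN1] := mingroupP minN.
have sPG := pHall_sub sylP; have pP := pHall_pgroup sylP.
have sNPG := normal_sub nsNPG.
have nsNG : N <| G by apply/andP.
have nNP := subset_trans sPG nNG.
have coNP : coprime #|N| #|P| by rewrite coprime_sym (pnat_coprime pP).
have defNP : N <*> P = N * P := norm_joinEr nNP.
have sylNP : p.-Sylow(N <*> P) P.
  by apply: pHall_subl sylP; rewrite /= ?joing_subr //= defNP.
have defG : N * 'N_G(P) = G.
  have nsJG : N <*> P <| G by rewrite defNP.
  have := Frattini_arg nsJG sylNP; rewrite /= defNP => {2}<-.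
  rewrite -mulgA; congr (_ * _).
  by rewrite mulSGid // subsetI sPG normG.
have cNNP : N :&: 'N_G(P) = 'C_N(P).
  by rewrite setIA (setIidPl sNG) coprime_norm_cent.
have nCG : 'C_N(P) <| G.
  rewrite /normal subIset ?sNG // -{1}defG mul_subG //.
    by rewrite sub_abelian_norm ?subsetIl.
  rewrite normsI ?norms_cent ?subsetIr //.
  exact: subset_trans (subsetIl _ _) nNG.
have [C1 | ntC] := eqVneq 'C_N(P) 1; last first.
  have CN : 'C_N(P) = N.
    by apply: minN1; rewrite ?subsetIl // ntC normal_norm.
  case/negP: nnPG; rewrite /normal sPG -defG mul_subG ?subsetIr //.
  by apply: cents_norm; apply/setIidPl.
by split=> //; rewrite sdprodE // ?cNNP // (subset_trans (subsetIl _ _)).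
Qed.

(** A acts trivially on G / [G, A], and fixed points lift through coprime
quotients. *)
Lemma coprime_cent_prod A G :
    A \subset 'N(G) -> coprime #|G| #|A| -> solvable G ->
  [~: G, A] * 'C_G(A) = G.
Proof.
move=> nGA coGA solG; have nRA := commg_normr A G; have nRG := commg_norml G A.
have sRG : [~: G, A] \subset G by rewrite commg_subl.
have sCG : 'C_G(A) \subset G := subsetIl _ _.
apply/eqP; rewrite eqEsubset mul_subG //= -quotientSK //.
rewrite coprime_quotient_cent // subsetI subxx /=.
by rewrite quotient_cents2 // commg_normr.
Qed.

Lemma coprime_commGid A G :
    A \subset 'N(G) -> coprime #|G| #|A| -> solvable G ->
  [~: G, A, A] = [~: G, A].
Proof.
move=> nGA coGA solG; have := coprime_cent_prod nGA coGA solG.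
move/(congr1 (fun B => [~: B, A])) => {2}<-.
have nRC : 'C_G(A) \subset 'N([~: G, A, A]).
  have nRG := commg_norml G A.
  rewrite normsR ?(subset_trans _ nRG) ?subsetIl //.
  by rewrite cents_norm // subsetIr.
rewrite commMG // (commG1P (subsetIr _ _)) mulg1 //.
Qed.
End GroupFacts.

(** Otherwise let C be the centralizer of F(G) and Z its intersection with F(G). A
nontrivial abelian normal subgroup of G / Z inside C / Z lifts to a normal
subgroup whose derived subgroup is central, hence to a nilpotent one. *)
Lemma cent_sub_Fitting (gT : finGroupType) (G : {group gT}) : solvable G -> 'C_G('F(G)) \subset 'F(G).
Proof.
move=> solG; apply: contraT => nCF.
set C := 'C_G('F(G)); set Z := C :&: 'F(G).
have nsCG : C <| G by rewrite norm_normalI // norms_cent // normal_norm ?Fitting_normal.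
have nsZG : Z <| G by rewrite normalI ?Fitting_normal.
have nZG := normal_norm nsZG.
have ntCZ : C / Z != 1.
  rewrite -subG1 quotient_sub1; last exact: subset_trans (normal_sub nsCG) nZG.
  by apply: contra nCF => sCZ; apply: subset_trans sCZ (subsetIr _ _).
have [Kb [sKC nsKG ntK]] := solvable_norm_abelem
  (quotient_sol Z (solvableS (normal_sub nsCG) solG)) (quotient_normal Z nsCG) ntCZ.
case/is_abelemP=> r _ /and3P[_ abK _].
have [K defK sZK nsK] := inv_quotientN nsZG nsKG.
have sKCr : K \subset C.
  by rewrite -(quotientSGK _ (subsetIl C 'F(G))) -?defK // (subset_trans (normal_sub nsK)).
have sK'Z : K^`(1) \subset 'Z(K).
  rewrite subsetI der_sub (subset_trans (der1_min _ _ : _ \subset Z)) //.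
  - exact: subset_trans (normal_sub nsK) nZG.
  - by rewrite -defK.
  apply: subset_trans (subsetIr _ _) _; rewrite centsC (subset_trans sKCr) ?subsetIr //.
have nilK : nilpotent K.
  by rewrite -quotient_center_nil abelian_nil // sub_der1_abelian.
case/eqP: ntK; rewrite defK; apply/trivgP; rewrite quotient_sub1.
  by rewrite subsetI sKCr Fitting_max.
exact: subset_trans (normal_sub nsK) nZG.
Qed.

Section SylowCounting.
Variable gT : finGroupType.
Implicit Types (A G H K L M N P Q R S T X : {group gT}) (n p q t : nat).

(** Applied with S the stabilizer of a character, this says that exactly one Sylow
subgroup of the normal subgroup X fixes the character. *)
Lemma normal_Sylow_sub_unique p H S P X :
    p.-Sylow(H) P -> P <| S -> S \subset H -> X <| H ->
  (P :&: X)%G \in 'Syl_p(X) /\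
  {in 'Syl_p(X), forall Q, (Q \subset S) = (Q == (P :&: X)%G)}.
Proof.
move=> sylP nsPS sSH nsXH; have sylPX := Hall_setI_normal nsXH sylP.
have sylPS : p.-Sylow(S) P by apply: pHall_subl sylP => //; apply: normal_sub.
split=> [|Q]; rewrite !inE // => sylQ; apply/idP/eqP=> [sQS | ->]; last first.
  by rewrite subIset // (normal_sub nsPS).
have sQP : Q \subset P.
  by rewrite (sub_normal_Hall sylPS) // (pHall_pgroup sylQ).
apply: val_inj => /=; apply/esym/(sub_pHall sylQ); rewrite ?subsetIr //.
  exact: pHall_pgroup sylPX.
by rewrite subsetI sQP (pHall_sub sylQ).
Qed.

Lemma card_Syl_coprime p L P :
    P \subset 'N(L) -> p.-group P -> p^'.-group L ->
  p.-Sylow(L <*> P) P /\ #|'Syl_p(L <*> P)| = #|L : 'C_L(P)|.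
Proof.
move=> nLP pP p'L; have coLP : coprime #|L| #|P|.
  by rewrite coprime_sym (pnat_coprime pP).
have tiLP := coprime_TIg coLP.
have defX : L <*> P = L * P := norm_joinEr nLP.
have cardX : #|L <*> P| = (#|L| * #|P|)%N by rewrite defX TI_cardMg.
have sylP : p.-Sylow(L <*> P) P.
  rewrite /pHall joing_subr pP -divgS ?joing_subr //= cardX mulnK //.
split=> //; rewrite (card_Syl sylP) -coprime_norm_cent //.
have defN : 'N_(L <*> P)(P) = 'N_L(P) * P.
  by rewrite defX setIC -group_modr ?normG // setIC.
have cardN : #|'N_(L <*> P)(P)| = (#|'N_L(P)| * #|P|)%N.
  by rewrite defN TI_cardMg //; apply/trivgP; rewrite -tiLP setSI ?subsetIl.
rewrite -!divgS ?subsetIl //= cardX cardN divnMr //.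
Qed.

(** Let T be a P-invariant Sylow t-subgroup of L that contains a Sylow t-subgroup
of C_L(P). The t-part in question is |T : C_T(P)|, that is, the number of Sylow
p-subgroups of T P, to which Sylow's congruence applies. *)
Lemma card_Syl_part_mod p t L P :
    prime p -> solvable L -> P \subset 'N(L) -> p.-group P -> p^'.-group L ->
  (#|'Syl_p(L <*> P)|`_t = 1 %[mod p])%N.
Proof.
move=> pr_p solL nLP pP p'L; have [_ ->] := card_Syl_coprime nLP pP p'L.
have coLP : coprime #|L| #|P| by rewrite coprime_sym (pnat_coprime pP).
have [T0 sylT0] := Sylow_exists t 'C_L(P).
have sT0C := pHall_sub sylT0; have sT0L := subset_trans sT0C (subsetIl _ _).
have cT0P : P \subset 'C(T0).
  by rewrite centsC (subset_trans sT0C) ?subsetIr.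
have [T [sylT nTP sT0T]] := coprime_Hall_subset nLP coLP solL sT0L
  (pHall_pgroup sylT0) (cents_norm cT0P).
have sTL := pHall_sub sylT.
have defT0 : 'C_T(P) = T0.
  apply: (sub_pHall sylT0); rewrite ?setSI //.
    exact: pgroupS (subsetIl _ _) (pHall_pgroup sylT).
  by rewrite subsetI sT0T centsC.
have [_ cardT] := card_Syl_coprime nTP pP (pgroupS sTL p'L).
have -> : (#|L : 'C_L(P)|`_t)%N = #|'Syl_p(T <*> P)|.
  rewrite cardT defT0 -divgS // (card_Hall sylT) (card_Hall sylT0).
  by rewrite -(Lagrange (subsetIl L 'C(P))) partnM ?mulKn ?part_gt0.
by rewrite card_Syl_mod // modn_small ?prime_gt1.
Qed.

(** Jordan's lemma: A has at most |L : A| conjugates, and they all contain the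
identity, so they have too few elements to cover L unless A = L. *)
Lemma conjugates_cover L A :
    A \subset L -> {in L, forall l, exists2 g, g \in L & l ^ g \in A} -> A :=: L.
Proof.
move=> sAL coverA; apply/eqP; rewrite eqEcard sAL /=.
have sLc : L^# \subset cover (A^# :^: L).
  apply/subsetP=> l /setD1P[l1 Ll]; have [g Lg Alg] := coverA l Ll.
  apply/bigcupP; exists (A^# :^ g^-1); first by apply: imset_f; rewrite groupV.
  by rewrite mem_conjg invgK !inE Alg conjg_eq1 l1.
have := leq_trans (subset_leq_card sLc) (leq_card_cover _).
rewrite (eq_bigr (fun=> #|A^#|)) => [|_ /imsetP[x _ ->]]; last by rewrite cardJg.
rewrite sum_nat_const card_conjugates => le1.
have le2 : #|L : 'N_L(A^#)| <= #|L : A|.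
  by apply: dvdn_leq => //; apply: indexgS; rewrite /= subsetI sAL normD1 normG.
have := leq_trans le1 (leq_mul le2 (leqnn _)).
have cardD (B : {group gT}) : #|B^#| = #|B|.-1 by rewrite (cardsD1 1 B) group1.
rewrite !cardD -(Lagrange sAL); have := cardG_gt0 A; have := indexg_gt0 L A.
move: #|A| #|_ : _| => [|a] [|[|i]] // _ _; first by rewrite muln1.
by rewrite mulSn [(i.+2 * a)%N]mulnC addSn /= -{2}[(a * i.+2)%N]add0n leq_add2r.
Qed.

(** The Fitting subgroup of the quotient is a {p, q}-group. If it were a q-group,
it would lie in the image of Q, which P centralises; as the Fitting subgroup
contains its centralizer, P would then have trivial image. *)
Lemma pcore_quotient_neq1 p q H P Q (pi := pred2 p q) :
    solvable H -> prime p -> prime q -> p.-Sylow(H) P -> q.-Sylow(H) Q -> P \subset 'C(Q) ->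
    p %| #|H| -> p != q ->
  'O_p(H / 'O_pi^'(H)) != 1.
Proof.
move=> solH pr_p pr_q sylP sylQ cPQ pH npq; set L := 'O_pi^'(H).
have nLH : H \subset 'N(L) by apply: normal_norm (pcore_normal _ _).
apply/eqP=> Op1; have solHL := quotient_sol L solH.
have qF : q.-group 'F(H / L).
  apply/pgroupP=> r pr_r rF; rewrite inE; apply: contraLR (erefl true) => nrq.
  have ntOr : 'O_r(H / L) != 1.
    rewrite -p_core_Fitting -cardG_gt1.
    rewrite (card_Hall (nilpotent_pcore_Hall r (Fitting_nil (H / L)))).
    by rewrite p_part_gt1 mem_primes pr_r rF cardG_gt0.
  case/eqP: ntOr; have [-> // | nrp] := eqVneq r p.
  apply/trivgP; rewrite -(trivg_pcore_quotient pi^' H) pcore_max ?pcore_normal //.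
  apply: pi_pgroup (pcore_pgroup r _) _.
  by rewrite !inE negb_or nrp.
have sFQ : 'F(H / L) \subset Q / L.
  have sylQL := quotient_pHall (subset_trans (pHall_sub sylQ) nLH) sylQ.
  by rewrite (normal_sub_max_pgroup (Hall_max sylQL)) // Fitting_normal.
have sPF : P / L \subset 'F(H / L).
  apply: subset_trans _ (cent_sub_Fitting solHL).
  rewrite subsetI quotientS ?(pHall_sub sylP) //.
  by apply: subset_trans _ (centS sFQ); rewrite quotient_cents.
have PL1 : P / L = 1.
  have pPL := quotient_pgroup L (pHall_pgroup sylP).
  have qPL : q.-group (P / L) := pgroupS sPF qF.
  apply: card1_trivg; apply: (pnat_1 pPL).
  by apply: pi_pnat qPL _; rewrite !inE eq_sym.
have sPL : P \subset L by rewrite -quotient_sub1 ?PL1 // (subset_trans (pHall_sub sylP)).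
have: p.-group P := pHall_pgroup sylP.
have p'P : p^'.-group P.
  apply: sub_pgroup (pgroupS sPL (pcore_pgroup _ _)) => r.
  by rewrite !inE negb_or => /andP[].
move=> pP; have P1 : #|P| = 1%N := pnat_1 pP p'P.
by have := card_Hall sylP; rewrite P1 => /esym/eqP; rewrite p_part_eq1 mem_primes pr_p pH cardG_gt0.
Qed.
End SylowCounting.

End FiniteGroups.

(** * Primes dividing character degrees, and the theorems of Ito *)

Definition degree_divisor (gT : finGroupType) (G : {group gT}) (n : nat) :=
  [exists i : Iirr G, n %| chi_degree i]%N.

Section DegreeDivisors.
Variable gT : finGroupType.
Implicit Types (G H K L N X : {group gT}) (n p q : nat).

Lemma chi_degree_eq (aT rT : finGroupType) (G : {group aT}) (H : {group rT})
    (i : Iirr G) (j : Iirr H) :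
  ('chi_i 1%g = 'chi_j 1%g -> chi_degree i = chi_degree j).
Proof. by rewrite /chi_degree => ->. Qed.

Lemma chi_degreeM (aT rT : finGroupType) (G : {group aT}) (H : {group rT})
    (i : Iirr G) (j : Iirr H) n :
  ('chi_i 1%g = n%:R * 'chi_j 1%g -> chi_degree i = (n * chi_degree j)%N).
Proof.
rewrite -!chi_degreeE -natrM => /eqP; rewrite eqr_nat => /eqP-> //.
Qed.

Lemma pgroup_degree (p : nat_pred) G (i : Iirr G) :
  p.-group G -> p.-nat (chi_degree i).
Proof.
move=> pG; apply: pnat_dvd pG; have := dvd_irr1_cardG i.
by rewrite -chi_degreeE dvdC_nat.
Qed.

Lemma pgroup_nonlinear_degree p G (i : Iirr G) :
  p.-group G -> 'chi_i \isn't a linear_char -> (p %| chi_degree i)%N.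
Proof.
move=> /(pgroup_degree i)/p_natP[[|e] Di]; last by rewrite Di dvdn_exp.
by rewrite qualifE /= irr_char -chi_degreeE Di eqxx.
Qed.

Lemma chi_degree_constt_Res G H (i : Iirr G) (j : Iirr H) :
  H <| G -> j \in irr_constt ('Res[H] 'chi_i) ->
  (chi_degree j %| chi_degree i)%N.
Proof.
move=> nsHG cj; have [n /chi_degreeM ->] := dvdn_constt_Res1_irr1 nsHG cj.
exact: dvdn_mull.
Qed.

Lemma degree_divisor_quotient G H n :
  H <| G -> degree_divisor (G / H)%G n -> degree_divisor G n.
Proof.
move=> nsHG /existsP[j nj]; apply/existsP; exists (mod_Iirr j).
by rewrite (chi_degree_eq (j := j)) // mod_IirrE // cfMod1.
Qed.

Lemma degree_divisor_sdprod G N H n :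
  N ><| H = G -> degree_divisor H n -> degree_divisor G n.
Proof.
move=> defG /existsP[j nj]; apply/existsP; exists (sdprod_Iirr defG j).
rewrite (chi_degree_eq (j := j)) // sdprod_IirrE.
by rewrite cfSdprod1.
Qed.

Lemma index_inertia_dvd G H (i : Iirr G) (j : Iirr H) :
  H <| G -> j \in irr_constt ('Res[H] 'chi_i) ->
  (#|G : 'I_G['chi_j]| %| chi_degree i)%N.
Proof.
move=> nsHG cj; have := Clifford_Res_sum_cfclass nsHG cj.
move/(congr1 (fun phi : 'CF(H) => phi 1%g)); rewrite cfResE ?normal_sub //.
rewrite cfunE sum_cfunE.
have /natrP[n ->]: ('['Res[H] 'chi_i, 'chi_j] \in Num.nat).
  by rewrite Cnat_cfdot_char ?cfRes_char ?irr_char.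
rewrite big_seq (eq_bigr (fun=> 'chi_j 1%g)); last first.
  by move=> _ /cfclassP[y Gy ->]; rewrite cfConjg1.
rewrite -big_seq big_const_seq count_predT iter_addr_0 size_cfclass.
rewrite -!chi_degreeE -mulrnA -natrM => /eqP; rewrite eqr_nat => /eqP->.
by rewrite mulnA dvdn_mull.
Qed.

(** By Clifford's theorem the degree of a character is divisible by the size of the
orbit of a constituent, here a nontrivial power of p because L acts trivially. *)
Lemma pdvd_degree_over p G X L (i : Iirr G) (t : Iirr L) :
    L <| G -> X <| G -> L \subset X -> p.-group (X / L) ->
    t \in irr_constt ('Res[L] 'chi_i) -> ~~ (X \subset 'I['chi_t]) ->
  (p %| chi_degree i)%N.
Proof.
move=> nsLG nsXG sLX pXL ct nIt.
have nsLX : L <| X by apply: normalS nsLG => //; apply: normal_sub.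
have [k ck ctk]: exists2 k : Iirr X, k \in irr_constt ('Res[X] 'chi_i)
    & t \in irr_constt ('Res[L] 'chi_k).
  have Dres : 'Res[L] 'chi_i = \sum_(k in irr_constt ('Res[X] 'chi_i))
      '['Res[X] 'chi_i, 'chi_k] *: 'Res[L] 'chi_k.
    rewrite -(cfResRes _ sLX (normal_sub nsXG)).
    rewrite {1}['Res[X] 'chi_i]cfun_sum_constt linear_sum /=.
    by apply: eq_bigr => k _; rewrite linearZ.
  apply/exists_inP; apply: contraLR ct => /exists_inPn nz.
  rewrite irr_consttE negbK Dres cfdot_suml big1 // => k /nz.
  by rewrite irr_consttE negbK cfdotZl => /eqP->; rewrite mulr0.
apply: dvdn_trans (chi_degree_constt_Res nsXG ck).
apply: dvdn_trans (index_inertia_dvd nsLX ctk).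
have: p.-nat #|X : 'I_X['chi_t]|.
  apply: pnat_dvd (indexgS _ (sub_Inertia 'chi_t sLX)) _.
  by rewrite -card_quotient ?normal_norm.
move/p_natP=> [[|e] Dx]; last by rewrite Dx dvdn_exp.
case/negP: nIt; move/eqP: Dx; rewrite indexg_eq1 subsetI => /andP[_].
by [].
Qed.
End DegreeDivisors.

Section Ito.
Variable gT : finGroupType.
Implicit Types (A G H K L M N P Q R S X : {group gT}) (n p q : nat).

(** A Clifford correspondent over a character of A restricts to A as a multiple of
a linear character. So A lies in its centre, whose index its degree divides. *)
Lemma Ito_degree_dvd G A (i : Iirr G) :
  abelian A -> A <| G -> (chi_degree i %| #|G : A|)%N.
Proof.
move=> abA nsAG; have [j cj] := constt_cfRes_irr A i.
have sAG := normal_sub nsAG.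
pose I := 'I_G['chi_j]%G; have nsAI : A <| I by apply: normal_Inertia.
have [_ _ im_Ind _ _] := constt_Inertia_bijection j nsAG.
have [s cs Ds]: exists2 s, s \in irr_constt ('Ind[I] 'chi_j) & i = Ind_Iirr G s.
  by apply/imsetP; rewrite im_Ind constt_Ind_Res.
have [irrInd _ _ _ _] := constt_Inertia_bijection j nsAG.
have sIG : I \subset G := subsetIl _ _.
have Ddeg : (chi_degree i = #|G : I| * chi_degree s)%N.
  apply: chi_degreeM; rewrite Ds cfIirrE ?irrInd // cfInd1 //.
rewrite Ddeg -(Lagrange_index sIG (normal_sub nsAI)) dvdn_pmul2l ?indexg_gt0 //.
have csA : j \in irr_constt ('Res[A] 'chi_s) by rewrite -constt_Ind_Res.
have DresA := Clifford_Res_sum_cfclass nsAI csA.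
rewrite cfclass_inertia big_seq1 in DresA.
have linj : 'chi_j \is a linear_char by apply/char_abelianP.
have sAZ : A \subset 'Z('chi_s)%CF.
  apply/subsetP=> x Ax; rewrite irr_cfcenterE ?(subsetP (normal_sub nsAI)) //.
  have := cfResE 'chi_s (normal_sub nsAI); rewrite DresA => E.
  rewrite -(E _ Ax) -(E _ (group1 A)) !cfunE normrM normC_lin_char //.
  rewrite (lin_char1 linj) ger0_norm // natr_ge0 //.
  by rewrite Cnat_cfdot_char ?cfRes_char ?irr_char.
apply: dvdn_trans (indexgS _ sAZ).
have := dvd_irr1_index_center s; rewrite -chi_degreeE.
by rewrite dvdC_nat.
Qed.

Lemma Ito_normal_abelian_Sylow G P p :
    p.-Sylow(G) P -> P <| G -> abelian P -> prime p -> ~~ degree_divisor G p.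
Proof.
move=> sylP nsPG abP pr_p; apply/negP => /existsP[i pi].
have := dvdn_trans pi (Ito_degree_dvd i abP nsPG).
apply/negP; rewrite -prime_coprime //.
by have /and3P[_ _] := sylP; rewrite p'natE // prime_coprime.
Qed.

Lemma lin_char_ker (N : {group gT}) (lam : 'CF(N)) x :
  lam \is a linear_char -> x \in N -> (x \in cfker lam) = (lam x == 1).
Proof.
move=> linl Nx; rewrite cfkerEchar ?lin_charW // inE Nx.
by rewrite lin_char1.
Qed.

(** An element x fixes a linear character if and only if the character is 1 on all
[y, x] with y in N. *)
Lemma lin_char_inertia (N : {group gT}) (lam : 'CF(N)) (B : {set gT}) :
    lam \is a linear_char -> B \subset 'N(N) ->
  (B \subset 'I[lam]) = ([~: N, B] \subset cfker lam).
Proof.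
move=> linl nNB; have nNBx := subsetP nNB.
have commE y x : y \in N -> x \in B ->
    ([~ y, x] \in cfker lam) = (lam (y ^ x)%g == lam y).
  move=> Ny Bx; have Nyx : (y ^ x)%g \in N by rewrite memJ_norm ?nNBx.
  rewrite commgEl lin_char_ker //; last by rewrite groupM ?groupV.
  rewrite lin_charM ?groupV // lin_charV //.
  rewrite -(inj_eq (mulfI (lin_char_neq0 linl Ny))) mulVKf ?lin_char_neq0 //.
  by rewrite mulr1.
apply/idP/idP=> [IB | kerB]; last first.
  apply/subsetP=> x Bx; rewrite inE nNBx //=; apply/eqP/cfun_inP=> y Ny.
  rewrite cfConjgE ?nNBx //.
  have Nyx : (y ^ x^-1)%g \in N by rewrite memJ_norm ?groupV ?nNBx.
  have := subsetP kerB _ (mem_commg Nyx Bx); rewrite commE // conjgKV.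
  by move/eqP.
rewrite gen_subG; apply/subsetP=> _ /imset2P[y x Ny Bx ->].
by rewrite commE // (inertia_valJ _ (subsetP IB x Bx)).
Qed.

End Ito.

Section ItoConverse.
Implicit Types (p : nat).

Lemma normal_Sylow_abelian (gT : finGroupType) (G P : {group gT}) p :
    prime p -> p.-group P -> P <| G -> ~~ degree_divisor G p -> abelian P.
Proof.
move=> pr_p pP nsPG ndG; apply/char_abelianP => j.
have [i] := constt_cfInd_irr j (normal_sub nsPG); rewrite constt_Ind_Res => cj.
have dji := chi_degree_constt_Res nsPG cj.
apply: contraR ndG => nlin; apply/existsP; exists i.
exact: dvdn_trans (pgroup_nonlinear_degree pP nlin) dji.
Qed.

(** Coprime action gives N = [N, P], so P moves every nonprincipal character of
N. *)
Lemma pdvd_degree_nontriv_on (gT : finGroupType) (G N P : {group gT}) p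
    (i : Iirr G) :
    N <| G -> N * P <| G -> abelian N -> p.-group P -> coprime #|N| #|P| ->
    'C_N(P) = 1%g -> ~~ (N \subset cfker 'chi_i) -> (p %| chi_degree i)%N.
Proof.
move=> nsNG nsNPG abN pP coNP C1 nkN; have nNG := normal_norm nsNG.
have nNP : P \subset 'N(N).
  by apply: subset_trans nNG; apply: subset_trans (normal_sub nsNPG); apply: mulG_subr.
have [j cj] := constt_cfRes_irr N i.
have defX : N <*> P = (N * P)%g := norm_joinEr nNP.
have nsXG : N <*> P <| G by rewrite defX.
apply: (pdvd_degree_over nsNG nsXG _ _ cj); first exact: joing_subl.
  by rewrite /= joingC quotientYidr // quotient_pgroup.
have linj : 'chi_j \is a linear_char by apply/char_abelianP.
apply: contra nkN => /(subset_trans (joing_subr N P)).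
rewrite lin_char_inertia // => kerj.
have defN : [~: N, P] = N.
  by have := coprime_cent_prod nNP coNP (abelian_sol abN); rewrite C1 mulg1.
apply: constt0_Res_cfker => //; suff <-: j = 0 by [].
by apply/eqP; rewrite -subGcfker -{1}defN.
Qed.

(** Induction on the order, with a minimal normal subgroup N: by induction N P is
normal in G. If N is not a p-group and P is not normal, then C_N(P) = 1 by
[Frattini_complement], and p divides the degree of every character that is
nontrivial on N. *)
Lemma Ito_converse_solvable p (gT : finGroupType) (G P : {group gT}) :
    solvable G -> prime p -> p.-Sylow(G) P -> ~~ degree_divisor G p ->
  P <| G /\ abelian P.
Proof.
move=> solG pr_p sylP ndG.
suff nsPG : P <| G.
  by split=> //; apply: normal_Sylow_abelian ndG => //; apply: pHall_pgroup sylP.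
have [n] := ubnP #|G|; elim: n => // n IHn in gT G P solG sylP ndG *.
move=> /ltnSE-leGn.
have [G1 | ntG] := eqVneq (gval G) 1%g.
  have P1 : gval P = 1%g by apply/trivgP; rewrite -G1 (pHall_sub sylP).
  by rewrite P1 normal1.
have [N minN sNG] := minnormal_exists ntG (normG G).
have [nNG ntN abelN] := minnormal_solvable minN sNG solG.
have [s pr_s abelNs] := is_abelemP abelN; have [sN abN _] := and3P abelNs.
have nsNG : N <| G by apply/andP.
have sPG := pHall_sub sylP; have nNP := subset_trans sPG nNG.
have nsNPG : (N * P)%g <| G.
  rewrite -quotientK // -(quotientGK nsNG) cosetpre_normal.
  apply: IHn (quotient_sol _ solG) (quotient_pHall _ sylP) _ _ => //.
    by apply: contra ndG; apply: degree_divisor_quotient.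
  by rewrite (leq_trans _ leGn) // ltn_quotient.
have [Dp | s'p] := eqVneq p s.
  rewrite mulSGid // in nsNPG.
  by rewrite (normal_sub_max_pgroup (Hall_max sylP)) // Dp.
have p'N : p^'.-group N by apply: pi_pnat sN _; rewrite !inE eq_sym.
apply: contraR ndG => nnP.
have [_ C1] := Frattini_complement minN sNG abN p'N sylP nsNPG nnP.
have [i nNi] : exists i : Iirr G, ~~ (N \subset cfker 'chi_i).
  apply/existsP; apply: contraR ntN => /existsPn kerN.
  rewrite -subG1 -(TI_cfker_irr G); apply/bigcapsP=> i _.
  by rewrite -[_ \subset _]negbK kerN.
have pP := pHall_pgroup sylP.
apply/existsP; exists i; apply: pdvd_degree_nontriv_on C1 nNi => //.
by rewrite coprime_sym (pnat_coprime pP).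
Qed.
End ItoConverse.

(** * Stabilizers of characters and Brauer's permutation lemma *)

Section Stabilizer.
Variable gT : finGroupType.
Implicit Types (A G H K L M N P Q R S X : {group gT}) (n p q : nat).

(** Since S fixes lam, sending m s to lam(m) is multiplicative. *)
Lemma lin_char_extends_sdprod G M S (lam : 'CF(M)) :
    M ><| S = G -> lam \is a linear_char -> S \subset 'I[lam] ->
  exists c : Iirr G, 'Res[M] 'chi_c = lam.
Proof.
move=> defG linl IS; have [nsMG sSG mulMS nMS tiMS] := sdprod_context defG.
have sMG := normal_sub nsMG.
have memD x : x \in G -> divgr M S x \in M.
  by rewrite -mulMS => Gx; rewrite mem_divgr.
have memR x : x \in G -> remgr M S x \in S.
  by rewrite -mulMS => Gx; rewrite mem_remgr.
pose f x : 'M[algC]_1 := (lam (divgr M S x))%:M.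
have lam1 := lin_char1 linl.
have f_repr : mx_repr G f.
  split=> [|x y Gx Gy]; rewrite /f; first by rewrite divgr_id // lam1.
  rewrite -scalar_mxM; congr (_%:M).
  set rx := remgr M S x; set dy := divgr M S y.
  have Mdx := memD x Gx; have Mdy0 : dy \in M := memD y Gy.
  have Srx : rx \in S := memR x Gx; have Sry := memR y Gy.
  have Mdy : (dy ^ rx^-1)%g \in M by rewrite memJ_norm // groupV (subsetP nMS).
  have ->: (x * y = divgr M S x * dy ^ rx^-1 * (rx * remgr M S y))%g.
    rewrite {1}(divgr_eq M S x) {1}(divgr_eq M S y) -/rx -/dy !conjgE invgK.
    by rewrite !mulgA !mulgKV.
  rewrite (divgrMid tiMS (groupM Mdx Mdy) (groupM Srx Sry)) lin_charM //.
  congr (_ * _).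
  by apply: inertia_valJ; rewrite groupV (subsetP IS).
pose rG := MxRepresentation f_repr.
have lin_rG : cfRepr rG \is a linear_char.
  by rewrite qualifE /= cfRepr_char cfRepr1 eqxx.
exists (cfIirr (cfRepr rG)); rewrite cfIirrE ?lin_char_irr //.
apply/cfun_inP=> x Mx; rewrite cfResE // cfunE (subsetP sMG) // mulr1n.
by rewrite mxtrace_scalar mulr1n divgr_id.
Qed.

(** By Gallagher's theorem and the Clifford correspondence, the degrees of G over t
are the products of |G : I|, t(1) and the degrees of I / M, where I is the
stabilizer of t. So p divides neither the index nor a degree of I / M, and the
converse of Ito's theorem applies to the latter group. *)
Lemma stabilizer_Sylow p G M H (t : Iirr M) P :
    M ><| H = G -> solvable H -> prime p ->
    (exists c : Iirr 'I_G['chi_t], 'Res[M] 'chi_c = 'chi_t) ->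
    (forall i : Iirr G, t \in irr_constt ('Res[M] 'chi_i) ->
       ~~ (p %| chi_degree i)%N) ->
    p.-Sylow('I_H['chi_t]) P ->
  [/\ p.-Sylow(H) P, P <| 'I_H['chi_t] & abelian P].
Proof.
move=> defG solH pr_p [c Dc] p'deg sylP.
have [nsMG sHG mulMH nMH tiMH] := sdprod_context defG.
have sMG := normal_sub nsMG.
set S := 'I_H['chi_t]%G; set I := 'I_G['chi_t]%G.
have sMI : M \subset I by rewrite sub_Inertia.
have nsMI : M <| I by apply: normal_Inertia.
have defI : M ><| S = I.
  rewrite sdprodE.
  - by rewrite /= -mulMH -group_modl ?sub_inertia.
  - by rewrite (subset_trans _ nMH) ?subsetIl.
  by apply/trivgP; rewrite -tiMH setIS ?subsetIl.
have sIG : I \subset G := subsetIl _ _.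
have [irrMul _ cMul _] := constt_Ind_ext nsMI Dc.
have [irrInd _ im_Ind _ _] := constt_Inertia_bijection t nsMG.
have key (j : Iirr S) : ~~ (p %| #|G : I| * chi_degree j)%N.
  pose b := quo_Iirr M (sdprod_Iirr defI j).
  have Db : mod_Iirr b = sdprod_Iirr defI j.
    by rewrite quo_IirrK // sdprod_IirrE cfker_sdprod.
  pose z := mul_mod_Iirr c b.
  have Dz : 'chi_z = cfSdprod defI 'chi_j * 'chi_c.
    by rewrite cfIirrE ?irrMul // Db sdprod_IirrE.
  have cz : z \in irr_constt ('Ind[I] 'chi_t) by rewrite cMul; apply: codom_f.
  have cG : Ind_Iirr G z \in irr_constt ('Ind[G] 'chi_t).
    by rewrite -im_Ind imset_f.
  rewrite constt_Ind_Res in cG; apply: contra (p'deg _ cG) => pd.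
  apply: dvdn_trans pd _.
  have -> : chi_degree (Ind_Iirr G z) = (#|G : I| * chi_degree z)%N.
    by apply: chi_degreeM; rewrite cfIirrE ?irrInd // cfInd1.
  rewrite dvdn_pmul2l ?indexg_gt0 //.
  have -> : chi_degree z = (chi_degree c * chi_degree j)%N.
    by apply: chi_degreeM; rewrite Dz cfunE cfSdprod1 chi_degreeE mulrC.
  exact: dvdn_mull.
have ndS : ~~ degree_divisor S p.
  by apply/existsPn=> j; apply: contra (key j); apply: dvdn_mull.
have [nsPS abP] := Ito_converse_solvable (solvableS (subsetIl _ _) solH) pr_p sylP ndS.
split=> //; have [sPS pP p'SP] := and3P sylP.
have sSH : S \subset H := subsetIl _ _.
rewrite /pHall pP (subset_trans sPS sSH) -(Lagrange_index sSH sPS) pnatM p'SP andbT.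
rewrite p'natE //; apply: contra (key 0) => pHS; apply: dvdn_mulr.
rewrite -divgS //= -(sdprod_card defG) -(sdprod_card defI) divnMl ?cardG_gt0 //.
by rewrite divgS.
Qed.

End Stabilizer.

Section FixedCharacters.
Variable gT : finGroupType.
Implicit Types (A B G H K L M N P Q R S X : {group gT}) (n p q : nat).

Lemma card_Iirr_ker N M :
    N^`(1)%g \subset M -> M \subset N ->
  #|[set t : Iirr N | M \subset cfker 'chi_t]| = #|N : M|.
Proof.
move=> sN'M sMN; have nsMN := sub_der1_normal sN'M sMN.
rewrite -card_quotient ?normal_norm // -card_Iirr_abelian ?sub_der1_abelian //.
rewrite -(card_imset _ (can_inj (mod_IirrK nsMN))); apply: eq_card => t.
rewrite inE; apply/idP/imsetP=> [kt | [i _ ->]]; last first.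
  by rewrite mod_IirrE // cfker_mod.
by exists (quo_Iirr M t); rewrite ?quo_IirrK.
Qed.

Lemma lin_char_of_ker N M (t : Iirr N) :
  N^`(1)%g \subset M -> M \subset cfker 'chi_t -> 'chi_t \is a linear_char.
Proof. by move=> sN'M kM; rewrite lin_irr_der1 (subset_trans sN'M). Qed.

(** A linear character is fixed by B if and only if it is trivial on [N, B]. *)
Lemma card_Iirr_ker_fixed N M B :
    N^`(1)%g \subset M -> M \subset N -> B \subset 'N(N) ->
  #|[set t : Iirr N | (M \subset cfker 'chi_t) && (B \subset 'I['chi_t])]|
    = #|N : M <*> [~: N, B]|.
Proof.
move=> sN'M sMN nNB; rewrite -card_Iirr_ker; first last.
- by rewrite join_subG sMN commg_subl.
- exact: subset_trans (joing_subl _ _).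
apply: eq_card => t; rewrite !inE join_subG; case: (boolP (M \subset _)) => //= kM.
by rewrite lin_char_inertia // (lin_char_of_ker sN'M).
Qed.

(** Count in two ways the pairs of a nonprincipal character in T and a Sylow
subgroup that fixes it. *)
Lemma card_Syl_fixed p N X (T : {set Iirr N}) c :
    X \subset 'N(N) -> 0 \in T ->
    {in T, forall t, t != 0 -> exists2 P, P \in 'Syl_p(X) &
      {in 'Syl_p(X), forall Q, (Q \subset 'I['chi_t]) = (Q == P)}} ->
    {in 'Syl_p(X), forall Q,
      #|[set t in T | Q \subset 'I['chi_t]]| = c.+1} ->
  (#|'Syl_p(X)| * c = #|T|.-1)%N.
Proof.
move=> nNX T0 uniqP cardF.
pose T1 := T :\ 0; have -> : #|T|.-1 = #|T1| by rewrite (cardsD1 0 T) T0.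
have cardF1 Q : Q \in 'Syl_p(X) -> 
   (\sum_(t in T1) (Q \subset 'I['chi_t]) = c)%N.
  move=> sylQ; apply/eqP; rewrite -eqSS -(cardF _ sylQ); apply/eqP.
  rewrite (cardsD1 0) !inE T0 irr0 inertia1 /=.
  have -> /= : Q \subset 'N(N).
    by apply: subset_trans nNX; rewrite inE in sylQ; apply: pHall_sub sylQ.
  rewrite add1n -sum1_card big_mkcond /= [in RHS]big_mkcond /=; congr (_.+1).
  apply: eq_bigr => t _; rewrite !inE.
  by case: (t == 0) => //; case: (t \in T) => //; case: (_ \subset _).
have cardP t : t \in T1 -> (\sum_(Q in 'Syl_p(X)) (Q \subset 'I['chi_t]) = 1)%N.
  rewrite !inE => /andP[t0 Tt]; have [P sylP uP] := uniqP t Tt t0.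
  rewrite (bigD1 P) //= uP // eqxx big1 // => Q /andP[sylQ nQP].
  by rewrite uP // (negPf nQP).
have <- : (\sum_(t in T1) \sum_(Q in 'Syl_p(X)) (Q \subset 'I['chi_t]) = #|T1|)%N.
  by rewrite (eq_bigr _ cardP) sum1_card.
by rewrite exchange_big /= (eq_bigr _ cardF1) sum_nat_const.
Qed.

Lemma index_commg_conj N B M x :
  x \in 'N(N) -> x \in 'N(M) -> 
  #|N : M <*> [~: N, B :^ x]| = #|N : M <*> [~: N, B]|.
Proof.
move=> nNx nMx; have := indexJg N (M <*> [~: N, B]) x.
by rewrite conjYg conjsRg (normP nNx) (normP nMx).
Qed.

End FixedCharacters.

Section ClassCovering.
Variable gT : finGroupType.
Implicit Types (A B G H K L M N P Q R S X Y : {group gT}) (n p q : nat).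

(** Brauer's permutation lemma. *)
Lemma card_fixed_irr_classes H L x : L <| H -> x \in H ->
  #|[set t : Iirr L | x \in 'I['chi_t]]|
    = #|[set c in classes L | c :^ x == c]|.
Proof.
move=> nsLH Hx; have nLH := normal_norm nsLH; have nLx := subsetP nLH x Hx.
have act_irr : is_action H (@conjg_Iirr _ L).
  split=> [y j k eq_jk | j y z Hy Hz].
    by apply/irr_inj/(can_inj (cfConjgK y)); rewrite -!conjg_IirrE eq_jk.
  by apply: irr_inj; rewrite !conjg_IirrE (cfConjgM _ nsLH).
pose ito := Action act_irr; pose cto := ('Js \ (subsetT H))%act.
have acts_Js : [acts H, on classes L | 'Js].
  apply/subsetP=> y Hy; have nLy := subsetP nLH y Hy.
  rewrite !inE; apply/subsetP=> _ /imsetP[z Lz ->] /[!inE]/=.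
  rewrite -class_rcoset norm_rlcoset // class_lcoset.
  by apply: imset_f; rewrite memJ_norm.
have acts_cto : [acts H, on classes L | cto] by rewrite astabs_ract subsetIidl.
have := card_afix_irr_classes (ito := ito) Hx acts_cto.
have E1 : [set t : Iirr L | x \in 'I['chi_t]] = 'Fix_ito[x].
  apply/setP=> t; rewrite inE.
  have -> : (x \in 'I['chi_t]) = (conjg_Iirr t x == t).
    by rewrite inE nLx -(inj_eq irr_inj) conjg_IirrE.
  exact/eqP/afix1P.
have E2 : [set c in classes L | c :^ x == c] = 'Fix_(classes L | cto)[x].
  apply/setP=> c; rewrite !in_setI inE; congr (_ && _).
  exact/eqP/afix1P.
rewrite E1 E2; apply=> j y _ Ly /imsetP[_ /imsetP[z Lz ->] ->].
by rewrite /= conjg_IirrE cfConjgEJ // cfunJ.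
Qed.

(** Every irreducible character of L is fixed by X or by Y, since otherwise both
primes divide the degree of any character of H over it. If x in P moved a class
of L and y in Q moved the same class, then Brauer's permutation lemma, applied
to x, y and x y, would make the characters fixed by x or y as few as the classes
fixed by x or y, hence fewer than all. So P or Q
leaves invariant the class of l; its size is prime to p and q, hence it has a
fixed point. *)
Lemma class_covering p q H L X Y P Q :
    prime p -> prime q -> p != q -> L <| H -> X <| H -> Y <| H ->
    L \subset X -> L \subset Y -> p.-group (X / L) -> q.-group (Y / L) ->
    P \subset X -> p.-group P -> Q \subset Y -> q.-group Q -> P \subset 'C(Q) ->
    p^'.-group L -> q^'.-group L -> ~~ degree_divisor H (p * q) ->
  {in L, forall l, exists2 g, g \in L
     & (l ^ g \in 'C(P))%g || (l ^ g \in 'C(Q))%g}.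
Proof.
move=> pr_p pr_q npq nsLH nsXH nsYH sLX sLY pXL qYL sPX pP sQY qQ cPQ p'L q'L.
move=> nadj l Ll.
have nLH := normal_norm nsLH.
have irrXY (t : Iirr L) : (X \subset 'I['chi_t]) || (Y \subset 'I['chi_t]).
  apply: contraR nadj; rewrite negb_or => /andP[nX nY].
  have [i] := constt_cfInd_irr t (normal_sub nsLH); rewrite constt_Ind_Res => ct.
  apply/existsP; exists i; rewrite Gauss_dvd; last first.
    by rewrite prime_coprime // dvdn_prime2.
  by rewrite (pdvd_degree_over nsLH nsXH _ pXL ct) ?(pdvd_degree_over nsLH nsYH _ qYL ct).
have fixed_class (r : nat) (R : {group gT}) : r.-group R -> R \subset H -> r^'.-group L ->
    prime r -> [forall x in R, (l ^: L) :^ x == l ^: L] ->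
    exists2 g, g \in L & (l ^ g \in 'C(R))%g.
  move=> rR sRH r'L pr_r /forall_inP fixR.
  have actsR : [acts R, on l ^: L | 'J].
    apply/subsetP=> x Rx; rewrite !inE; apply/subsetP=> y cy; rewrite inE /=.
    by rewrite -(eqP (fixR x Rx)) memJ_conjg.
  have := pgroup_fix_mod rR actsR.
  have [F0 | [y]] := set_0Vmem 'Fix_(l ^: L | 'J)(R).
    rewrite F0 cards0 mod0n => /eqP dvr; case/idPn: (pr_r).
    suff: ~~ (r %| #|l ^: L|)%N by rewrite /dvdn dvr.
    rewrite -prime_coprime // -index_cent1 (coprime_dvdr (dvdn_indexg _ _)) //.
    by rewrite prime_coprime // -p'natE.
  case/setIP=> /imsetP[g Lg ->] /afixP fixg _; exists g => //.
  by apply/centP=> x /fixg /= /conjg_fixP/commgP.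
have [fixP | ] := boolP [forall x in P, (l ^: L) :^ x == l ^: L].
  have [g Lg cg] := fixed_class p P pP (subset_trans sPX (normal_sub nsXH)) p'L pr_p fixP.
  by exists g; rewrite ?cg.
have [fixQ _ | ] := boolP [forall x in Q, (l ^: L) :^ x == l ^: L].
  have [g Lg cg] := fixed_class q Q qQ (subset_trans sQY (normal_sub nsYH)) q'L pr_q fixQ.
  by exists g; rewrite ?cg ?orbT.
case/forall_inPn=> y Qy nfy /forall_inPn[x Px nfx].
have Hx : x \in H by rewrite (subsetP (normal_sub nsXH)) ?(subsetP sPX).
have Hy : y \in H by rewrite (subsetP (normal_sub nsYH)) ?(subsetP sQY).
have cxy : commute x y by apply: (centsP cPQ).
have coxy : coprime #[x] #[y].
  apply: (@pnat_coprime p); first exact: mem_p_elt pP Px.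
  by apply: pi_pnat (mem_p_elt qQ Qy) _; rewrite !inE eq_sym.
have memxy (S : {group gT}) : ((x * y)%g \in S) = (x \in S) && (y \in S).
  by rewrite -!cycle_subG cycleM // mulG_subG.
pose Ix := [set t : Iirr L | x \in 'I['chi_t]].
pose Iy := [set t : Iirr L | y \in 'I['chi_t]].
pose Cx := [set c in classes L | c :^ x == c].
pose Cy := [set c in classes L | c :^ y == c].
have cardI : #|Ix :&: Iy| = #|Cx :&: Cy|.
  have <- : [set t : Iirr L | (x * y)%g \in 'I['chi_t]] = Ix :&: Iy.
    apply/setP=> t; rewrite [LHS]in_set in_setI [X in X && _]in_set.
    by rewrite [X in _ && X]in_set; apply: (memxy 'I['chi_t]%G).
  rewrite (card_fixed_irr_classes nsLH) ?groupM //; congr #|pred_of_set _|.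
  apply/setP=> c; rewrite !inE; case: (c \in classes L) => //=.
  have nE z : (c :^ z == c) = (z \in 'N(c)%G) by apply/eqP/normP.
  by rewrite !nE memxy.
have coverI : Ix :|: Iy = setT.
  apply/setP=> t; rewrite in_setU in_setT [X in X || _]in_set [X in _ || X]in_set.
  case/orP: (irrXY t) => I_t; first by rewrite (subsetP I_t) ?(subsetP sPX).
  by rewrite orbC (subsetP I_t) ?(subsetP sQY).
have cardT : #|Ix :|: Iy| = #|classes L| by rewrite coverI cardsT card_ord NirrE.
have : Cx :|: Cy = classes L.
  apply/eqP; rewrite eqEcard; apply/andP; split.
    by apply/subsetP=> c; rewrite !inE; case/orP=> /andP[].
  have [Ex Ey] : #|Ix| = #|Cx| /\ #|Iy| = #|Cy| by rewrite !(card_fixed_irr_classes nsLH).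
  by rewrite -cardT !cardsU Ex Ey cardI.
move/setP/(_ (l ^: L)); rewrite !inE mem_classes //=.
by rewrite (negPf nfx) (negPf nfy).
Qed.
End ClassCovering.

(** * Sylow subgroups that fix the characters of an abelian normal subgroup *)

Section ConjAction.
Variables (gT : finGroupType) (N : {group gT}).

Fact conjg_Iirr_is_action : is_action 'N(N) (@conjg_Iirr _ N).
Proof.
split=> [y j k eq_jk | j y z Hy Hz].
  by apply/irr_inj/(can_inj (cfConjgK y)); rewrite -!conjg_IirrE eq_jk.
by apply: irr_inj; rewrite !conjg_IirrE cfConjgMnorm.
Qed.
Definition conjg_Iirr_action := Action conjg_Iirr_is_action.

Lemma afix_conjg_Iirr (B : {set gT}) (t : Iirr N) : B \subset 'N(N) ->
  (t \in 'Fix_conjg_Iirr_action(B)) = (B \subset 'I['chi_t]).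
Proof.
move=> nNB; have I_E x : x \in B -> (x \in 'I['chi_t]) = (conjg_Iirr t x == t).
  by move=> Bx; rewrite inE (subsetP nNB) // -(inj_eq irr_inj) conjg_IirrE.
apply/afixP/subsetP=> fixB x Bx; last by apply/eqP; rewrite -I_E ?fixB.
by rewrite I_E //; apply/eqP/fixB.
Qed.

Lemma sub_inertia_conj (B : {set gT}) (t : Iirr N) x : x \in 'N(N) ->
  (B :^ x \subset 'I['chi_(conjg_Iirr t x)]) = (B \subset 'I['chi_t]).
Proof. by move=> nNx; rewrite conjg_IirrE -conjg_inertia // conjSg. Qed.

End ConjAction.

(** For abelian N and solvable H this property means that p divides no degree of
the semidirect product of N and H over a nonprincipal character of N; see
[Sylow_fixing_of_degrees] and [degrees_of_Sylow_fixing]. *)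
Definition Sylow_fixing (gT : finGroupType) p (N H : {group gT}) :=
  forall t : Iirr N, t != 0 ->
  exists P : {group gT}, [/\ p.-Sylow(H) P, P <| 'I_H['chi_t] & abelian P].

Section SylowFixing.
Variable gT : finGroupType.
Implicit Types (A B G H K L M N P Q R S X Y : {group gT}) (n p q r s m a : nat).

Lemma card_fixed_abelian N B : abelian N -> B \subset 'N(N) ->
  #|[set t : Iirr N | B \subset 'I['chi_t]]| = #|N : [~: N, B]|.
Proof.
move=> abN nNB; have N'1 : N^`(1)%g \subset [1 gT] by rewrite (derG1P abN).
have := card_Iirr_ker_fixed N'1 (sub1G N) nNB.
rewrite /= joingE (setUidPr _) ?sub1G ?genGid // => <-.
by apply: eq_card => t; rewrite !inE sub1G.
Qed.

Lemma centralises_of_fixed N B : abelian N -> B \subset 'N(N) ->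
  #|[set t : Iirr N | B \subset 'I['chi_t]]| = #|N| -> B \subset 'C(N).
Proof.
move=> abN nNB; rewrite card_fixed_abelian // => iN.
rewrite centsC; apply/commG1P/card1_trivg/eqP.
have sRN : [~: N, B] \subset N by rewrite commg_subl.
have := Lagrange sRN; rewrite iN => /eqP.
by rewrite -{2}[#|N|]mul1n eqn_pmul2r ?cardG_gt0.
Qed.

Lemma Sylow_fixing_uniq p N H X t : Sylow_fixing p N H -> X <| H -> t != 0 ->
  exists2 P, P \in 'Syl_p(X) &
    {in 'Syl_p(X), forall Q, (Q \subset 'I['chi[N]_t]) = (Q == P)}.
Proof.
move=> fixN nsXH t0; have [P [sylP nsPS _]] := fixN t t0.
have [sylPX uP] := normal_Sylow_sub_unique sylP nsPS (subsetIl _ _) nsXH.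
exists (P :&: X)%G => // Q sylQ; rewrite -uP // subsetI andb_idl // => _.
by move: sylQ; rewrite inE => /pHall_sub/subset_trans->; rewrite ?normal_sub.
Qed.

(** Each nonprincipal character of N is fixed by exactly one Sylow p-subgroup of X,
and all these subgroups fix the same number s^a of characters. *)
Lemma card_Syl_Sylow_fixing p s m N H X P :
    abelian N -> prime s -> #|N| = (s ^ m)%N -> H \subset 'N(N) ->
    Sylow_fixing p N H -> X <| H -> P \in 'Syl_p(X) ->
  exists a, [/\ #|[set t : Iirr N | P \subset 'I['chi_t]]| = (s ^ a)%N, (a <= m)%N
              & (#|'Syl_p(X)| * (s ^ a).-1 = (s ^ m).-1)%N].
Proof.
move=> abN pr_s cardN nNH fixN nsXH sylP.
have nNX := subset_trans (normal_sub nsXH) nNH.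
have nNP : P \subset 'N(N).
  by apply: subset_trans nNX; move: sylP; rewrite inE => /pHall_sub.
have [a leam DF] : exists2 a, (a <= m)%N & #|N : [~: N, P]| = (s ^ a)%N.
  by apply/(dvdn_pfactor _ _ pr_s); rewrite -cardN dvdn_indexg.
exists a; rewrite card_fixed_abelian //; split=> //.
have sa_gt0 : (0 < s ^ a)%N by rewrite expn_gt0 prime_gt0.
have cardT : #|[set: Iirr N]| = (s ^ m)%N by rewrite cardsT card_Iirr_abelian.
rewrite -cardT; apply: (card_Syl_fixed nNX) => //; first by rewrite inE.
  by move=> t _ t0; apply: Sylow_fixing_uniq fixN nsXH t0.
move=> Q sylQ; rewrite prednK // -DF.
rewrite !inE in sylP sylQ; have [x Xx ->] := Sylow_trans sylP sylQ.
have nNx := subsetP nNX x Xx.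
rewrite -(indexJg _ _ x) conjsRg (normP nNx) -card_fixed_abelian //.
  by apply: eq_card => t; rewrite !inE.
by rewrite -(normP nNx) normJ conjSg.
Qed.

(** The order r of l does not divide the number s^a - 1 of nonprincipal characters
fixed by B, which l permutes; so l fixes a nonprincipal character. The number
s^i of characters fixed by l is congruent to s^m modulo r, so r divides
s^(m-i) - 1; as i > 0 and r is primitive, i = m. *)
Lemma fixed_by_primitive_elt r s m a N B l :
    abelian N -> #|N| = (s ^ m)%N -> prime s -> prime r -> (r %| (s ^ m).-1)%N ->
    (forall i, 0 < i < m -> ~~ (r %| (s ^ i).-1))%N ->
    (l \in 'N(N))%g -> #[l]%g = r -> (l \in 'C(B))%g -> B \subset 'N(N) ->
    #|[set t : Iirr N | B \subset 'I['chi_t]]| = (s ^ a)%N -> (0 < a < m)%N ->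
  (l \in 'C(N))%g.
Proof.
move=> abN cardN pr_s pr_r rm prim nNl ol cBl nNB cardB ltam.
have s_gt0 := prime_gt0 pr_s.
have sX_gt0 i : (0 < s ^ i)%N by rewrite expn_gt0 s_gt0.
have nNl' : <[l]> \subset 'N(N) by rewrite cycle_subG.
have nNl2 : N :^ l \subset N by move: nNl; rewrite inE.
have rl : r.-group <[l]> by rewrite /pgroup -orderE ol pnat_id.
pose to := conjg_Iirr_action N.
pose F1 := [set t : Iirr N | B \subset 'I['chi_t]] :\ 0.
have actF1 : [acts <[l]>, on F1 | to].
  rewrite cycle_subG !inE nNl2; apply/subsetP=> t; rewrite !inE /= => /andP[t0 Bt].
  rewrite conjg_Iirr_eq0 t0 /=.
  have <- : B :^ l = B by apply/normP; rewrite (subsetP (cent_sub B)).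
  by rewrite sub_inertia_conj.
have cardF1 : #|F1| = (s ^ a).-1.
  by rewrite -cardB [in RHS](cardsD1 (0 : Iirr N)) inE irr0 inertia1 nNB.
have [t Ft t0] : exists2 t, t \in 'Fix_to(<[l]>) & t != 0.
  have := pgroup_fix_mod rl actF1; rewrite cardF1.
  have [-> | [t /setIP[/setD1P[t0 _] Ft] _]] := set_0Vmem 'Fix_(F1 | to)(<[l]>); last first.
    by exists t.
  rewrite cards0 mod0n => /eqP; rewrite -/(dvdn _ _) => ra.
  by have := prim a ltam; rewrite ra.
have [i leim cardFl] : exists2 i, (i <= m)%N
    & #|[set t : Iirr N | <[l]> \subset 'I['chi_t]]| = (s ^ i)%N.
  apply/(dvdn_pfactor _ _ pr_s); rewrite -cardN card_fixed_abelian //.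
  exact: dvdn_indexg.
have i_gt0 : (0 < i)%N.
  rewrite lt0n; apply: contraNneq t0 => i0; move: cardFl; rewrite i0 expn0.
  move/eqP/cards1P=> [u Du].
  have : t \in [set u] by rewrite -Du inE -afix_conjg_Iirr.
  have : 0 \in [set u] by rewrite -Du inE irr0 inertia1.
  by rewrite !inE => /eqP-> /eqP->.
have actT : [acts <[l]>, on [set: Iirr N] | to].
  by rewrite cycle_subG !inE nNl2; apply/subsetP=> u; rewrite !inE.
have := pgroup_fix_mod rl actT.
rewrite cardsT card_Iirr_abelian // cardN.
have -> : #|'Fix_([set: Iirr N] | to)(<[l]>)| = (s ^ i)%N.
  by rewrite setTI -cardFl; apply: eq_card => u; rewrite [RHS]inE -afix_conjg_Iirr.
rewrite -(subnK leim) expnD -{2}[(s ^ i)%N]mul1n => /eqP.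
rewrite eqn_mod_dvd ?leq_mul2r ?sX_gt0 ?orbT // -mulnBl subn1 Gauss_dvdl.
  move=> rmi; case: (posnP (m - i)) => [mi0 | mi_gt0].
    rewrite -cycle_subG; apply: centralises_of_fixed => //.
    by rewrite cardFl cardN; congr (_ ^ _)%N; apply/eqP; rewrite eqn_leq leim -subn_eq0 mi0.
  have := prim (m - i)%N; rewrite mi_gt0 ltn_subrL i_gt0 (leq_trans i_gt0) // rmi.
  by move/(_ isT).
rewrite coprimeXr // prime_coprime //; apply/negP=> rs.
have m_gt0 : (0 < m)%N by case/andP: ltam => /ltn_trans; apply.
have : (r %| (s ^ m).-1 + 1)%N by rewrite addn1 prednK ?dvdn_exp.
by rewrite dvdn_addr // dvdn1 gtn_eqF ?prime_gt1.
Qed.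

End SylowFixing.

(** This settles the exception 2^6 - 1 of Zsigmondy's theorem. The quotient n is
63, 21 or 9, its 3-part is 9, 3 or 9, and 2 is the only prime that divides 8 or
2. *)
Lemma three_part_quotient_63 p n a :
    prime p -> (0 < a < 6)%N -> (n * (2 ^ a).-1 = (2 ^ 6).-1)%N ->
    (n`_3 = 1 %[mod p])%N -> p = 2%N.
Proof.
move=> pr_p /andP[a0 a6] Dn; rewrite p_part => /eqP n3.
have dvd2 k : (0 < k)%N -> (k.+1 == 1 %[mod p])%N -> p \in primes k.
  by move=> k0; rewrite eqn_mod_dvd // subn1 mem_primes pr_p k0.
have Cn : n \in [:: 63; 21; 9]%N.
  by case: a a0 a6 Dn => [|[|[|[|[|[|]]]]]] //= _ _ Dn; rewrite !inE; lia.
have p2 k : primes k = [:: 2%N] -> p \in primes k -> p = 2%N.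
  by move=> ->; rewrite inE => /eqP.
move: Cn n3; rewrite !inE => /or3P[] /eqP-> n3.
- by apply: (p2 8%N) => //; apply: dvd2.
- by apply: (p2 2%N) => //; apply: dvd2.
- by apply: (p2 8%N) => //; apply: dvd2.
Qed.

Section CoreFaithful.
Variable gT : finGroupType.
Implicit Types (A B G H K L M N P Q R S X Y : {group gT}) (n p q r s m a : nat).

(** An element l of L that centralises Q sends t to a character fixed by Q, hence
by P; this character is also fixed by P^l, so P^l = P and l centralises P. Thus
conjugates of C_L(P) cover L, and Jordan's lemma makes P the only Sylow
p-subgroup of L P. Then P fixes all characters of N and centralises N, although
C_H(N) = 1. *)
Lemma Sylow_fixing_contained p s m N H L P Q :
    abelian N -> prime s -> #|N| = (s ^ m)%N -> H \subset 'N(N) ->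
    Sylow_fixing p N H -> L <*> P <| H -> p.-group P -> p^'.-group L ->
    P \subset 'N(L) -> 'C_H(N) = 1%g -> P :!=: 1%g ->
    (exists2 t : Iirr N, t != 0 & (P \subset 'I['chi_t]) && (Q \subset 'I['chi_t])) ->
    (forall t : Iirr N, Q \subset 'I['chi_t] -> P \subset 'I['chi_t]) ->
    {in L, forall l, exists2 g, g \in L
     & (l ^ g \in 'C(P))%g || (l ^ g \in 'C(Q))%g} ->
  False.
Proof.
move=> abN pr_s cardN nNH fixN nsXH pP p'L nLP C1 ntP [t t0 /andP[Pt Qt]] sQP coverL.
have [sylP cardS] := card_Syl_coprime nLP pP p'L.
have coLP : coprime #|L| #|P| by rewrite coprime_sym (pnat_coprime pP).
have sLX : L \subset L <*> P := joing_subl _ _.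
have sLH := subset_trans sLX (normal_sub nsXH).
have sylP' : P \in 'Syl_p(L <*> P) by rewrite inE.
have cQP l : l \in L -> (l \in 'C(Q) -> l \in 'C(P))%g.
  move=> Ll cQl; have nNl : (l \in 'N(N))%g by rewrite (subsetP nNH) ?(subsetP sLH).
  have tl0 : conjg_Iirr t l != 0 by rewrite conjg_Iirr_eq0.
  have QQ : Q :^ l = Q by apply/normP; rewrite (subsetP (cent_sub Q)).
  have Ql : Q \subset 'I['chi_(conjg_Iirr t l)] by rewrite -QQ sub_inertia_conj.
  have Pl := sQP _ Ql.
  have Pl' : P :^ l \subset 'I['chi_(conjg_Iirr t l)] by rewrite sub_inertia_conj.
  have [P1 _ uP1] := Sylow_fixing_uniq fixN nsXH tl0.
  have sylPl : (P :^ l)%G \in 'Syl_p(L <*> P).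
    by rewrite inE /= -(conjGid (subsetP sLX l Ll)) pHallJ2.
  have : l \in 'N_L(P).
    have e1 : P = P1 by apply/eqP; rewrite -uP1.
    have e2 : (P :^ l)%G = P1 by apply/eqP; rewrite -uP1.
    by rewrite inE Ll; apply/normP; rewrite [in RHS]e1 -e2.
  by rewrite coprime_norm_cent // => /setIP[].
have eLC : 'C_L(P)%G :=: L.
  apply: conjugates_cover (subsetIl _ _) _ => l Ll; have [g Lg cPQ] := coverL l Ll.
  have Llg : (l ^ g)%g \in L by rewrite groupJ.
  exists g => //; apply/setIP; split=> //.
  by case/orP: cPQ => [//|]; apply: cQP.
have [a [cardF leam]] := card_Syl_Sylow_fixing abN pr_s cardN nNH fixN nsXH sylP'.
rewrite cardS eLC indexgg mul1n => /(congr1 succn).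
have s_gt0 k : (0 < s ^ k)%N by rewrite expn_gt0 prime_gt0.
rewrite !prednK // -cardN -cardF => DF.
case/eqP: ntP; apply/trivgP; rewrite -C1 subsetI.
have sPH : P \subset H by apply: subset_trans (normal_sub nsXH); apply: joing_subr.
by rewrite sPH centralises_of_fixed // (subset_trans sPH).
Qed.

(** The inverse image of O_p(H / L) is the product of L and its intersection with
P. *)
Lemma Sylow_over_normal p H L P :
    L <| H -> p^'.-group L -> p.-Sylow(H) P -> 'O_p(H / L) != 1%g ->
  exists P0, [/\ P0 \subset P, L <*> P0 <| H, p.-group (L <*> P0 / L),
                 P0 \subset 'N(L) & P0 :!=: 1%g].
Proof.
move=> nsLH p'L sylP ntO; have nLH := normal_norm nsLH.
pose X := (coset L @*^-1 'O_p(H / L))%G.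
have nsXH : X <| H by rewrite -(quotientGK nsLH) cosetpre_normal pcore_normal.
have nsLX : L <| X by apply: normal_cosetpre.
have sLX := normal_sub nsLX.
have DX : (X / L)%g = 'O_p(H / L) by rewrite cosetpreK.
have sylP0 := Hall_setI_normal nsXH sylP; set P0 := (P :&: X)%G in sylP0.
have nLP0 : P0 \subset 'N(L).
  by rewrite (subset_trans (pHall_sub sylP0)) // (subset_trans (normal_sub nsXH)).
have pXL : p.-group (X / L) by rewrite DX pcore_pgroup.
have defX : L <*> P0 = X.
  have sJX : L <*> P0 \subset X by rewrite join_subG sLX (pHall_sub sylP0).
  have nLX : X \subset 'N(L) by rewrite (subset_trans (normal_sub nsXH)).
  apply/eqP; rewrite eqEsubset sJX /= -(quotientSGK nLX (joing_subl L P0)).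
  rewrite (quotientYidl nLP0).
  have sylP0L := quotient_pHall nLP0 sylP0.
  by rewrite (sub_pHall sylP0L pXL) // quotientS // (pHall_sub sylP0).
exists P0; split=> //; rewrite ?defX ?subsetIl //.
apply: contraNneq ntO => P01; rewrite -DX -defX P01 joingG1 trivg_quotient.
by [].
Qed.

(** The bounds on a hold because P fixes some nonprincipal characters, but not all
of them, since it acts faithfully. *)
Lemma Sylow_fixing_count p s m N H L P :
    abelian N -> prime s -> #|N| = (s ^ m)%N -> (0 < m)%N -> H \subset 'N(N) ->
    Sylow_fixing p N H -> L <*> P <| H -> prime p -> solvable L -> p.-group P -> p^'.-group L ->
    P \subset 'N(L) -> 'C_H(N) = 1%g -> P :!=: 1%g ->
  exists a n, [/\ #|[set t : Iirr N | P \subset 'I['chi_t]]| = (s ^ a)%N,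
     (0 < a < m)%N, (n * (s ^ a).-1 = (s ^ m).-1)%N, (n %| #|L|)%N
     & (n`_3 = 1 %[mod p])%N].
Proof.
move=> abN pr_s cardN m_gt0 nNH fixN nsXH pr_p solL pP p'L nLP C1 ntP.
have [sylP cardS] := card_Syl_coprime nLP pP p'L.
have sylP' : P \in 'Syl_p(L <*> P) by rewrite inE.
have [a [cardF leam Dn]] := card_Syl_Sylow_fixing abN pr_s cardN nNH fixN nsXH sylP'.
have s_gt1 := prime_gt1 pr_s.
exists a, #|'Syl_p(L <*> P)|; split=> //; last 2 first.
- by rewrite cardS dvdn_indexg.
- exact: card_Syl_part_mod.
rewrite lt0n ltn_neqAle leam andbT; apply/andP; split.
  apply: contraTneq m_gt0 => a0; move: Dn; rewrite a0 expn0 muln0.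
  move/(congr1 succn); rewrite prednK ?expn_gt0 ?(prime_gt0 pr_s) // => /esym/eqP.
  by rewrite -lt0n -[1%N](expn0 s) eqn_exp2l // => /eqP->.
have sPH : P \subset H by apply: subset_trans (normal_sub nsXH); apply: joing_subr.
apply: contraNneq ntP => am; apply/eqP/trivgP; rewrite -C1 subsetI sPH.
by rewrite centralises_of_fixed ?(subset_trans sPH) // cardF am cardN.
Qed.

(** The Sylow subgroups P and Q that are normal in a stabilizer centralise each
other. With L = O_{p,q}'(H), the groups O_p(H / L) and O_q(H / L) are therefore
nontrivial; let P0 and Q0 be the corresponding parts of P and Q. By
[class_covering] each element of L is conjugate to one that centralises P0 or
Q0. The number n of Sylow p-subgroups of L P0 satisfies n (s^a - 1) = s^m - 1,
so a primitive prime divisor of s^m - 1 divides n, hence |L|, and an element of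
that order centralises N by [fixed_by_primitive_elt]. In the exceptional case
s^m = 2^6 the congruence for the 3-part of n gives p = q = 2. If m = 2, both
[N, P0] and [N, Q0] are the kernel of t, so P0 and Q0 fix the same characters,
against [Sylow_fixing_contained]. *)
Lemma faithful_Sylow_fixing_exclusive s p q N H :
    abelian N -> prime s -> s.-group N -> H \subset 'N(N) -> solvable H ->
    'C_H(N) = 1%g -> prime p -> prime q -> p != q ->
    Sylow_fixing p N H -> Sylow_fixing q N H -> ~~ degree_divisor H (p * q) ->
  (p %| #|H|)%N -> (q %| #|H|)%N -> False.
Proof.
move=> abN pr_s sN nNH solH C1 pr_p pr_q npq fixp fixq nadj pH qH.
have [m cardN] := p_natP sN.
have ntN : N :!=: 1%g.
  apply: contraTneq pH => N1; move: C1; rewrite N1 => CH1.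
  have -> : H :=: 1%g by apply/trivgP; rewrite -CH1 subsetI subxx cents1.
  by rewrite cards1 dvdn1 gtn_eqF ?prime_gt1.
have m_gt0 : (0 < m)%N by rewrite lt0n; apply: contraNneq ntN => m0; rewrite trivg_card1 cardN m0.
have [t t0] := has_nonprincipal_irr ntN.
have [P [sylP nsPS abP]] := fixp t t0; have [Q [sylQ nsQS abQ]] := fixq t t0.
have pP := pHall_pgroup sylP; have qQ := pHall_pgroup sylQ.
have q'p : q \in p^' by rewrite !inE eq_sym.
have coPQ : coprime #|P| #|Q| by apply: (pnat_coprime pP); apply: pi_pnat qQ _.
have cPQ : P \subset 'C(Q).
  apply/commG1P/trivgP; rewrite -(coprime_TIg coPQ) commg_subI //.
    by rewrite subsetI subxx (subset_trans (normal_sub nsPS)) ?normal_norm.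
  by rewrite subsetI subxx (subset_trans (normal_sub nsQS)) ?normal_norm.
pose L := 'O_(pred2 p q)^'(H)%G; have nsLH : L <| H by apply: pcore_normal.
have L' r : r \in pred2 p q -> r^'.-group L.
  move=> pqr; apply: sub_pgroup (pcore_pgroup _ _) => u; rewrite 2!inE /= => nu.
  by rewrite !inE; apply: contra nu => /eqP->.
have p'L : p^'.-group L by apply: L'; rewrite inE eqxx.
have q'L : q^'.-group L by apply: L'; rewrite inE eqxx orbT.
have solL : solvable L := solvableS (normal_sub nsLH) solH.
have ntOp : 'O_p(H / L) != 1%g.
  by apply: (pcore_quotient_neq1 solH pr_p pr_q sylP sylQ).
have ntOq : 'O_q(H / L) != 1%g.
  have E : 'O_(pred2 q p)^'(H) = L by apply: eq_pcore => u; rewrite !inE orbC.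
  rewrite -E; apply: (pcore_quotient_neq1 solH pr_q pr_p sylQ sylP) => //.
  by rewrite centsC.
have [P0 [sP0P nsXH pXL nLP0 ntP0]] := Sylow_over_normal nsLH p'L sylP ntOp.
have [Q0 [sQ0Q nsYH qYL nLQ0 ntQ0]] := Sylow_over_normal nsLH q'L sylQ ntOq.
have pP0 := pgroupS sP0P pP; have qQ0 := pgroupS sQ0Q qQ.
have cPQ0 : P0 \subset 'C(Q0) by rewrite (centSS _ _ cPQ).
have coverL := class_covering pr_p pr_q npq nsLH nsXH nsYH (joing_subl _ _)
  (joing_subl _ _) pXL qYL (joing_subr _ _) pP0 (joing_subr _ _) qQ0 cPQ0 p'L q'L nadj.
have Pt : P0 \subset 'I['chi_t].
  by apply: subset_trans sP0P _; apply: subset_trans (normal_sub nsPS) (subsetIr _ _).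
have Qt : Q0 \subset 'I['chi_t].
  by apply: subset_trans sQ0Q _; apply: subset_trans (normal_sub nsQS) (subsetIr _ _).
have contPQ : ~ (forall u : Iirr N, Q0 \subset 'I['chi_u] -> P0 \subset 'I['chi_u]).
  move=> sQP; apply: (Sylow_fixing_contained abN pr_s cardN nNH fixp nsXH pP0 p'L nLP0 C1 ntP0 _ sQP coverL).
  by exists t; rewrite // Pt.
have [a [n [cardFP a_bnd Dn nL n3]]] := Sylow_fixing_count abN pr_s cardN m_gt0 nNH fixp nsXH pr_p solL pP0 p'L nLP0 C1 ntP0.
have [b [k [cardFQ b_bnd Dk kL k3]]] := Sylow_fixing_count abN pr_s cardN m_gt0 nNH fixq nsYH pr_q solL qQ0 q'L nLQ0 C1 ntQ0.
have sLH := normal_sub nsLH; have nNL := subset_trans sLH nNH.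
have nNP0 : P0 \subset 'N(N).
  by apply: subset_trans nNH; apply: subset_trans sP0P (pHall_sub sylP).
have nNQ0 : Q0 \subset 'N(N).
  by apply: subset_trans nNH; apply: subset_trans sQ0Q (pHall_sub sylQ).
have s_gt1 := prime_gt1 pr_s.
have [m_gt2 | m_le2] := ltnP 2 m.
  have [/andP[/eqP s2 /eqP m6] | exc] := boolP ((s == 2) && (m == 6))%N.
    rewrite s2 m6 in a_bnd b_bnd Dn Dk; case/eqP: npq.
    by rewrite (three_part_quotient_63 pr_p a_bnd Dn n3) (three_part_quotient_63 pr_q b_bnd Dk k3).
  have [r [pr_r rm prim]] := primitive_prime_divisor s_gt1 m_gt2 exc.
  have rL : (r %| #|L|)%N.
    apply: dvdn_trans nL; move: rm; rewrite -Dn Euclid_dvdM //.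
    by rewrite (negPf (prim a a_bnd)) orbF.
  have [l Ll ol] := Cauchy pr_r rL.
  have [g Lg cl] := coverL l Ll; have Llg : (l ^ g)%g \in L by rewrite groupJ.
  have nNlg : (l ^ g \in 'N(N))%g by rewrite (subsetP nNL).
  have : (l ^ g \in 'C_H(N))%g.
    apply/setIP; split; first exact: (subsetP sLH).
    case/orP: cl => cl.
      by apply: (fixed_by_primitive_elt abN cardN pr_s pr_r rm prim nNlg _ cl nNP0 cardFP a_bnd); rewrite orderJ.
    by apply: (fixed_by_primitive_elt abN cardN pr_s pr_r rm prim nNlg _ cl nNQ0 cardFQ b_bnd); rewrite orderJ.
  rewrite C1 inE conjg_eq1 -order_eq1 ol => /eqP r1.
  by rewrite r1 in pr_r.
have [a1 b1] : a = 1%N /\ b = 1%N by clear -a_bnd b_bnd m_le2; lia.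
apply: contPQ => u; rewrite a1 b1 expn1 in cardFP cardFQ.
have lin v : 'chi[N]_v \is a linear_char by apply/char_abelianP.
suff DR : [~: N, P0] = [~: N, Q0] by rewrite !lin_char_inertia // DR.
rewrite !lin_char_inertia // in Pt Qt.
have ker_eq (B : {group gT}) : B \subset 'N(N) ->
    #|[set t : Iirr N | B \subset 'I['chi_t]]| = s ->
    [~: N, B] \subset cfker 'chi_t -> cfker 'chi_t = [~: N, B].
  move=> nNB; rewrite card_fixed_abelian // => iN sRk; apply/eqP; rewrite eq_sym.
  have sRN : [~: N, B] \subset N by rewrite commg_subl.
  have sKN := cfker_sub 'chi_t.
  rewrite eqEsubset sRk /= -indexg_eq1.
  have := Lagrange_index sKN sRk; rewrite iN => Ds.
  have: #|N : cfker 'chi_t| != 1%N by rewrite indexg_eq1 subGcfker.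
  have: (#|cfker 'chi_t : [~: N, B]| %| s)%N by rewrite -Ds dvdn_mull.
  case/(primeP pr_s).2 /orP => // /eqP Di; rewrite Di in Ds.
  by case/negP; rewrite -(eqn_pmul2r (prime_gt0 pr_s)) Ds mul1n.
by rewrite -(ker_eq P0 nNP0 cardFP Pt) (ker_eq Q0 nNQ0 cardFQ Qt).
Qed.
End CoreFaithful.

Section SylowFixingDegrees.
Variable gT : finGroupType.
Implicit Types (A B G H K L M N P Q R S X Y : {group gT}) (n p q r s m a : nat).

Lemma lin_char_extends_inertia G M H (t : Iirr M) :
    M ><| H = G -> 'chi_t \is a linear_char ->
  exists c : Iirr 'I_G['chi_t], 'Res[M] 'chi_c = 'chi_t.
Proof.
move=> defG lint; have [nsMG sHG mulMH nMH tiMH] := sdprod_context defG.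
apply: (@lin_char_extends_sdprod _ _ _ 'I_H['chi_t]%G) lint _; last exact: subsetIr.
rewrite sdprodE.
- by rewrite /= -mulMH -group_modl ?sub_inertia.
- by rewrite (subset_trans _ nMH) ?subsetIl.
by apply/trivgP; rewrite -tiMH setIS ?subsetIl.
Qed.

Lemma Sylow_fixing_of_degrees p G N H :
    N ><| H = G -> abelian N -> solvable H -> prime p ->
    (forall i : Iirr G, ~~ (N \subset cfker 'chi_i) -> ~~ (p %| chi_degree i)%N) ->
  Sylow_fixing p N H.
Proof.
move=> defG abN solH pr_p p'deg t t0.
have [P sylP] := Sylow_exists p 'I_H['chi_t].
have lint : 'chi_t \is a linear_char by apply/char_abelianP.
have [] := stabilizer_Sylow defG solH pr_p (lin_char_extends_inertia defG lint) _ sylP.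
  move=> i ct; apply: p'deg; apply: contra t0 => sNk.
  have [nsNG _ _ _ _] := sdprod_context defG.
  have resC : 'Res[N] 'chi_i \is a character by rewrite cfRes_char ?irr_char.
  rewrite -subGcfker; apply: subset_trans _ (cfker_constt resC ct).
  by rewrite (cfker_Res (normal_sub nsNG) (irr_char i)) subsetI subxx.
by exists P.
Qed.

End SylowFixingDegrees.

Section Core.
Variable gT : finGroupType.
Implicit Types (A B G H K L M N P Q R S X Y : {group gT}) (n p q r s m a : nat).

(** Factor out C_H(N) to make the action faithful. *)
Theorem Sylow_centralises_core s p q G N H :
    N ><| H = G -> abelian N -> prime s -> s.-group N -> solvable H ->
    prime p -> prime q -> p != q ->
    (forall i : Iirr G, ~~ (N \subset cfker 'chi_i) ->
       ~~ (p %| chi_degree i)%N /\ ~~ (q %| chi_degree i)%N) ->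
    ~~ degree_divisor H (p * q) ->
  ~~ (p %| #|H : 'C_H(N)|)%N \/ ~~ (q %| #|H : 'C_H(N)|)%N.
Proof.
move=> defG abN pr_s sN solH pr_p pr_q npq pqdeg nadj.
have [nsNG sHG mulNH nNH tiNH] := sdprod_context defG.
set K := 'C_H(N)%G.
have sKH : K \subset H := subsetIl _ _.
have nsKH : K <| H by rewrite norm_normalI // norms_cent.
have nsKG : K <| G.
  rewrite /normal (subset_trans sKH) // -mulNH mul_subG ?(normal_norm nsKH) //.
  by rewrite cents_norm // centsC subsetIr.
have nKN : N \subset 'N(K) := subset_trans (normal_sub nsNG) (normal_norm nsKG).
have nKH := normal_norm nsKH.
have defGK : (N / K) ><| (H / K) = (G / K)%g.
  rewrite sdprodE ?quotient_norms //; first by rewrite -quotientMl ?mulNH.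
  by rewrite -quotientIG // tiNH quotient1.
have tiNK : N :&: K = 1%g by apply/trivgP; rewrite -tiNH setIS.
have C1 : 'C_(H / K)(N / K) = 1%g.
  apply/trivgP; apply/subsetP=> _ /setIP[/morphimP[h nKh Hh ->] ch].
  rewrite inE; apply/eqP/coset_id; rewrite inE Hh /=.
  apply/centP=> y Ny; apply/commgP; rewrite -in_set1 -[[set 1%g]]tiNK.
  have nKy := subsetP nKN y Ny; apply/setIP; split.
    by rewrite commgEr groupM ?groupV // memJ_norm ?groupV ?(subsetP nNH).
  apply: coset_idr; rewrite ?groupR // morphR //.
  by apply/eqP/commgP/(centP ch); apply: mem_quotient.
have degK r : (forall i : Iirr G, ~~ (N \subset cfker 'chi_i) -> ~~ (r %| chi_degree i)%N) ->
   prime r -> Sylow_fixing r (N / K) (H / K).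
  move=> r'deg pr_r; apply: (Sylow_fixing_of_degrees defGK) => //.
  - by rewrite quotient_abelian.
  - by rewrite quotient_sol.
  move=> i nNk; have := r'deg (mod_Iirr i).
  rewrite (chi_degree_eq (i := mod_Iirr i) (j := i)) ?mod_IirrE ?cfMod1 //; apply.
  by rewrite sub_cfker_morph ?normal_norm //; apply: contra nNk => /andP[].
have := faithful_Sylow_fixing_exclusive (quotient_abelian K abN) pr_s (quotient_pgroup K sN)
  (quotient_norms K nNH) (quotient_sol K solH) C1 pr_p pr_q npq
  (degK p _ pr_p) (degK q _ pr_q).
rewrite -card_quotient //.
case: (p %| _)%N => [|_]; last by left.
case: (q %| _)%N => [|_]; last by right.
move=> F; case: F => //; try by move=> i /pqdeg[].
by apply: contra nadj; apply: degree_divisor_quotient.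
Qed.
End Core.

Section SylowFixingConsequences.
Variable gT : finGroupType.
Implicit Types (A B G H K L M N P Q R S X Y : {group gT}) (n p q r s m a : nat).

(** By Gallagher's theorem the degrees over t are the products of the index of the
stabilizer of t in H and a degree of that stabilizer. *)
Lemma degrees_of_Sylow_fixing p G N H (i : Iirr G) :
    N ><| H = G -> abelian N -> prime p -> Sylow_fixing p N H ->
    ~~ (N \subset cfker 'chi_i) ->
  ~~ (p %| chi_degree i)%N.
Proof.
move=> defG abN pr_p fixN nNk; have [nsNG sHG mulNH nNH tiNH] := sdprod_context defG.
have [t ct] := constt_cfRes_irr N i.
have t0 : t != 0.
  by apply: contraNneq nNk => t0; apply: constt0_Res_cfker; rewrite // -t0.
have lint : 'chi_t \is a linear_char by apply/char_abelianP.
have [P [sylP nsPS abP]] := fixN t t0.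
have [c Dc] := lin_char_extends_inertia defG lint.
set I := 'I_G['chi_t]%G in c Dc; set S := 'I_H['chi_t]%G in nsPS.
have sMI : N \subset I by rewrite sub_Inertia ?normal_sub.
have nsNI : N <| I := normal_Inertia _ (normal_sub nsNG).
have mulI : (N * S)%g = I by rewrite /= -mulNH -group_modl ?sub_inertia.
have nNS : S \subset 'N(N) by rewrite (subset_trans _ nNH) ?subsetIl.
have defI : N ><| S = I.
  by rewrite sdprodE //; apply/trivgP; rewrite -tiNH setIS ?subsetIl.
have [irrMul _ cMul _] := constt_Ind_ext nsNI Dc.
have [irrInd _ im_Ind _ _] := constt_Inertia_bijection t nsNG.
have [s cs Di] : exists2 s, s \in irr_constt ('Ind[I] 'chi_t) & i = Ind_Iirr G s.
  by apply/imsetP; rewrite im_Ind constt_Ind_Res.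
have [b Ds] : exists b : Iirr (I / N), s = mul_mod_Iirr c b.
  by move: cs; rewrite cMul => /codomP.
have Ddeg : (chi_degree i = #|G : I| * chi_degree b)%N.
  have -> : chi_degree b = chi_degree s.
    apply: chi_degree_eq; rewrite Ds cfIirrE ?irrMul // cfunE mod_IirrE // cfMod1.
    have -> : 'chi_c 1%g = 1 by rewrite -(cfResE _ sMI) ?group1 // Dc lin_char1.
    by rewrite mulr1.
  by apply: chi_degreeM; rewrite Di cfIirrE ?irrInd // cfInd1 ?subsetIl.
have sylPS : p.-Sylow(S) P.
  by apply: pHall_subl sylP; rewrite ?subsetIl ?normal_sub.
rewrite Ddeg Euclid_dvdM // negb_or; apply/andP; split.
  have sIG : I \subset G by apply: subsetIl.
  have sSH : S \subset H by apply: subsetIl.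
  have -> : #|G : I| = #|H : S|.
    rewrite -!divgS // -(sdprod_card defG) -(sdprod_card defI).
    by rewrite divnMl ?cardG_gt0.
  rewrite -p'natE //; have /and3P[_ _ p'HP] := sylP; apply: pnat_dvd p'HP.
  by apply: indexgS; apply: normal_sub.
have nNP := subset_trans (normal_sub nsPS) nNS.
have EIS : (I / N)%g = (S / N)%g by rewrite -mulI quotientMidl.
have sylq : p.-Sylow(I / N) (P / N) by rewrite EIS; apply: quotient_pHall.
have nsq : P / N <| I / N by rewrite EIS quotient_normal.
have := Ito_normal_abelian_Sylow sylq nsq (quotient_abelian N abP) pr_p.
by apply: contra => pb; apply/existsP; exists b.
Qed.

(** The Sylow subgroup that is normal in the stabilizer of a character lies in
C_H(N), which fixes the character; so it is characteristic in C_H(N). *)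
Lemma normal_Sylow_of_centralising p N H :
    H \subset 'N(N) -> N :!=: 1%g -> prime p -> Sylow_fixing p N H ->
    ~~ (p %| #|H : 'C_H(N)|)%N ->
  exists P, [/\ p.-Sylow(H) P, P <| H, abelian P & P \subset 'C(N)].
Proof.
move=> nNH ntN pr_p fixN p'i; have [t t0] := has_nonprincipal_irr ntN.
have [P [sylP nsPS abP]] := fixN t t0; exists P.
set K := 'C_H(N)%G.
have nsKH : K <| H by rewrite norm_normalI // norms_cent.
have sylPK := Hall_setI_normal nsKH sylP.
have sPK : P \subset K.
  apply/setIidPl/eqP; rewrite eqEcard subsetIl /=.
  rewrite (card_Hall sylP) (card_Hall sylPK) -(Lagrange (normal_sub nsKH)).
  by rewrite partnM ?(part_p'nat (_ : p^'.-nat #|H : K|)) ?muln1 ?p'natE.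
have sKS : K \subset 'I_H['chi_t].
  by rewrite subsetI subsetIl subIset // cent_sub_inertia orbT.
have nsPK : P <| K := normalS sPK sKS nsPS.
have sylPK' : p.-Sylow(K) P by rewrite -(setIidPl sPK).
split=> //; last by apply: subset_trans sPK (subsetIr _ _).
by rewrite -(normal_Hall_pcore sylPK' nsPK) gFnormal_trans.
Qed.

(** N P is a normal abelian subgroup of index prime to p. *)
Lemma no_degree_of_centralising p G N P H :
    N ><| H = G -> abelian N -> prime p -> p.-Sylow(H) P -> P <| H ->
    abelian P -> P \subset 'C(N) ->
  ~~ degree_divisor G p.
Proof.
move=> defG abN pr_p sylP nsPH abP cNP.
have [nsNG sHG mulNH nNH tiNH] := sdprod_context defG.
have cNP' : N \subset 'C(P) by rewrite centsC.
pose A := (N <*> P)%G; have defA : A :=: (N * P)%g := cent_joinEr cNP.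
have abA : abelian A by rewrite abelianY abN abP.
have nsAG : A <| G.
  rewrite /normal join_subG (normal_sub nsNG) (subset_trans (normal_sub nsPH)) //=.
  rewrite -mulNH mul_subG //; first by apply: subset_trans (joing_subl N P) (normG _).
  by rewrite normsY // normal_norm.
apply/existsPn=> i; apply/negP=> pi.
have := dvdn_trans pi (Ito_degree_dvd i abA nsAG); apply/negP.
have -> : #|G : A| = #|H : P|.
  have tiNP : N :&: P = 1%g.
    by apply/trivgP; rewrite -tiNH setIS ?normal_sub.
  rewrite -!divgS ?normal_sub //= defA (TI_cardMg tiNP) -(sdprod_card defG).
  by rewrite divnMl ?cardG_gt0.
by rewrite -p'natE //; case/and3P: sylP.
Qed.

End SylowFixingConsequences.

(** * Palfy's theorem when the Sylow subgroup and the minimal normal subgroup are coprime *)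

Section Palfy.
Variable gT : finGroupType.
Implicit Types (A B G H K L M N P Q R S X Y : {group gT}) (n p q r s m a : nat).

Lemma degree_divisor_coprime G m n (i : Iirr G) :
    coprime m n -> (m %| chi_degree i)%N -> (n %| chi_degree i)%N ->
  degree_divisor G (m * n).
Proof.
by move=> co_mn mi ni; apply/existsP; exists i; rewrite Gauss_dvd ?mi.
Qed.

(** Every degree over a nonprincipal character of N is divisible by r, hence not by
p or q. So p and q have the Sylow fixing property, and by the core one of them
divides no degree of G. *)
Lemma palfy_coprime_case p q r s G N R :
    solvable G -> prime p -> prime q -> prime r -> p != q -> p != r -> q != r ->
    minnormal N G -> N \subset G -> prime s -> s.-abelem N -> s != r ->
    r.-Sylow(G) R -> R / N <| G / N -> abelian (R / N) ->
    degree_divisor G p -> degree_divisor G q -> degree_divisor G r ->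
    ~~ degree_divisor G (p * q) -> ~~ degree_divisor G (p * r) ->
    ~~ degree_divisor G (q * r) -> False.
Proof.
move=> solG pr_p pr_q pr_r npq npr nqr minN sNG pr_s abelN nsr sylR nsRNq abRq.
move=> dp dq dr npq' npr' nqr'.
have [sN abN _] := and3P abelN.
have [/andP[ntN nNG] _] := mingroupP minN.
have nsNG : N <| G by apply/andP.
have sRG := pHall_sub sylR; have nNR := subset_trans sRG nNG.
have rR := pHall_pgroup sylR.
have r'N : r^'.-group N by apply: pi_pnat sN _; rewrite !inE.
have coNR : coprime #|N| #|R| by rewrite coprime_sym (pnat_coprime rR).
have nsNRG : (N * R)%g <| G.
  by rewrite -quotientK // -(quotientGK nsNG) cosetpre_normal.
have abR : abelian R.
  by rewrite (isog_abelian (quotient_isog nNR _)) // setIC coprime_TIg // coprime_sym.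
have nnRG : ~~ (R <| G).
  apply: contraL dr => nsRG; exact: Ito_normal_abelian_Sylow abR pr_r.
have [defG C1] := Frattini_complement minN sNG abN r'N sylR nsNRG nnRG.
set H := 'N_G(R)%G in defG.
have solH : solvable H := solvableS (subsetIl _ _) solG.
have co u v : prime u -> prime v -> u != v -> coprime u v.
  by move=> pu pv uv; rewrite prime_coprime // dvdn_prime2.
have degs (u : nat) : prime u -> u != r -> ~~ degree_divisor G (u * r) ->
    forall i : Iirr G, ~~ (N \subset cfker 'chi_i) -> ~~ (u %| chi_degree i)%N.
  move=> pr_u nur nadj i nNi; apply: contra nadj => ui.
  apply: (degree_divisor_coprime (co u r pr_u pr_r nur) ui).
  exact: pdvd_degree_nontriv_on C1 nNi.
have notK (u : nat) : prime u -> u != r -> ~~ degree_divisor G (u * r) -> degree_divisor G u ->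
    (u %| #|H : 'C_H(N)|)%N.
  move=> pr_u nur nadj du; apply: contraLR du => u'i.
  have fixu := Sylow_fixing_of_degrees defG abN solH pr_u (degs u pr_u nur nadj).
  have nNH : H \subset 'N(N) by have [] := sdprodP defG.
  have [P [sylP nsPH abP cNP]] := normal_Sylow_of_centralising nNH ntN pr_u fixu u'i.
  exact: no_degree_of_centralising defG abN pr_u sylP nsPH abP cNP.
have := Sylow_centralises_core defG abN pr_s sN solH pr_p pr_q npq.
case=> [i nNi | | /negP[] | /negP[]]; last 2 first.
- exact: notK.
- exact: notK.
- by split; [apply: (degs p) nNi | apply: (degs q) nNi].
by apply: contra npq'; apply: degree_divisor_sdprod defG.
Qed.

End Palfy.

(** * Characters of a group of class two over its derived subgroup *)

Section CentralCharacters.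
Implicit Types (gT : finGroupType).

Lemma Res_central gT (G N : {group gT}) (i : Iirr G) (j : Iirr N) :
    N \subset 'Z(G) -> j \in irr_constt ('Res[N] 'chi_i) ->
  'Res[N] 'chi_i = 'chi_i 1%g *: 'chi_j.
Proof.
move=> sNZ cj; have sNG := subset_trans sNZ (center_sub G).
have cGN : G \subset 'C(N) by rewrite centsC (subset_trans sNZ) ?subsetIr.
have nsNG : N <| G by rewrite /normal sNG cents_norm.
have linj : 'chi_j \is a linear_char.
  by apply/char_abelianP; apply: abelianS sNZ (center_abelian G).
have Ij : G \subset 'I['chi_j] by apply: subset_trans cGN (cent_sub_inertia _).
have := Clifford_Res_sum_cfclass nsNG cj.
rewrite cfclass_invariant // big_seq1 => DR; rewrite {1}DR; congr (_ *: _).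
have := congr1 (fun phi : 'CF(N) => phi 1%g) DR.
by rewrite cfResE // cfunE (lin_char1 linj) mulr1.
Qed.

Lemma nonlinear_over_der1 gT (G N : {group gT}) (i : Iirr G) (j : Iirr N) :
    G^`(1)%g = N -> 'Res[N] 'chi_i = 'chi_i 1%g *: 'chi_j -> j != 0 ->
  'chi_i \isn't a linear_char.
Proof.
move=> G'N Di; apply: contra; rewrite lin_irr_der1 G'N => kN.
have sNG : N \subset G by rewrite -G'N der_sub.
rewrite -subGcfker; apply/subsetP=> x Nx; rewrite cfkerEirr inE.
apply/eqP/(mulfI (irr1_neq0 i)).
have := congr1 (fun f : 'CF(N) => (f x, f 1%g)) Di; rewrite !cfunE !cfResE // => -[<- <-].
by rewrite (cfker1 (subsetP kN x Nx)).
Qed.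

Lemma irr_mul_cfcenter gT (G : {group gT}) (i : Iirr G) x z :
    x \in G -> z \in 'Z('chi_i)%CF ->
  'chi_i 1%g * 'chi_i (x * z)%g = 'chi_i z * 'chi_i x.
Proof.
move=> Gx; rewrite -irrRepr cfcenter_repr => /setIdP[Gz /is_scalar_mxP[c Dc]].
rewrite !cfunE groupM ?group1 ?Gx ?Gz // !mulr1n repr_mx1 repr_mxM // Dc.
by rewrite mul_mx_scalar mxtraceZ !mxtrace_scalar mulrA mulr_natl.
Qed.

(** For some y the commutator [x, y] is nontrivial; it acts as a scalar other than
1, while x [x, y] is conjugate to x. *)
Lemma irr_vanish_off_center gT (G N : {group gT}) (i : Iirr G) (j : Iirr N) x :
    G^`(1)%g \subset N -> N \subset 'Z(G) -> j \in irr_constt ('Res[N] 'chi_i) ->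
    cfaithful 'chi_j -> x \in G -> x \notin 'Z(G) -> 'chi_i x = 0.
Proof.
move=> sG'N sNZ cj ffj Gx nZx.
have linj : 'chi_j \is a linear_char.
  by apply/char_abelianP; apply: abelianS sNZ (center_abelian G).
have sNG := subset_trans sNZ (center_sub G).
have [y Gy nxy] : exists2 y, y \in G & [~ x, y] != 1%g.
  apply/exists_inP; apply: contraR nZx => /exists_inPn cxy.
  apply/centerP; split=> // y Gy; apply/commgP; have := cxy y Gy.
  by rewrite negbK.
have Nxy : [~ x, y] \in N by apply: (subsetP sG'N); apply: mem_commg.
have sZZ : 'Z(G) \subset 'Z('chi_i)%CF by rewrite -cap_cfcenter_irr; apply: bigcap_inf.
have := irr_mul_cfcenter Gx (subsetP sZZ _ (subsetP sNZ _ Nxy)).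
have Dz : 'chi_i [~ x, y] = 'chi_i 1%g * 'chi_j [~ x, y].
  by rewrite -(cfResE _ sNG) // (Res_central sNZ cj) cfunE.
rewrite -conjg_mulR cfunJ // Dz -mulrA => /(mulfI (irr1_neq0 i)) /eqP.
rewrite -[X in X == _]mul1r -subr_eq0 -mulrBl mulf_eq0 subr_eq0 => /orP[|/eqP//].
rewrite eq_sym -lin_char_ker // => kxy; case/negP: nxy.
by have := subsetP ffj _ kxy; rewrite inE.
Qed.

(** Off the centre of G a character over the faithful j vanishes. On the centre it
is determined by an extension of j to Z(G), and an extension that is trivial on
[Z(G), S] is S-invariant. *)
Lemma invariant_irr_over_faithful gT (G N S : {group gT}) (j : Iirr N) :
    G^`(1)%g \subset N -> N \subset 'Z(G) -> S \subset 'N(G) -> S \subset 'C(N) ->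
    coprime #|G| #|S| -> cfaithful 'chi_j ->
  exists2 i : Iirr G, j \in irr_constt ('Res[N] 'chi_i) & S \subset 'I['chi_i].
Proof.
move=> sG'N sNZ nGS cNS coGS ffj; have sNG := subset_trans sNZ (center_sub G).
have abZ := center_abelian G; have sZG := center_sub G.
have nZS : S \subset 'N('Z(G)) := char_norm_trans (center_char G) nGS.
have coZS : coprime #|'Z(G)| #|S| := coprimeSg sZG coGS.
(* M meets N trivially, because S centralises N and acts coprimely on Z(G). *)
pose M := [~: 'Z(G), S]%G.
have sMZ : M \subset 'Z(G) by rewrite commg_subl.
have tiMN : M :&: N = 1%g.
  apply/trivgP; rewrite -(coprime_abel_cent_TI nZS coZS abZ).
  by rewrite setIS // centsC.
have defMN : M ><| N = M <*> N.
  have cMN : N \subset 'C(M).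
    by apply: subset_trans sNZ _; apply: subset_trans (centS sMZ); apply: abZ.
  by rewrite sdprodEY ?cents_norm.
pose MN := (M <*> N)%G; have sMNZ : MN \subset 'Z(G) by rewrite join_subG sMZ.
have sMNG := subset_trans sMNZ sZG.
pose k : Iirr MN := sdprod_Iirr defMN j.
have [i] := constt_cfInd_irr k sMNG; rewrite constt_Ind_Res => ck.
have Dres := Res_central sMNZ ck.
have kM : M \subset cfker 'chi_k by rewrite sdprod_IirrE cfker_sdprod.
have cj : j \in irr_constt ('Res[N] 'chi_i).
  rewrite -(cfResRes _ (joing_subr M N) sMNG) Dres linearZ /= sdprod_IirrE cfSdprodK.
  by rewrite irr_consttE cfdotZl cfdot_irr eqxx mulr1 irr1_neq0.
exists i => //; have kiM : M \subset cfker 'chi_i.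
  apply/subsetP=> x Mx; have MNx : x \in MN by rewrite (subsetP (joing_subl M N)).
  rewrite cfkerEirr inE -!(cfResE _ sMNG) // Dres !cfunE.
  by rewrite (cfker1 (subsetP kM x Mx)).
apply/subsetP=> s Ss; have nGs := subsetP nGS s Ss.
rewrite inE nGs; apply/eqP/cfun_inP=> x Gx; rewrite cfConjgE //.
have Ss' : (s^-1 \in S)%g by rewrite groupV.
have Gxs : (x ^ s^-1)%g \in G by rewrite memJ_norm ?groupV.
have [Zx | nZx] := boolP (x \in 'Z(G)).
  by rewrite conjg_mulR cfkerMr // (subsetP kiM) // mem_commg.
rewrite !(irr_vanish_off_center sG'N sNZ cj) // memJ_norm //.
by rewrite groupV (subsetP nZS).
Qed.

(** Factor out the kernel of j, which is normal in G because N is central. *)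
Lemma invariant_irr_over gT (G N S : {group gT}) (j : Iirr N) :
    G^`(1)%g \subset N -> N \subset 'Z(G) -> S \subset 'N(G) -> S \subset 'I['chi_j] ->
    coprime #|G| #|S| ->
  exists2 i : Iirr G, j \in irr_constt ('Res[N] 'chi_i) & S \subset 'I['chi_i].
Proof.
move=> sG'N sNZ nGS IjS coGS; have sNG := subset_trans sNZ (center_sub G).
have linj : 'chi_j \is a linear_char.
  by apply/char_abelianP; apply: abelianS sNZ (center_abelian G).
have nNS := subset_trans IjS (norm_inertia _).
pose K := cfker_group 'chi_j; have sKN : K \subset N := cfker_sub 'chi_j.
have nsKN : K <| N := cfker_normal _.
have cGN : G \subset 'C(N) by rewrite centsC (subset_trans sNZ) ?subsetIr.
have cGK := subset_trans cGN (centS sKN).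
have nKG := cents_norm cGK.
have nsNG : N <| G by rewrite /normal sNG cents_norm.
have nsKG : K <| G by rewrite /normal (subset_trans sKN).
have nKS : S \subset 'N(K).
  by apply/subsetP=> s Ss; apply/normP; rewrite -cfker_conjg ?(subsetP nNS) // inertiaJ ?(subsetP IjS).
have cNSK : (S / K \subset 'C(N / K))%g.
  by rewrite centsC quotient_cents2r // -lin_char_inertia.
have Dj : ('chi_(quo_Iirr K j) %% K)%CF = 'chi_j by rewrite quo_IirrE // cfQuoK.
have [||||||i ci IiS] := @invariant_irr_over_faithful _ (G / K)%G (N / K)%G (S / K)%G (quo_Iirr K j).
- by rewrite -quotient_der ?quotientS.
- by rewrite subsetI quotientS ?quotient_cents // centsC.
- exact: quotient_norms.
- exact: cNSK.
- exact: coprime_morph.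
- by rewrite /cfaithful quo_IirrE // cfker_quo // trivg_quotient.
exists (mod_Iirr i).
  rewrite irr_consttE mod_IirrE // -Dj (cfResMod _ sNG) //.
  by rewrite cfMod_iso // -irr_consttE.
apply/subsetP=> s Ss; have nGs := subsetP nGS s Ss; have nKs := subsetP nKS s Ss.
rewrite inE nGs; apply/eqP/cfun_inP=> x Gx; rewrite cfConjgE // mod_IirrE //.
have nKs' : s^-1%g \in 'N(K) by rewrite groupV.
have nKx := subsetP nKG x Gx.
rewrite !cfModE ?memJ_norm ?groupV // morphJ //.
by apply: inertia_valJ; rewrite (subsetP IiS) ?mem_quotient ?groupV.
Qed.

End CentralCharacters.

Section LinearCharacters.
Variable gT : finGroupType.
Implicit Types (A B G H K L M N P Q R S X Y : {group gT}) (n p q r s m a : nat).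

(** If P centralised both R / N and N, it would centralise R by coprime action,
and would be a normal abelian Sylow subgroup of G. *)
Lemma comm_not_sub_center p G R N H P :
    R ><| H = G -> R^`(1)%g = N -> N \subset 'Z(R) -> prime p -> p^'.-group R ->
    solvable R -> p.-Sylow(H) P -> P <| H -> abelian P -> P \subset 'C(N) ->
    degree_divisor G p ->
  ~~ ([~: R, P] \subset N).
Proof.
move=> defG R'N sNZ pr_p p'R solR sylP nsPH abP cPN.
have [nsRG sHG mulRH nRH tiRH] := sdprod_context defG.
have nRP := subset_trans (normal_sub nsPH) nRH.
have pP := pHall_pgroup sylP.
have coRP : coprime #|R| #|P| by rewrite coprime_sym (pnat_coprime pP).
apply: contraL => sRPN; apply: (Ito_normal_abelian_Sylow _ _ abP pr_p).
  rewrite /pHall (subset_trans (normal_sub nsPH)) // pP /=.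
  rewrite -divgS ?(subset_trans (normal_sub nsPH)) // -(sdprod_card defG).
  rewrite -muln_divA ?cardSg ?normal_sub // divgS ?normal_sub // pnatM.
  by apply/andP; split=> //; case/and3P: sylP.
rewrite /normal (subset_trans (normal_sub nsPH)) //= -mulRH mul_subG ?(normal_norm nsPH) //.
rewrite cents_norm //; apply/commG1P/trivgP.
rewrite /= -(coprime_commGid nRP coRP solR).
by apply: subset_trans (commSg _ sRPN) _; rewrite (commG1P _) // centsC.
Qed.

(** The characters of R / N trivial on A make up at most half of all, those trivial
on B as well, and the principal character is in both halves. *)
Lemma exists_lin_char_nontriv_on R N A B :
    R^`(1)%g \subset N -> N \subset R -> A \subset R -> B \subset R ->
    ~~ (A \subset N) -> ~~ (B \subset N) ->
  exists t : Iirr R, [/\ N \subset cfker 'chi_t, ~~ (A \subset cfker 'chi_t)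
    & ~~ (B \subset cfker 'chi_t)].
Proof.
move=> sR'N sNR sAR sBR nAN nBN.
pose T (C : {group gT}) := [set t : Iirr R | C \subset cfker 'chi_t].
have half (C : {group gT}) : C \subset R -> ~~ (C \subset N) -> (2 * #|T (N <*> C)%G| <= #|T N|)%N.
  move=> sCR nCN; rewrite !card_Iirr_ker //; last 2 first.
  - exact: subset_trans sR'N (joing_subl _ _).
  - by rewrite join_subG sNR.
  have sNJ : N \subset N <*> C := joing_subl _ _.
  have sJR : N <*> C \subset R by rewrite join_subG sNR.
  rewrite -(Lagrange_index sJR sNJ) mulnC leq_mul // indexg_gt1.
  by apply: contra nCN; apply: subset_trans (joing_subr _ _).
pose U := T (N <*> A)%G :|: T (N <*> B)%G.
have ltU : (#|U| < #|T N|)%N.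
  rewrite cardsU -(ltn_pmul2l (isT : 0 < 2)%N) mulnBr mulnDr.
  have I0 : (0 < #|T (N <*> A)%G :&: T (N <*> B)%G|)%N.
    apply/card_gt0P; exists 0; rewrite !inE cfker_irr0.
    by rewrite !join_subG sNR sAR sBR.
  have := subset_leq_card (subsetIl (T (N <*> A)%G) (T (N <*> B)%G)).
  have := half A sAR nAN; have := half B sBR nBN; move: I0.
  set a := #|T (N <*> A)%G|; set b := #|T (N <*> B)%G|; set c := #|_ :&: _|.
  by set d := #|T N|; clearbody a b c d; clear; lia.
have [t Tt nUt] : exists2 t, t \in T N & t \notin U.
  apply/subsetPn; apply: contraL ltU => /subset_leq_card; by rewrite -leqNgt.
exists t; move: Tt nUt; rewrite !inE !join_subG => -> /=.
by rewrite negb_or => /andP[].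
Qed.
End LinearCharacters.

Section SemiExtraspecial.
Variable gT : finGroupType.
Implicit Types (A B G H K L M N P Q R S X Y : {group gT}) (n p q r s m a : nat).

(** Y / N is the centralizer of P in R / N. Coprime action gives R = Y [R, P], and
the three subgroups lemma shows that [R, P] centralises Y. *)
Lemma cent_mod_center R N P :
    R^`(1)%g \subset N -> N \subset 'Z(R) -> P \subset 'N(R) -> P \subset 'C(N) ->
    coprime #|R| #|P| -> solvable R -> N <| R -> ~~ ([~: R, P] \subset N) ->
  exists Y, [/\ N \subset Y, Y \subset R, (R \subset Y * [~: R, P])%g,
     [~: R, P] \subset 'C(Y) & 
     [/\ {in R, forall d, (d \in Y) = ([~: [set d], P] \subset N)},
      ~~ ([~: R, P] \subset Y) & 
       forall B, B \subset 'N(R) -> B \subset 'N(N) -> B \subset 'N(P) -> B \subset 'N(Y)]].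
Proof.
move=> sR'N sNZ nRP cNP coRP solR nsNR ncRP; have nNR := normal_norm nsNR.
have nNP : P \subset 'N(N) by apply: cents_norm.
pose Y := (R :&: coset N @*^-1 'C(P / N))%G.
have sNY : N \subset Y.
  rewrite subsetI (normal_sub nsNR) /= -sub_quotient_pre ?normG //.
  by rewrite trivg_quotient sub1G.
have sYR : Y \subset R := subsetIl _ _.
have Ydef d : d \in R -> (d \in Y) = ([~: [set d], P] \subset N).
  move=> Rd; have nNd := subsetP nNR d Rd.
  rewrite inE Rd /= -sub1set -sub_quotient_pre ?sub1set //.
  by rewrite quotient_cents2 // sub1set.
have cRPY : [~: Y, P] \subset N.
  rewrite gen_subG; apply/subsetP=> _ /imset2P[y x Yy Px ->].
  have := Yy; rewrite Ydef ?(subsetP sYR) // => /subsetP; apply.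
  by apply: mem_commg; rewrite ?set11.
have cNR : R \subset 'C(N) by rewrite centsC (subset_trans sNZ) ?subsetIr.
have cent : [~: R, P] \subset 'C(Y).
  apply/commG1P; apply: three_subgroup.
    apply/commG1P; apply: subset_trans (_ : N \subset _); first by rewrite commGC.
    by rewrite centsC.
  apply/commG1P; apply: subset_trans (_ : N \subset _).
    by apply: subset_trans sR'N; apply: commgSS.
  by rewrite centsC.
exists Y; split=> //.
  have sCY : 'C_R(P) \subset Y.
    apply/subsetP=> d /setIP[Rd cd]; rewrite Ydef //.
    by rewrite (commG1P _) ?sub1G // sub1set.
  have := coprime_cent_prod nRP coRP solR => DR.
  have nRG : R \subset 'N([~: R, P]) := commg_norml _ _.
  have nCR : 'C_R(P) \subset 'N([~: R, P]) := subset_trans (subsetIl _ _) nRG.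
  by rewrite -{1}DR -(normC nCR) mulSg.
split=> //.
  apply: contra ncRP => sRPY; rewrite -(coprime_commGid nRP coRP solR).
  by apply: subset_trans (commSg _ sRPY) _.
move=> B nRB nNB nPB; apply/subsetP=> b Bb; rewrite inE.
apply/subsetP=> _ /imsetP[y Yy ->]; have Ry := subsetP sYR y Yy.
rewrite Ydef ?memJ_norm ?(subsetP nRB) //.
have := Yy; rewrite Ydef // -(conjSg _ _ b) conjsRg conjg_set1.
by rewrite !(normsP _ b Bb).
Qed.

(** As N is central, x |-> [d, x] is a homomorphism from R to N. Its kernel
contains Y and d, so its image J has fewer than |R : Y| elements, and it
suffices that J = N. Otherwise some character i of R lies over a nonprincipal
character of N / J. It is nonlinear, and d is in its centre, so i(d) is not 0.
Choose x in P with [d, x] not in N and a linear k with k([d, x]) different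
from 1. Both i and k i are nonlinear, hence fixed by x, although k differs at d
and at d^x. *)
Lemma card_center_lt_index R N P Y d :
    R^`(1)%g = N -> N \subset 'Z(R) -> P \subset 'N(R) ->
    (forall i : Iirr R, 'chi_i \isn't a linear_char -> P \subset 'I['chi_i]) ->
    Y \subset R -> d \in R -> d \notin Y -> Y \subset 'C[d]%g ->
    ~~ ([~: [set d], P] \subset N) ->
  (#|N| < #|R : Y|)%N.
Proof.
move=> R'N sNZ nRP fixP sYR Rd nYd cYd ncd.
have sNR := subset_trans sNZ (center_sub R).
have cNR : R \subset 'C(N) by rewrite centsC (subset_trans sNZ) ?subsetIr.
have Nc x : x \in R -> [~ d, x] \in N by move=> Rx; rewrite -R'N mem_commg.
have cdM x y : x \in R -> y \in R -> ([~ d, x] * [~ d, y])%g = [~ d, y * x].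
  move=> Rx Ry; rewrite commgMJ; congr (_ * _)%g.
  apply/esym/conjg_fixP/commgP/esym/(centsP cNR) => //; exact: Nc.
have gJ : group_set [set [~ d, x] | x in R].
  apply/group_setP; split; first by apply/imsetP; exists 1%g; rewrite ?commg1.
  move=> _ _ /imsetP[x Rx ->] /imsetP[y Ry ->].
  by rewrite cdM //; apply: imset_f; rewrite groupM.
pose J := Group gJ; have sJN : J \subset N.
  by apply/subsetP=> _ /imsetP[x Rx ->]; apply: Nc.
have cardJ : #|J| = #|R : 'C_R[d]|.
  rewrite index_cent1 -(card_lcoset J d); apply: eq_card => u.
  apply/lcosetP/imsetP=> [[_ /imsetP[x Rx ->] ->] | [x Rx ->]].
    by exists x; rewrite // conjg_mulR.
  by exists [~ d, x]; [apply: imset_f | rewrite conjg_mulR].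
have sYC : Y \subset 'C_R[d] by rewrite subsetI sYR.
have ltJ : (#|J| < #|R : Y|)%N.
  have sCR : 'C_R[d] \subset R := subsetIl _ _.
  rewrite cardJ -(Lagrange_index sCR sYC) ltn_Pmulr ?indexg_gt0 // indexg_gt1.
  by apply: contra nYd => /subsetP; apply; rewrite inE Rd cent1id.
have [<- // | neJN] := eqVneq (gval J) N.
have abN : abelian N := abelianS sNZ (center_abelian R).
have N'J : N^`(1)%g \subset J by rewrite (derG1P abN) sub1G.
have [t kJ t0] : exists2 t : Iirr N, J \subset cfker 'chi_t & t != 0.
  have : (1 < #|[set t : Iirr N | J \subset cfker 'chi_t]|)%N.
    rewrite card_Iirr_ker // indexg_gt1; apply: contra neJN => sNJ.
    by rewrite eqEsubset sJN.
  rewrite (cardsD1 0) inE cfker_irr0 sJN add1n ltnS => /card_gt0P[t].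
  by rewrite !inE => /andP[t0 kJ]; exists t.
have [i] := constt_cfInd_irr t sNR; rewrite constt_Ind_Res => ct.
have Dres := Res_central sNZ ct.
have nonlin k Dk : 'chi_k \isn't a linear_char :=
  nonlinear_over_der1 (i := k) R'N Dk t0.
have kerJ : J \subset cfker 'chi_i.
  apply/subsetP=> x Jx; have Nx := subsetP sJN x Jx.
  rewrite cfkerEirr inE -!(cfResE _ sNR) // Dres !cfunE.
  by rewrite (cfker1 (subsetP kJ x Jx)).
have nkR : R \subset 'N(cfker 'chi_i) := normal_norm (cfker_normal _).
have Zd : d \in 'Z('chi_i)%CF.
  rewrite -cycle_subG -(quotientSGK _ (normal_sub (cfker_center_normal _))); last first.
    by rewrite cycle_subG (subsetP nkR).
  rewrite cfcenter_eq_center quotient_cycle ?(subsetP nkR) // cycle_subG.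
  apply/setIP; split; first exact: mem_quotient.
  apply/centP=> _ /morphimP[y nky Ry ->]; apply/commgP.
  rewrite -morphR ?(subsetP nkR) //; apply/eqP/coset_id; apply: (subsetP kerJ).
  exact: imset_f.
have chid : 'chi_i d != 0.
  have : `|'chi_i d| == 'chi_i 1%g by rewrite -irr_cfcenterE.
  by apply: contraTneq => ->; rewrite normr0 eq_sym irr1_neq0.
have [x Px nx] : exists2 x, x \in P & [~ d, x] \notin N.
  apply/exists_inP; apply: contraR ncd => /exists_inPn ncx.
  rewrite gen_subG; apply/subsetP=> _ /imset2P[y x /set1P-> Px ->].
  by have := ncx x Px; rewrite negbK.
have nRx := subsetP nRP x Px; have Rdx : (d ^ x)%g \in R by rewrite memJ_norm.
have Rcdx : [~ d, x] \in R by rewrite commgEl groupM ?groupV.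
have [k lin_k kdx] : exists2 k : Iirr R, 'chi_k \is a linear_char & [~ d, x] \notin cfker 'chi_k.
  apply/exists_inP; apply: contraR nx => /exists_inPn kerR.
  rewrite -R'N -cap_cfker_lin_irr; apply/bigcapP=> k lin_k.
  by have := kerR k lin_k; rewrite negbK.
have irr_ki : 'chi_k * 'chi_i \in irr R by apply: mul_lin_irr => //; apply: mem_irr.
have /irrP[j Dj] := irr_ki.
have kN : N \subset cfker 'chi_k by rewrite -R'N -lin_irr_der1.
have Dresj : 'Res[N] 'chi_j = 'chi_j 1%g *: 'chi_t.
  apply/cfun_inP=> y Ny; rewrite -Dj rmorphM /= Dres !cfunE cfResE //.
  by rewrite (cfker1 (subsetP kN y Ny)) (lin_char1 lin_k) !mul1r.
have fix_i := inertia_valJ d (subsetP (fixP i (nonlin i Dres)) x Px).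
have := inertia_valJ d (subsetP (fixP j (nonlin j Dresj)) x Px).
rewrite -Dj !cfunE fix_i => /(mulIf chid) => Dk.
case/negP: kdx; rewrite lin_char_ker //.
rewrite commgEl lin_charM ?groupV // Dk lin_charV // mulVf //.
exact: lin_char_neq0.
Qed.

End SemiExtraspecial.

(** * Palfy's theorem *)

Section CentralisingSylow.
Variable gT : finGroupType.
Implicit Types (A B G H K L M N P Q R S X Y : {group gT}) (n p q r s m a : nat).

(** P centralises N. If a Sylow q-subgroup Q also does, a linear character of R
nontrivial on [R, P] and on [R, Q] is moved by both, so that p q divides a
degree. Otherwise let Y / N be the centralizer of P in R / N. The prime p
divides every degree over a nonprincipal character of R / Y, so q does not, and
these characters are partitioned by the Sylow q-subgroups of H, as are those of
N. The two resulting expressions of the number of Sylow q-subgroups force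
|R : Y| = |N|, against [card_center_lt_index]; this lemma applies because
nonlinear characters of R have degrees divisible by r, so that P fixes them. *)
Lemma palfy_pgroup_asym p q r G R N H P :
    R ><| H = G -> solvable G -> prime p -> prime q -> prime r ->
    p != q -> p != r -> q != r -> r.-group R -> r^'.-group H ->
    R^`(1)%g = N -> N \subset 'Z(R) -> N :!=: 1%g -> N <| G ->
    p.-Sylow(H) P -> P <| H -> abelian P -> P \subset 'C(N) ->
    Sylow_fixing q N H -> degree_divisor G p -> degree_divisor G q ->
    ~~ degree_divisor G (p * q) -> ~~ degree_divisor G (p * r) -> False.
Proof.
move=> defG solG pr_p pr_q pr_r npq npr nqr rR r'H R'N sNZ ntN nsNG.
move=> sylP nsPH abP cNP fixq dp dq nadj nadjr.
have [nsRG sHG mulRH nRH tiRH] := sdprod_context defG.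
have sRG := normal_sub nsRG; have solR := solvableS sRG solG.
have solH := solvableS sHG solG.
have sNR := subset_trans sNZ (center_sub R).
have nsNR : N <| R := normalS sNR sRG nsNG.
have nNH : H \subset 'N(N) := subset_trans sHG (normal_norm nsNG).
have r'part (u : nat) : u != r -> u^'.-group R.
  by move=> nur; apply: pi_pnat rR _; rewrite !inE eq_sym.
have co (u v : nat) : prime u -> prime v -> u != v -> coprime u v.
  by move=> pu pv uv; rewrite prime_coprime // dvdn_prime2.
have moved (u : nat) (U : {group gT}) (t : Iirr R) (i : Iirr G) :
    u.-group U -> U <| H -> t \in irr_constt ('Res[R] 'chi_i) ->
    ~~ (U \subset 'I['chi_t]) -> (u %| chi_degree i)%N.
  move=> uU nsUH ct nUt; have nRU := subset_trans (normal_sub nsUH) nRH.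
  have nsXG : R <*> U <| G.
    rewrite /normal join_subG sRG (subset_trans (normal_sub nsUH)) //=.
    rewrite -{1}mulRH mul_subG //; first by apply: subset_trans (joing_subl R U) (normG _).
    by rewrite normsY // normal_norm.
  apply: (pdvd_degree_over nsRG nsXG _ _ ct); first exact: joing_subl.
    by rewrite /= quotientYidl // quotient_pgroup.
  by apply: contra nUt; apply: subset_trans; apply: joing_subr.
have pP := pHall_pgroup sylP.
have nRP := subset_trans (normal_sub nsPH) nRH.
have coRP : coprime #|R| #|P| by rewrite coprime_sym; apply: (pnat_coprime pP (r'part p npr)).
have ncP : ~~ ([~: R, P] \subset N).
  exact: comm_not_sub_center defG R'N sNZ pr_p (r'part p npr) solR sylP nsPH abP cNP dp.
have sR'N : R^`(1)%g \subset N by rewrite R'N.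
have lin_of (t : Iirr R) : N \subset cfker 'chi_t -> 'chi_t \is a linear_char.
  by rewrite lin_irr_der1 R'N.
have sRPR : [~: R, P] \subset R by rewrite commg_subl.
have [qi | q'i] := boolP (q %| #|H : 'C_H(N)|)%N; last first.
  have [Q [sylQ nsQH abQ cNQ]] := normal_Sylow_of_centralising nNH ntN pr_q fixq q'i.
  have ncQ : ~~ ([~: R, Q] \subset N).
    exact: comm_not_sub_center defG R'N sNZ pr_q (r'part q nqr) solR sylQ nsQH abQ cNQ dq.
  have nRQ := subset_trans (normal_sub nsQH) nRH.
  have sRQR : [~: R, Q] \subset R by rewrite commg_subl.
  have [t [kN nP nQ]] := exists_lin_char_nontriv_on sR'N sNR sRPR sRQR ncP ncQ.
  have [i] := constt_cfInd_irr t sRG; rewrite constt_Ind_Res => ct.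
  case/negP: nadj; apply: (degree_divisor_coprime (co p q pr_p pr_q npq) (i := i)).
    by apply: (moved p P t) ct _; rewrite // lin_char_inertia ?lin_of.
  apply: (moved q Q t) ct _; rewrite ?(pHall_pgroup sylQ) //.
  by rewrite lin_char_inertia ?lin_of.
have [Y [sNY sYR sRYP cYP [Ydef nRPY normY]]] :=
  cent_mod_center sR'N sNZ nRP cNP coRP solR nsNR ncP.
have nYH : H \subset 'N(Y) := normY H nRH nNH (normal_norm nsPH).
have sR'Y : R^`(1)%g \subset Y := subset_trans sR'N sNY.
have nYR : R \subset 'N(Y) := sub_der1_norm sR'Y sYR.
(* R = Y [R, P], so a P-invariant linear character trivial on Y is principal. *)
have nPt (t : Iirr R) : Y \subset cfker 'chi_t -> t != 0 -> ~~ (P \subset 'I['chi_t]).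
  move=> kY; apply: contra; rewrite lin_char_inertia //; last first.
    exact: lin_of (subset_trans sNY kY).
  move=> kRP; rewrite -subGcfker; apply: subset_trans sRYP _.
  by rewrite mul_subG.
have uniqQ (t : Iirr R) : Y \subset cfker 'chi_t -> t != 0 ->
    exists2 Q, Q \in 'Syl_q(H) &
      {in 'Syl_q(H), forall Q', (Q' \subset 'I['chi_t]) = (Q' == Q)}.
  move=> kY t0; have lint := lin_of t (subset_trans sNY kY).
  have [Q sylQ] := Sylow_exists q 'I_H['chi_t].
  have [] := stabilizer_Sylow defG solH pr_q (lin_char_extends_inertia defG lint) _ sylQ.
    move=> i ct; apply: contra nadj => qdi.
    apply: (degree_divisor_coprime (co p q pr_p pr_q npq) (i := i)) qdi.
    exact: (moved p P t) pP nsPH ct (nPt t kY t0).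
  move=> sylQH nsQ _; have := normal_Sylow_sub_unique sylQH nsQ (subsetIl _ _) (normal_refl H).
  case=> sylQ' uQ; exists (Q :&: H)%G => // Q' sylQ''; rewrite -uQ // subsetI andb_idl // => _.
  by move: sylQ''; rewrite inE => /pHall_sub.
pose T := [set t : Iirr R | Y \subset cfker 'chi_t].
have T0 : 0 \in T by rewrite inE cfker_irr0.
have [Q0 sylQ0] := Sylow_exists q H.
have sylQ0' : Q0 \in 'Syl_q(H) by rewrite inE.
have cardFQ Q : Q \in 'Syl_q(H) ->
    #|[set t in T | Q \subset 'I['chi_t]]| = #|R : Y <*> [~: R, Q0]|.
  move=> sylQ; have nRQ : Q \subset 'N(R).
    by apply: subset_trans nRH; move: sylQ; rewrite inE => /pHall_sub.
  have := card_Iirr_ker_fixed sR'Y sYR nRQ.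
  have -> : #|[set t in T | Q \subset 'I['chi_t]]|
    = #|[set t : Iirr R | (Y \subset cfker 'chi_t) && (Q \subset 'I['chi_t])]|.
    by apply: eq_card => t; rewrite !inE.
  move=> ->; move: sylQ; rewrite inE => sylQ.
  have [x Hx ->] := Sylow_trans sylQ0 sylQ.
  by apply: index_commg_conj; rewrite ?(subsetP nRH) ?(subsetP nYH).
have [f lef Df] : exists2 f, (f <= logn r #|R|)%N & #|R : Y| = (r ^ f)%N.
  apply/(dvdn_pfactor _ _ pr_r); rewrite -(card_pgroup rR); exact: dvdn_indexg.
have [g leg Dg] : exists2 g, (g <= logn r #|R|)%N & #|R : Y <*> [~: R, Q0]| = (r ^ g)%N.
  apply/(dvdn_pfactor _ _ pr_r); rewrite -(card_pgroup rR); exact: dvdn_indexg.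
have rX k : (0 < r ^ k)%N by rewrite expn_gt0 prime_gt0.
have eq1 : (#|'Syl_q(H)| * (r ^ g).-1 = (r ^ f).-1)%N.
  rewrite -Df -(card_Iirr_ker sR'Y sYR); apply: (card_Syl_fixed nRH T0) => //.
    by move=> t; rewrite inE; apply: uniqQ.
  by move=> Q sylQ; rewrite cardFQ // Dg prednK.
have rN := pgroupS sNR rR; have abN : abelian N := abelianS sNZ (center_abelian R).
have cardN := card_pgroup rN; set m := logn r #|N| in cardN.
have [b [cardFb leb eq2]] := card_Syl_Sylow_fixing abN pr_r cardN nNH fixq (normal_refl H) sylQ0'.
have m_gt0 : (0 < m)%N.
  by rewrite lt0n; apply: contraNneq ntN => m0; rewrite trivg_card1 cardN m0.
have f_gt0 : (0 < f)%N.
  rewrite lt0n; apply: contraNneq nRPY => f0; apply: subset_trans sRPR _.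
  by rewrite -indexg_eq1 Df f0.
have n_gt1 : (1 < #|'Syl_q(H)|)%N.
  rewrite ltnNge; apply/negP=> n_le1.
  have n1 : #|'Syl_q(H)| = 1%N.
    by apply/eqP; rewrite eqn_leq n_le1; apply/card_gt0P; exists Q0.
  move: eq2; rewrite n1 mul1n => /(congr1 succn); rewrite !prednK // => eq2.
  have nNQ : Q0 \subset 'N(N) := subset_trans (pHall_sub sylQ0) nNH.
  have cQ0 : Q0 \subset 'C(N) by apply: centralises_of_fixed; rewrite ?cardFb ?eq2 ?cardN.
  case/idPn: qi; have /and3P[sQH qQ q'HQ] := sylQ0.
  rewrite -p'natE //; apply: pnat_dvd q'HQ; apply: indexgS.
  by rewrite subsetI sQH.
have fm := repunit_quotient_inj (prime_gt1 pr_r) n_gt1 f_gt0 m_gt0 eq1 eq2.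
have [d RPd nYd] := subsetPn nRPY.
have Rd := subsetP sRPR d RPd.
have fixP (t : Iirr R) : 'chi_t \isn't a linear_char -> P \subset 'I['chi_t].
  move=> nlt; apply: contraR nadjr => nPt'.
  have [i] := constt_cfInd_irr t sRG; rewrite constt_Ind_Res => ct.
  apply: (degree_divisor_coprime (co p r pr_p pr_r npr) (i := i)).
    exact: (moved p P t) ct nPt'.
  apply: dvdn_trans (chi_degree_constt_Res nsRG ct).
  exact: pgroup_nonlinear_degree.
have cYd : Y \subset 'C[d]%g.
  by apply/subsetP=> y Yy; apply/cent1P/commute_sym; exact: (centsP cYP d RPd y Yy).
have ncd : ~~ ([~: [set d], P] \subset N) by rewrite -Ydef.
have := card_center_lt_index R'N sNZ nRP fixP sYR Rd nYd cYd ncd.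
by rewrite cardN Df fm ltnn.
Qed.
End CentralisingSylow.

Section PgroupCase.
Variable gT : finGroupType.
Implicit Types (A B G H K L M N P Q R S X Y : {group gT}) (n p q r s m a : nat).

(** Let S be the stabilizer of t in H. An S-invariant character i of R over t has
stabilizer S in H, and extends to its stabilizer in G by coprimeness. It is
nonlinear, so r divides all degrees over i, and p does not; [stabilizer_Sylow]
now applies to i. *)
Lemma Sylow_fixing_center p r G R N H :
    R ><| H = G -> solvable G -> prime p -> prime r -> p != r ->
    r.-group R -> r^'.-group H -> R^`(1)%g = N -> N \subset 'Z(R) -> N <| G ->
    ~~ degree_divisor G (p * r) ->
  Sylow_fixing p N H.
Proof.
move=> defG solG pr_p pr_r npr rR r'H R'N sNZ nsNG nadj t t0.
have [nsRG sHG mulRH nRH tiRH] := sdprod_context defG.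
have sRG := normal_sub nsRG; have solH := solvableS sHG solG.
have sNR := subset_trans sNZ (center_sub R).
have sR'N : R^`(1)%g \subset N by rewrite R'N.
set S := 'I_H['chi_t]%G; have sSH : S \subset H := subsetIl _ _.
have coRS : coprime #|R| #|S|.
  by apply: (pnat_coprime rR); apply: pgroupS sSH r'H.
have [i ci IiS] := invariant_irr_over sR'N sNZ (subset_trans sSH nRH) (subsetIr _ _) coRS.
have Dres := Res_central sNZ ci.
have nonlin := nonlinear_over_der1 R'N Dres t0.
have rdeg := pgroup_degree i rR; have rdvd := pgroup_nonlinear_degree rR nonlin.
have eqI : 'I_H['chi_i]%g = S.
  apply/eqP; rewrite eqEsubset; apply/andP; split; last first.
    by rewrite /= subsetI sSH.
  rewrite /= subsetI subsetIl; apply/subsetP=> x /setIP[Hx Ix].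
  have nNx : (x \in 'N(N))%g by rewrite (subsetP (normal_norm nsNG)) ?(subsetP sHG).
  rewrite inE nNx; apply/eqP/cfun_inP=> y Ny; rewrite cfConjgE //.
  have Nyx : (y ^ x^-1)%g \in N by rewrite memJ_norm ?groupV.
  apply: (mulfI (irr1_neq0 i)).
  have E z : z \in N -> 'chi_i 1%g * 'chi_t z = 'chi_i z.
    by move=> Nz; rewrite -(cfResE _ sNR Nz) Dres cfunE.
  by rewrite !E //; apply: inertia_valJ; rewrite groupV.
set I := 'I_G['chi_i]%G.
have sRI : R \subset I by rewrite sub_Inertia.
have nsRI : R <| I := normal_Inertia _ sRG.
have [c [Dc _ _]] : exists c : Iirr I, [/\ 'Res[R] 'chi_c = 'chi_i, 'o('chi_c)%CF = 'o('chi_i)%CF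
   & forall d, 'Res 'chi_d = 'chi_i -> coprime #|I : R| 'o('chi_d)%CF -> d = c].
  apply: extend_solvable_coprime_irr => //.
  - by rewrite quotient_sol // (solvableS _ solG) ?subsetIl.
  - exact: subsetIr.
  rewrite coprime_sym; apply: (pnat_coprime (pi := r)).
    rewrite pnatM rdeg andbT; apply: pnat_dvd rR.
    by rewrite cforder_lin_char_dvdG ?cfDet_lin_char.
  have r'GR : r^'.-nat #|G : R|.
    by rewrite -divgS // -(sdprod_card defG) mulKn.
  by apply: pnat_dvd r'GR; apply: indexSg; rewrite ?subsetIl.
have [P sylP] := Sylow_exists p S.
have sylP' : p.-Sylow('I_H['chi_i]) P by rewrite eqI.
have [] := stabilizer_Sylow defG solH pr_p (ex_intro _ c Dc) _ sylP'.
  move=> k ck; apply: contra nadj => pk.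
  apply: degree_divisor_coprime pk (dvdn_trans rdvd (chi_degree_constt_Res nsRG ck)).
  by rewrite prime_coprime // dvdn_prime2.
by rewrite eqI; exists P.
Qed.

(** By minimality of N, the normal Sylow subgroup R has derived subgroup N, and N
is central in R. So p and q have the Sylow fixing property on N, and the core
leaves the situation of [palfy_pgroup_asym] for p or for q. *)
Lemma palfy_pgroup_case p q r G N R :
    solvable G -> prime p -> prime q -> prime r -> p != q -> p != r -> q != r ->
    minnormal N G -> N \subset G -> r.-abelem N ->
    r.-Sylow(G) R -> R / N <| G / N -> abelian (R / N) ->
    degree_divisor G p -> degree_divisor G q -> degree_divisor G r ->
    ~~ degree_divisor G (p * q) -> ~~ degree_divisor G (p * r) ->
    ~~ degree_divisor G (q * r) -> False.
Proof.
move=> solG pr_p pr_q pr_r npq npr nqr minN sNG abelN sylR nsRNq abRq.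
move=> dp dq dr npq' npr' nqr'.
have [rN abN _] := and3P abelN.
have [/andP[ntN nNG] minN'] := mingroupP minN.
have nsNG : N <| G by apply/andP.
have sRG := pHall_sub sylR; have nNR := subset_trans sRG nNG.
have rR := pHall_pgroup sylR.
have sNR : N \subset R := normal_sub_max_pgroup (Hall_max sylR) rN nsNG.
have nsRG : R <| G.
  rewrite -(mulSGid sNR) -quotientK // -(quotientGK nsNG) cosetpre_normal.
  by [].
have nabR : ~~ abelian R.
  by apply: contraL dr => abR; exact: Ito_normal_abelian_Sylow abR pr_r.
have R'N : R^`(1)%g = N.
  apply: minN'; last by rewrite der1_min.
  have -> : R^`(1)%g != 1%g by apply: contra nabR => /eqP/derG1P.
  by rewrite normal_norm // gFnormal_trans.
have sNZ : N \subset 'Z(R).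
  have ntNZ : N :&: 'Z(R) != 1%g.
    apply: meet_center_nil ntN; first exact: pgroup_nil rR.
    exact: normalS sNR sRG nsNG.
  have <- : N :&: 'Z(R) = N.
    apply: minN'; last exact: subsetIl.
    by rewrite ntNZ normsI // normal_norm // gFnormal_trans.
  exact: subsetIr.
have hallR : Hall G R := pHall_Hall sylR.
have /splitsP[H /complP[tiRH mulRH]] := SchurZassenhaus_split hallR nsRG.
have sHG : H \subset G by rewrite -mulRH mulG_subr.
have nRH : H \subset 'N(R) := subset_trans sHG (normal_norm nsRG).
have defG : R ><| H = G by rewrite sdprodE.
have r'H : r^'.-group H.
  have /and3P[_ _ r'GR] := sylR; apply: pnat_dvd r'GR.
  by rewrite -divgS // -(sdprod_card defG) mulKn.
have fixp := Sylow_fixing_center defG solG pr_p pr_r npr rR r'H R'N sNZ nsNG npr'.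
have fixq := Sylow_fixing_center defG solG pr_q pr_r nqr rR r'H R'N sNZ nsNG nqr'.
have nNH : H \subset 'N(N) := subset_trans sHG nNG.
have solH := solvableS sHG solG.
have defNH : N ><| H = N <*> H.
  by rewrite sdprodEY //; apply/trivgP; rewrite -tiRH setSI.
have := Sylow_centralises_core defNH abN pr_r rN solH pr_p pr_q npq.
case=> [i nNi | | p'i | q'i].
- split; first exact: degrees_of_Sylow_fixing defNH abN pr_p fixp nNi.
  exact: degrees_of_Sylow_fixing defNH abN pr_q fixq nNi.
- by apply: contra npq'; apply: degree_divisor_sdprod defG.
- have [P [sylP nsPH abP cNP]] := normal_Sylow_of_centralising nNH ntN pr_p fixp p'i.
  exact: palfy_pgroup_asym defG solG pr_p pr_q pr_r npq npr nqr rR r'H R'N sNZ ntN nsNG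
    sylP nsPH abP cNP fixq dp dq npq' npr'.
have [Q [sylQ nsQH abQ cNQ]] := normal_Sylow_of_centralising nNH ntN pr_q fixq q'i.
rewrite eq_sym in npq; rewrite mulnC in npq'.
exact: palfy_pgroup_asym defG solG pr_q pr_p pr_r npq nqr npr rR r'H R'N sNZ ntN nsNG
    sylQ nsQH abQ cNQ fixp dq dp npq' nqr'.
Qed.
End PgroupCase.

Lemma palfy_step p q r (gT : finGroupType) (G N : {group gT}) :
    solvable G -> prime p -> prime q -> prime r -> p != q -> p != r -> q != r ->
    minnormal N G -> N \subset G -> ~~ degree_divisor (G / N)%G r ->
    degree_divisor G p -> degree_divisor G q -> degree_divisor G r ->
    ~~ degree_divisor G (p * q) -> ~~ degree_divisor G (p * r) ->
    ~~ degree_divisor G (q * r) -> False.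
Proof.
move=> solG pr_p pr_q pr_r npq npr nqr minN sNG ndr dp dq dr npq' npr' nqr'.
have [nNG ntN abelN] := minnormal_solvable minN sNG solG.
have [s pr_s abelNs] := is_abelemP abelN.
have [R sylR] := Sylow_exists r G.
have nNR := subset_trans (pHall_sub sylR) nNG.
have sylRN : r.-Sylow(G / N) (R / N) := quotient_pHall nNR sylR.
have [nsRN abRN] := Ito_converse_solvable (quotient_sol N solG) pr_r sylRN ndr.
have [sr | nsr] := eqVneq s r.
  rewrite sr in abelNs.
  exact: palfy_pgroup_case solG pr_p pr_q pr_r npq npr nqr minN sNG abelNs sylR
    nsRN abRN dp dq dr npq' npr' nqr'.
exact: palfy_coprime_case solG pr_p pr_q pr_r npq npr nqr minN sNG pr_s abelNs nsr
  sylR nsRN abRN dp dq dr npq' npr' nqr'.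
Qed.

(** In a quotient of a minimal counterexample by a minimal normal subgroup, one of
the three primes divides no degree any longer. *)
Theorem palfy_three_primes (gT : finGroupType) (G : {group gT}) p q r :
    solvable G -> prime p -> prime q -> prime r -> p != q -> p != r -> q != r ->
    degree_divisor G p -> degree_divisor G q -> degree_divisor G r ->
  [|| degree_divisor G (p * q), degree_divisor G (p * r)
    | degree_divisor G (q * r)].
Proof.
have [n] := ubnP #|G|; elim: n => // n IHn in gT G *; move=> /ltnSE-leGn.
move=> solG pr_p pr_q pr_r npq npr nqr dp dq dr.
apply/idPn; rewrite !negb_or => /and3P[npq' npr' nqr'].
have [G1 | ntG] := eqVneq (gval G) 1%g.
  have /existsP[i pi] := dp; have := dvd_irr1_cardG i.
  rewrite -chi_degreeE dvdC_nat G1 cards1 dvdn1 => /eqP d1.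
  by move: pi; rewrite d1 dvdn1 gtn_eqF ?prime_gt1.
have [N minN sNG] := minnormal_exists ntG (normG G).
have [nNG ntN _] := minnormal_solvable minN sNG solG.
have nsNG : N <| G by apply/andP.
have lt_n : (#|(G / N)%G| < n)%N by rewrite (leq_trans _ leGn) // ltn_quotient.
have := IHn _ (G / N)%G lt_n (quotient_sol N solG) pr_p pr_q pr_r npq npr nqr.
have ddN m : ~~ degree_divisor G m -> degree_divisor (G / N)%G m = false.
  by move=> nm; apply: contraNF nm; apply: degree_divisor_quotient.
rewrite (ddN _ npq') (ddN _ npr') (ddN _ nqr') /=.
have [_|ndr] := boolP (degree_divisor (G / N)%G r); last first.
  by case: (palfy_step solG pr_p pr_q pr_r npq npr nqr minN sNG ndr dp dq dr npq' npr' nqr').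
have [_|ndq] := boolP (degree_divisor (G / N)%G q); last first.
  rewrite eq_sym in nqr; rewrite (mulnC q) in nqr'.
  by case: (palfy_step solG pr_p pr_r pr_q npr npq nqr minN sNG ndq dp dr dq npr' npq' nqr').
have [_|ndp] := boolP (degree_divisor (G / N)%G p); first by move=> /(_ isT isT isT).
rewrite eq_sym in npq; rewrite eq_sym in npr; rewrite (mulnC p) in npq'; rewrite (mulnC p) in npr'.
by case: (palfy_step solG pr_q pr_r pr_p nqr npq npr minN sNG ndp dq dr dp nqr' npq' npr').
Qed.

Lemma degree_divisor_cd (gT : finGroupType) (G : {group gT}) n :
  has (dvdn n) (cd G) = degree_divisor G n.
Proof.
apply/hasP/existsP=> [[d + nd] | [i ni]].
  by rewrite mem_undup => /imageP[i _ di]; exists i; rewrite -di.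
by exists (chi_degree i) => //; rewrite mem_undup; apply/imageP; exists i.
Qed.

Lemma char_graph_no_independent_triple (gT : finGroupType) (G : {group gT}) :
  solvable G -> no_independent_triple (char_graph G).
Proof.
move=> solG x y z nxy nxz nyz.
have rhoP (u : char_graph G) : prime (val u) /\ degree_divisor G (val u).
  by have := valP u; rewrite mem_rho degree_divisor_cd => /andP[].
have [[px dx] [py dy]] := (rhoP x, rhoP y); have [pz dz] := rhoP z.
have := palfy_three_primes solG px py pz nxy nxz nyz dx dy dz.
have edgeE (u v : char_graph G) :
    u != v -> edge u v = degree_divisor G (val u * val v).
  by move=> nuv; rewrite -degree_divisor_cd -[LHS]/(_ && _) nuv.
by rewrite !edgeE.
Qed.

(** * The alternating group of degree five *)

Section AlternatingGroup.
Local Open Scope nat_scope.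
Local Open Scope group_scope.

(** One-line notation turns the calculations with even permutations of five points
into calculations with lists of numbers. *)
Definition code (s : {perm 'I_5}) : seq nat := [seq val (s i) | i <- enum 'I_5].

Definition compose (a b : seq nat) : seq nat := [seq nth 0 b i | i <- a].

(** The parity of the number of inversions. *)
Definition even_code (a : seq nat) : bool :=
  ~~ odd (sumn [seq sumn [seq (nth 0 a j < nth 0 a i : nat) | j <- iota i (5 - i)] | i <- iota 0 5]).

Definition even_codes : seq (seq nat) := [seq a <- permutations (iota 0 5) | even_code a].

Lemma codeM s t : code (s * t) = compose (code s) (code t).
Proof.
rewrite /code /compose -map_comp; apply: eq_map => i /=.
by rewrite permM (nth_map i) ?nth_ord_enum // size_enum_ord.
Qed.

Lemma nth_code s (i : 'I_5) : nth 0 (code s) i = s i.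
Proof. by rewrite (nth_map i) ?nth_ord_enum // size_enum_ord. Qed.

Lemma code_inj : injective code.
Proof. by move=> s t e; apply/permP=> i; apply/val_inj; rewrite /= -!nth_code e. Qed.

Lemma perm_code s : perm_eq (code s) (iota 0 5).
Proof.
rewrite -val_enum_ord /code (map_comp val s); apply/perm_map/uniq_perm.
- by rewrite map_inj_uniq ?enum_uniq //; apply: perm_inj.
- exact: enum_uniq.
move=> i; rewrite mem_enum -[i](permKV s) map_f // mem_enum //.
Qed.

Lemma code_onto a : perm_eq a (iota 0 5) -> exists s, code s = a.
Proof.
move=> pa; have sa : size a = 5 by rewrite (perm_size pa).
pose f (i : 'I_5) : 'I_5 := inord (nth 0 a i).
have fE i : val (f i) = nth 0 a i.
  rewrite /f /= inordK // -[_ < _]/(nth 0 a i < 0 + 5); have := mem_nth 0 (_ : i < size a).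
  by rewrite (perm_mem pa) mem_iota sa; apply.
have f_inj : injective f.
  move=> i j /(congr1 val); rewrite !fE => /eqP.
  by rewrite nth_uniq ?sa ?(perm_uniq pa) // => /eqP/val_inj.
exists (perm f_inj); apply: (@eq_from_nth _ 0) => [|i].
  by rewrite size_map size_enum_ord sa.
rewrite size_map size_enum_ord => lt_i.
by rewrite (nth_code _ (Ordinal lt_i)) permE fE.
Qed.

Definition alt5 : {set {perm 'I_5}} := [set s | even_code (code s)].

Lemma mem_even_codes s : (code s \in even_codes) = (s \in alt5).
Proof. by rewrite [RHS]inE mem_filter mem_permutations perm_code andbT. Qed.

Lemma alt5_group_set : group_set alt5.
Proof.
have closed : all (fun a => all (fun b => even_code (compose a b)) even_codes) even_codes.
  by vm_compute.
apply/group_setP; split=> [|s t].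
  have e1 : code 1 = iota 0 5.
    rewrite -val_enum_ord; apply: eq_map => i; by rewrite perm1.
  by rewrite inE e1; vm_compute.
rewrite [s * t \in _]inE codeM -!mem_even_codes => Es Et.
exact: (allP (allP closed _ Es)).
Qed.
Canonical alt5_group := Group alt5_group_set.

Lemma codes_alt5 : perm_eq [seq code s | s in alt5] even_codes.
Proof.
apply: uniq_perm; first by rewrite map_inj_uniq ?enum_uniq //; apply: code_inj.
  by rewrite filter_uniq ?permutations_uniq.
move=> a; apply/mapP/idP=> [[s + ->] | Ea].
  by rewrite mem_enum mem_even_codes.
have [s Ds] : exists s, code s = a.
  by apply: code_onto; move: Ea; rewrite mem_filter mem_permutations => /andP[].
by exists s; rewrite // mem_enum -mem_even_codes Ds.
Qed.

Lemma card_alt5 : #|alt5| = 60.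
Proof.
by rewrite cardE -(size_map code) (perm_size codes_alt5); vm_compute.
Qed.

(** By orbit counting it is enough that 300 pairs of elements commute. *)
Lemma card_classes_alt5 : #|classes alt5| = 5.
Proof.
have sumE (F : seq nat -> nat) :
    \sum_(a in alt5) F (code a) = sumn (map F even_codes).
  rewrite sumnE big_map -(perm_big _ codes_alt5) big_map big_enum_cond.
  by apply: eq_bigl => a; rewrite andbT.
have: \sum_(a in alt5) #|'C_alt5[a]| = 300.
  pose F a b : nat := compose a b == compose b a.
  transitivity (\sum_(a in alt5) \sum_(b in alt5) F (code a) (code b)).
    apply: eq_bigr => a _; rewrite -sum1_card big_mkcond /=.
    rewrite [RHS]big_mkcond; apply: eq_bigr => b _; rewrite inE.
    case: (b \in alt5) => //=; rewrite cent1C; apply/esym.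
    rewrite /F -!codeM (inj_eq code_inj) (sameP cent1P eqP).
    by case: eqP.
  rewrite (eq_bigr (fun a => sumn (map (F (code a)) even_codes))) => [|a _].
    by rewrite (sumE (fun a => sumn (map (F a) even_codes))); vm_compute.
  exact: (sumE (F (code a))).
have acts : [acts alt5, on alt5 | 'J] by rewrite astabsJ normG.
rewrite (eq_bigr (fun a => #|'Fix_(alt5 | 'J)[a]|)) => [|a _]; last first.
  by rewrite -afix_cycle afixJ cent_cycle.
rewrite (Frobenius_Cauchy acts) card_alt5 => /eqP.
by rewrite -[300%N]/(5 * 60)%N eqn_pmul2r // => /eqP.
Qed.

Lemma sum_four_squares_59 a b c d : 0 < a -> 0 < b -> 0 < c -> 0 < d ->
  (a ^ 2 + b ^ 2 + c ^ 2 + d ^ 2 = 59)%N -> perm_eq [:: a; b; c; d] [:: 3; 3; 4; 5].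
Proof.
have check : all (fun a => all (fun b => all (fun c => all (fun d =>
      (a ^ 2 + b ^ 2 + c ^ 2 + d ^ 2 == 59)%N ==>
      perm_eq [:: a; b; c; d] [:: 3; 3; 4; 5])
    (iota 1 7)) (iota 1 7)) (iota 1 7)) (iota 1 7).
  by vm_compute.
move=> a0 b0 c0 d0 sum59.
have bound x : 0 < x -> (x ^ 2 <= 59)%N -> x \in iota 1 7.
  move=> x0 le59; rewrite mem_iota x0 /= ltnNge; apply: contraL le59 => x8.
  by rewrite -ltnNge (@leq_trans (8 ^ 2)%N) // leq_exp2r.
have /allP/(_ a) := check; rewrite bound //; last first.
  by rewrite -sum59 -!addnA leq_addr.
move/(_ isT)/allP/(_ b); rewrite bound //; last first.
  by rewrite -sum59 -addnA addnAC addnA addnC leq_addr.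
move/(_ isT)/allP/(_ c); rewrite bound //; last first.
  by rewrite -sum59 addnAC leq_addl.
move/(_ isT)/allP/(_ d); rewrite bound //; last first.
  by rewrite -sum59 leq_addl.
by move/(_ isT)/implyP; apply; apply/eqP.
Qed.

(** Five classes leave four nonprincipal degrees, whose squares have sum 59. *)
Lemma degrees_alt5 :
  perm_eq [seq chi_degree i | i : Iirr alt5_group] [:: 1; 3; 3; 4; 5]%N.
Proof.
set s := [seq _ | i : _].
have size_s : size s = 5 by rewrite size_image card_ord NirrE card_classes_alt5.
have sum_s : sumn [seq (d ^ 2)%N | d <- s] = 60.
  rewrite sumnE big_map big_image /= -card_alt5; apply/eqP.
  rewrite -(eqr_nat algC) -irr_sum_square natr_sum; apply/eqP/eq_bigr => i _.
  by rewrite natrX chi_degreeE.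
have pos_s : all (leq 1) s by apply/allP=> _ /imageP[i _ ->]; apply: chi_degree_gt0.
have head_s : head 0%N s = 1%N.
  rewrite /s /image_mem enum_ordSl /=; apply/eqP.
  by rewrite -(eqr_nat algC) chi_degreeE irr0 cfun11.
case: s size_s sum_s pos_s head_s => [|x [|a [|b [|c [|d [|? ?]]]]]] //= _ + + x1.
rewrite x1 addn0 !addnA add1n => - [sum59] /and5P[_ a0 b0 c0 /andP[d0 _]].
by rewrite perm_cons sum_four_squares_59.
Qed.

End AlternatingGroup.

(** * A nonsolvable group whose graph is a star *)

(** The principal character is the only linear one, so the group is perfect. *)
Lemma alt5_nonsolvable : ~~ solvable alt5.
Proof.
apply/negP=> solA; have nA1 : alt5 != 1%g.
  by apply/eqP => A1; have := card_alt5; rewrite A1 cards1.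
have := sol_der1_proper solA (subxx _) nA1.
rewrite properEneq der_sub andbT => /eqP[]; apply/eqP.
rewrite eqEsubset der_sub -indexg_eq1 -card_lin_irr.
have -> : #|[pred i : Iirr alt5_group | 'chi_i \is a linear_char]| =
    count_mem 1%N [seq chi_degree i | i : Iirr alt5_group].
  rewrite -sum1_card -sum1_count big_map big_enum_cond; apply: eq_bigl => i /=.
  rewrite [in LHS]inE [LHS]qualifE/= irr_char -chi_degreeE.
  by rewrite -(eqr_nat algC).
by rewrite (seq.permP degrees_alt5).
Qed.

Lemma degree_isog (aT rT : finGroupType) (G : {group aT}) (H : {group rT}) (i : Iirr G) :
  G \isog H -> exists j : Iirr H, chi_degree j = chi_degree i.
Proof.
case/isogP=> f injf /= fG; have isoGH : isom G H f by apply/isomP.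
by exists (isom_Iirr isoGH i); apply: chi_degree_eq; rewrite isom_IirrE cfIsom1.
Qed.

Section ProductDegrees.
Variables (aT rT : finGroupType) (A : {group aT}) (B : {group rT}).

Lemma degree_setX (i : Iirr A) (j : Iirr B) :
  exists k : Iirr (setX A B)%G, chi_degree k = (chi_degree i * chi_degree j)%N.
Proof.
have [i' <-] := degree_isog (H := (setX A [1 rT])%G) i (isog_setX1 _ A).
have [j' <-] := degree_isog (H := (setX [1 aT] B)%G) j (isog_set1X _ B).
exists (dprod_Iirr (setX_dprod A B) (i', j')).
apply: chi_degreeM.
by rewrite dprod_IirrE cfDprod1 chi_degreeE.
Qed.

Lemma degree_setX_inv (k : Iirr (setX A B)%G) :
  exists i : Iirr A, exists j : Iirr B, chi_degree k = (chi_degree i * chi_degree j)%N.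
Proof.
have [[i' j'] Dk]: exists ij, k = dprod_Iirr (setX_dprod A B) ij.
  by exists (inv_dprod_Iirr (setX_dprod A B) k); rewrite inv_dprod_IirrK.
have [i Di] := degree_isog i' (isog_symr (isog_setX1 _ A)).
have [j Dj] := degree_isog j' (isog_symr (isog_set1X _ B)).
exists i, j; rewrite Di Dj Dk; apply: chi_degreeM.
by rewrite dprod_IirrE cfDprod1 chi_degreeE.
Qed.
End ProductDegrees.

Lemma nonabelian_pgroup_degree (gT : finGroupType) (G : {group gT}) (p : nat) :
  p.-group G -> ~~ abelian G -> exists i : Iirr G, (p %| chi_degree i)%N.
Proof.
move=> pG; rewrite (sameP (char_abelianP G) forallP) => /forallPn[i nlin].
by exists i; apply: pgroup_nonlinear_degree.
Qed.

Lemma star_connected (D : sgraph) (c : D) :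
  (forall x, x != c -> edge x c) -> connected_graph D.
Proof.
move=> toc; have conn x : connect (@edge D) x c.
  by have [-> | /toc/connect1] := eqVneq x c.
move=> x y; apply: connect_trans (conn x) _.
by rewrite (sym_connect_sym (@edge_sym D)).
Qed.

(** Two leaves could only be matched with the same centre. *)
Lemma star_no_perfect_matching (D : sgraph) (c a b : D) :
    (forall x y, edge x y -> x = c \/ y = c) ->
  a != c -> b != c -> a != b -> ~ has_perfect_matching D.
Proof.
move=> star ac bc ab [M [[/subsetP sME _] M1]].
have leaf t v : t \in M -> v \in t -> v != c -> t = [set v; c].
  move=> /sME/imsetP[[x y] + ->]; rewrite !inE /= => /star.
  by case=> -> /orP[] /eqP-> //; rewrite ?eqxx // setUC.
have matched v : v != c -> [set v; c] \in M.
  move=> vc; have /card_gt0P[t]: (0 < #|[set t in M | v \in t]|)%N by rewrite M1.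
  by rewrite inE => /andP[Mt vt]; rewrite -(leaf t v).
have /eqP/cards1P[t Dt] := M1 c.
have eqt v : v != c -> [set v; c] = t.
  move=> vc; apply/set1P; rewrite -Dt !inE matched //= eqxx orbT //.
have: a \in [set b; c] by rewrite (eqt b bc) -(eqt a ac) set21.
by rewrite !inE (negPf ab) (negPf ac).
Qed.

Local Notation alt5_times_7 := (setX alt5_group 7^{1+2})%G.

(** The degrees of the second factor are powers of 7, so prime factors other than 7
come from a single degree of the first. *)
Lemma alt5_times_7_degree n : degree_divisor alt5_times_7 n ->
  exists2 d, d \in [:: 1; 3; 4; 5]%N & exists e, (n %| d * 7 ^ e)%N.
Proof.
case/existsP=> k; have [i [j ->]] := degree_setX_inv k.
have /p_natP[e ->] := pgroup_degree j (pX1p2_pgroup (isT : prime 7)) => nd.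
exists (chi_degree i); last by exists e.
have: chi_degree i \in [seq chi_degree i | i : Iirr alt5_group].
  exact: image_f.
by rewrite (perm_mem degrees_alt5) !inE; case/or4P => [->|->|->|/orP[]->]; rewrite ?orbT.
Qed.

Lemma alt5_times_7_dvd d : d \in [:: 1; 3; 4; 5]%N ->
  degree_divisor alt5_times_7 (d * 7).
Proof.
move=> Dd; have: d \in [seq chi_degree i | i : Iirr alt5_group].
  rewrite (perm_mem degrees_alt5); move: Dd; rewrite !inE.
  by case/or4P=> ->; rewrite ?orbT.
case/imageP=> i _ ->.
have [j pj] := nonabelian_pgroup_degree (pX1p2_pgroup (isT : prime 7))
  (extraspecial_nonabelian (pX1p2_extraspecial (isT : prime 7))).
have [k Dk] := degree_setX i j.
by apply/existsP; exists k; rewrite Dk dvdn_mul.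
Qed.

Lemma mem_rho_alt5_times_7 : rho alt5_times_7 =i [:: 2; 3; 5; 7]%N.
Proof.
move=> p; rewrite mem_rho degree_divisor_cd.
apply/andP/idP=> [[pr_p /alt5_times_7_degree[d Dd [e]]] | ].
  rewrite Euclid_dvdM // Euclid_dvdX // => p_div.
  have: p \in primes (3 * 4 * 5 * 7).
    rewrite mem_primes pr_p /=.
    case/orP: p_div => [p_d | /andP[p_7 _]]; last exact: dvdn_mull.
    apply/dvdn_mulr/(dvdn_trans p_d).
    by move: Dd; rewrite !inE; case/or4P=> /eqP->.
  by rewrite (_ : primes _ = [:: 2; 3; 5; 7]%N).
rewrite !inE => Dp.
have [d [pr_p Dd pd]]: exists d, [/\ prime p, d \in [:: 1; 3; 4; 5]%N & (p %| d * 7)%N].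
  by case/or4P: Dp => /eqP->; [exists 4%N | exists 3%N | exists 5%N | exists 1%N].
split=> //; have /existsP[k dk] := alt5_times_7_dvd Dd.
by apply/existsP; exists k; apply: dvdn_trans dk.
Qed.

Lemma degree_divisor_alt5_times_7 p q :
    p \in [:: 2; 3; 5; 7]%N -> q \in [:: 2; 3; 5; 7]%N -> p != q ->
  degree_divisor alt5_times_7 (p * q) = ((p == 7) || (q == 7))%N.
Proof.
have spoke r : r \in [:: 2; 3; 5]%N -> degree_divisor alt5_times_7 (r * 7).
  rewrite !inE => /or3P[] /eqP->.
  - have /existsP[k dk] := alt5_times_7_dvd (isT : 4 \in [:: 1; 3; 4; 5]%N).
    by apply/existsP; exists k; apply: dvdn_trans dk.
  - exact: (@alt5_times_7_dvd 3).
  - exact: (@alt5_times_7_dvd 5).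
have no_edge r : coprime r 7 -> all (fun d => ~~ (r %| d))%N [:: 1; 3; 4; 5]%N ->
    degree_divisor alt5_times_7 r = false.
  move=> co /allP nd; case dr: (degree_divisor _ _) => //.
  have [d Dd [e]] := alt5_times_7_degree dr.
  by rewrite Gauss_dvdl ?coprimeXr // (negPf (nd d Dd)).
rewrite !inE => /or4P[] /eqP-> /or4P[] /eqP-> // _; try exact: no_edge.
all: by [apply: spoke | rewrite mulnC; apply: spoke].
Qed.

Lemma edge_alt5_times_7 (x y : char_graph alt5_times_7) :
  x != y -> edge x y = ((val x == 7) || (val y == 7))%N.
Proof.
move=> nxy; rewrite -[edge x y]/(_ && _) nxy degree_divisor_cd.
by rewrite degree_divisor_alt5_times_7 // -mem_rho_alt5_times_7 ?(valP x) ?(valP y).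
Qed.

Lemma alt5_times_7_nonsolvable : ~~ solvable alt5_times_7.
Proof.
apply: contra alt5_nonsolvable => solG.
rewrite (isog_sol (isog_setX1 (7^{1+2})%type alt5_group)).
by apply: solvableS solG; rewrite setXS ?sub1G.
Qed.

Lemma alt5_times_7_graph :
  [/\ connected_graph (char_graph alt5_times_7),
      ~~ odd (graph_order (char_graph alt5_times_7))
    & ~ has_perfect_matching (char_graph alt5_times_7)].
Proof.
have rhoG p : p \in [:: 2; 3; 5; 7]%N -> p \in rho alt5_times_7.
  by rewrite mem_rho_alt5_times_7.
pose c : char_graph alt5_times_7 := SeqSub (rhoG 7 isT).
pose a : char_graph alt5_times_7 := SeqSub (rhoG 2 isT).
pose b : char_graph alt5_times_7 := SeqSub (rhoG 3 isT).
split.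
- by apply: (@star_connected _ c) => x xc; rewrite edge_alt5_times_7 // eqxx orbT.
- rewrite char_graph_order.
  by rewrite (perm_size (uniq_perm (undup_uniq _) _ mem_rho_alt5_times_7)).
apply: (@star_no_perfect_matching _ c a b) => // x y xy.
have nxy : x != y by apply: contraTneq xy => ->; rewrite edge_irr.
move: xy; rewrite edge_alt5_times_7 //.
by case/orP=> /eqP e; [left | right]; apply: val_inj.
Qed.

Theorem theorem4 :
  (forall (gT : finGroupType) (G : {group gT}),
     solvable G -> connected_graph (char_graph G) ->
     (~~ odd (graph_order (char_graph G)) ->
        has_perfect_matching (char_graph G)) /\
     ((forall v : char_graph G, ~ cut_vertex v) ->
        odd (graph_order (char_graph G)) ->
        hypomatchable (char_graph G))) /\
  (exists (gT : finGroupType) (G : {group gT}),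
     [/\ ~~ solvable G,
         connected_graph (char_graph G),
         ~~ odd (graph_order (char_graph G)) &
         ~ has_perfect_matching (char_graph G)]).
Proof.
split=> [gT G solG conn | ].
  have n3 := char_graph_no_independent_triple solG.
  split; first exact: perfect_matching_of_no_independent_triple.
  exact: hypomatchable_of_no_independent_triple.
have [conn even_order no_pm] := alt5_times_7_graph.
exists _, alt5_times_7; split=> //; exact: alt5_times_7_nonsolvable.
Qed.
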